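(* Let $0<\alpha<1$ and $\nu_1,\nu_2>0$, and let $X$ be a real random variable with the asymmetric Student's $t$ probability density function \[ f(x)=\begin{cases} \displaystyle \frac{\alpha}{\alpha^*}K(\nu_1)\bigg[1+\frac{1}{\nu_1}\Big(\frac{x}{2\alpha^*}\Big)^2\bigg]^{-(\nu_1+1)/2}, & x\leq0, \\[10pt] \displaystyle \frac{1-\alpha}{1-\alpha^*}K(\nu_2)\bigg[1+\frac{1}{\nu_2}\Big(\frac{x}{2(1-\alpha^* )}\Big)^2\bigg]^{-(\nu_2+1)/2}, & x>0, \end{cases} \] where $K(\nu)=\Gamma((\nu+1)/2)/\{\sqrt{\pi\nu}\,\Gamma(\nu/2)\}$ and $\alpha^*=\alpha K(\nu_1)/\{\alpha K(\nu_1)+(1-\alpha)K(\nu_2)\}$. Let $\phi_X(t)=\mathbb{E}[\mathrm{e}^{\mathrm{i}tX}]$ be its characteristic function. Then, for $t\in\mathbb{R}$, \[ \phi_X(t)=\mathcal{A}_{\alpha,\nu_1}(t)+ \mathcal{A}_{1-\alpha,\nu_2}(t) +\mathrm{i}\{\mathcal{B}_{1-\alpha,\nu_2}(t)-\mathcal{B}_{\alpha,\nu_1}(t)\}, \] where, for each of the two pairs $(\beta,\nu)=(\alpha,\nu_1)$ (with $\beta^*=\alpha^*$) and $(\beta,\nu)=(1-\alpha,\nu_2)$ (with $\beta^*=1-\alpha^*$), \[ \mathcal{A}_{\beta,\nu}(t)=\frac{2\beta(\beta^*\sqrt{\nu}|t|)^{\nu/2}K_{\nu/2}(2\beta^*\sqrt{\nu}|t|)}{\Gamma(\nu/2)},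 \quad \nu>0, \] \[ \mathcal{B}_{\beta,\nu}(t)=\frac{\pi\beta(\beta^*\sqrt{\nu}|t|)^{\nu/2}\,\mathrm{sgn}(t)}{\cos(\pi\nu/2)\Gamma(\nu/2)}\big\{I_{\nu/2}(2\beta^*\sqrt{\nu}|t|)-\mathbf{L}_{-\nu/2}(2\beta^*\sqrt{\nu}|t|)\big\}, \quad \nu\in(0,\infty)\setminus\{1,3,5,\ldots\}, \] \begin{align*} \mathcal{B}_{\beta,\nu}(t)&=\frac{2\beta}{\sqrt{\pi}}\frac{\Gamma((\nu+1)/2)}{\Gamma(\nu/2)}\mathrm{sgn}(t)\sum_{k=1}^{(\nu+1)/2}\binom{\nu-k}{(\nu-1)/2}\frac{2^{k-\nu-1}}{(k-1)!}\\ &\quad\times\bigg\{(2\beta^*\sqrt{\nu}|t|)^{k-1}\big[\mathrm{e}^{-2\beta^*\sqrt{\nu}|t|}\mathrm{Ei}(2\beta^*\sqrt{\nu}|t|)+(-1)^k\mathrm{e}^{2\beta^*\sqrt{\nu}|t|}\mathrm{Ei}(-2\beta^*\sqrt{\nu}|t|)\big]\\ &\quad-\sum_{j=1}^{k-1}(j-1)!\big[1+(-1)^{k+j}\big](2\beta^*\sqrt{\nu}|t|)^{k-j-1}\bigg\}, \quad \nu\in\{1,3,5,\ldots\}, \end{align*} and at $t=0$ the expressions $\mathcal{A}_{\beta,\nu}(t)$ and $\mathcal{B}_{\beta,\nu}(t)$ are understood as their limits as $t\to0$.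
   Context: $K(\nu)$ (no subscript) is the normalising constant defined in the claim, whereas $K_\nu(x)$ (subscript) is the modified Bessel function of the second kind. For real $\nu$ and $x>0$: $I_\nu(x)=\sum_{k=0}^\infty \frac{(x/2)^{2k+\nu}}{k!\,\Gamma(k+\nu+1)}$ is the modified Bessel function of the first kind; $\mathbf{L}_\nu(x)=\sum_{k=0}^\infty \frac{(x/2)^{2k+\nu+1}}{\Gamma(k+3/2)\,\Gamma(k+\nu+3/2)}$ is the modified Struve function of the first kind (with $1/\Gamma$ taken to be $0$ at the poles of $\Gamma$); and $K_\nu(x)=\int_0^\infty \mathrm{e}^{-x\cosh u}\cosh(\nu u)\,\mathrm{d}u$. $\mathrm{Ei}$ denotes the exponential integral: for $x>0$, $\mathrm{Ei}(x)=-\int_{-x}^\infty \mathrm{e}^{-t}/t\,\mathrm{d}t=\int_{-\infty}^x \mathrm{e}^{t}/t\,\mathrm{d}t$ (Cauchy principal value integrals) and $\mathrm{Ei}(-x)=-\int_x^\infty \mathrm{e}^{-t}/t\,\mathrm{d}t$. The sign function is $\mathrm{sgn}(x)=-1$ for $x<0$, $\mathrm{sgn}(0)=0$, $\mathrm{sgn}(x)=1$ for $x>0$. Empty sums are equal to zero. *)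

(* Defs.v *)
From mathcomp Require Import all_boot all_order all_algebra.
From mathcomp Require Import complex.
From mathcomp Require Import all_classical all_reals all_analysis.

Set Implicit Arguments.
Unset Strict Implicit.
Unset Printing Implicit Defensive.

Import Order.TTheory GRing.Theory Num.Theory.
Import numFieldNormedType.Exports.

Local Open Scope classical_set_scope.
Local Open Scope ring_scope.
Local Open Scope complex_scope.

Section SpecialFunctions.
Context {R : realType}.
Implicit Types x nu : R.

Local Notation mu := (@lebesgue_measure R).

Definition eulerGamma x : R :=
  \int[mu]_(t in `]0, +oo[) (t `^ (x - 1) * expR (- t)).

(* Euler's integral for x > 0, continued to x <= 0 by the functional equation
   Gamma (x + n) = x (x + 1) ... (x + n - 1) Gamma x, where n is the least
   natural number with 0 < x + n.
   At a pole x = 0, -1, -2, ... the product vanishes, so that (since 0^-1 = 0)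
   Gamma x = 0 and 1 / Gamma x = 0, which is the usual convention for
   1 / Gamma. *)
Definition Gamma x : R :=
  let n := if 0 < x then 0%N else (Num.truncn (- x)).+1 in
  eulerGamma (x + n%:R) / \prod_(i < n) (x + i%:R).

Definition cosh x : R := (expR x + expR (- x)) / 2.

(* The Bessel and Struve functions are meant for x > 0. *)
Definition besselI nu x : R :=
  limn (series (fun k : nat =>
    (x / 2) `^ (2 * k%:R + nu) / (k`!%:R * Gamma (k%:R + nu + 1)))).

Definition struveL nu x : R :=
  limn (series (fun k : nat =>
    (x / 2) `^ (2 * k%:R + nu + 1)
      / (Gamma (k%:R + 3 / 2) * Gamma (k%:R + nu + 3 / 2)))).

Definition besselK nu x : R :=
  \int[mu]_(u in `[0, +oo[) (expR (- (x * cosh u)) * cosh (nu * u)).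

(* Ei x = - \int_(-x)^oo e^(-t) / t dt, as a Cauchy principal value at t = 0
   when x > 0; meant for x != 0. *)
Definition Ei x : R :=
  if 0 < x then
    lim ((- (\int[mu]_(t in `[- x, - e]) (expR (- t) / t)
             + \int[mu]_(t in `[e, +oo[) (expR (- t) / t))) @[e --> 0^'+])
  else - \int[mu]_(t in `[- x, +oo[) (expR (- t) / t).

End SpecialFunctions.

Section RandomVariables.
Context d (T : measurableType d) (R : realType) (P : probability T R).

Definition has_pdf (X : {RV P >-> R}) (f : R -> R) : Prop :=
  forall A : set R, measurable A ->
    distribution P X A = (\int[@lebesgue_measure R]_(x in A) (f x)%:E)%E.

Definition cexpectation (Z : T -> R[i]) : R[i] :=
  fine 'E_P[fun w => complex.Re (Z w)] +i* fine 'E_P[fun w => complex.Im (Z w)].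

Definition expi (theta : R) : R[i] := cos theta +i* sin theta.

Definition charfun (X : {RV P >-> R}) (t : R) : R[i] :=
  cexpectation (fun w => expi (t * X w)).

End RandomVariables.

Section AsymmetricStudent.
Context {R : realType}.
Implicit Types alpha beta betas nu t x : R.

Definition Kcst nu : R :=
  Gamma ((nu + 1) / 2) / (Num.sqrt (pi * nu) * Gamma (nu / 2)).

Definition alpha_star alpha nu1 nu2 : R :=
  alpha * Kcst nu1 / (alpha * Kcst nu1 + (1 - alpha) * Kcst nu2).

Definition ast_pdf alpha nu1 nu2 x : R :=
  let alphas := alpha_star alpha nu1 nu2 in
  if x <= 0 then
    alpha / alphas * Kcst nu1 *
      (1 + nu1^-1 * (x / (2 * alphas)) ^+ 2) `^ (- ((nu1 + 1) / 2))
  else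
    (1 - alpha) / (1 - alphas) * Kcst nu2 *
      (1 + nu2^-1 * (x / (2 * (1 - alphas))) ^+ 2) `^ (- ((nu2 + 1) / 2)).

(* In the formulas below betas stands for beta^*. *)
Definition calA_formula beta betas nu t : R :=
  2 * beta * (betas * Num.sqrt nu * `|t|) `^ (nu / 2)
    * besselK (nu / 2) (2 * betas * Num.sqrt nu * `|t|) / Gamma (nu / 2).

Definition calB_generic beta betas nu t : R :=
  pi * beta * (betas * Num.sqrt nu * `|t|) `^ (nu / 2) * Num.sg t
    / (cos (pi * nu / 2) * Gamma (nu / 2))
  * (besselI (nu / 2) (2 * betas * Num.sqrt nu * `|t|)
     - struveL (- (nu / 2)) (2 * betas * Num.sqrt nu * `|t|)).

(* The case nu = n with n an odd natural number; then (n + 1) / 2 = n.+1./2,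
   (n - 1) / 2 = n.-1./2, and no subtraction in nat is truncated. *)
Definition calB_odd beta betas (n : nat) t : R :=
  let nu : R := n%:R in
  let y := 2 * betas * Num.sqrt nu * `|t| in
  2 * beta / Num.sqrt pi * (Gamma ((nu + 1) / 2) / Gamma (nu / 2)) * Num.sg t
  * \sum_(1 <= k < (n.+1./2).+1)
      'C(n - k, n.-1./2)%:R * ((2 : R) ^ (k%:Z - n%:Z - 1) / (k.-1)`!%:R)
      * (y ^+ (k - 1)
           * (expR (- y) * Ei y + (-1) ^+ k * (expR y * Ei (- y)))
         - \sum_(1 <= j < k)
             (j.-1)`!%:R * (1 + (-1) ^+ (k + j)) * y ^+ (k - j - 1)).

Definition calB_formula beta betas nu t : R :=
  let n := Num.truncn nu in
  if (nu == n%:R) && odd n then calB_odd beta betas n t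
  else calB_generic beta betas nu t.

Definition extend_at0 (f : R -> R) t : R :=
  if t == 0 then lim (f s @[s --> 0^']) else f t.

Definition calA beta betas nu : R -> R :=
  extend_at0 (calA_formula beta betas nu).

Definition calB beta betas nu : R -> R :=
  extend_at0 (calB_formula beta betas nu).

End AsymmetricStudent.

(* Main.v *)
Require Import Defs.
From mathcomp Require Import all_boot all_order all_algebra.
From mathcomp Require Import complex.
From mathcomp Require Import all_classical all_reals all_analysis.
From mathcomp Require Import measurable_realfun.
From mathcomp Require Import ring lra zify.

(* Rescaling turns the integrals of the two halves of the density against
   e^(itx) into
     C_a(y) = \int_0^oo cos(yu) (1+u^2)^(-a) du and
     S_a(y) = \int_0^oo sin(yu) (1+u^2)^(-a) du,
   with a = (nu+1)/2 and y = 2 beta^* sqrt(nu) |t|.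
   Writing Gamma(a) (1+u^2)^(-a) as a Laplace integral reduces C_a to a Gaussian
   Fourier transform, whence Basset's formula with K_(a-1/2).
   The functions S_a and S_(a+1) satisfy the system
     S_(a+1)' = (1 - y S_a) / (2a),  y S_a' = (2a-1) S_a - 2a S_(a+1).
   If a is not an integer, so does a multiple of
   y^(a-1/2) (I_(a-1/2) - L_(1/2-a)). For 1 < a < 2 the two solutions agree to
   order y^(2a-1) at 0, where the constants match by the duplication and
   reflection formulas, and this determines the solution; the system then
   carries the identity to all a > 1/2.
   For integer a the recursion starts from
     S_1(y) = (e^(-y) Ei(y) - e^y Ei(-y)) / 2,
   the solution of S'' = S - 1/y that vanishes at 0 and is bounded at
   infinity. *)

Import Order.TTheory GRing.Theory Num.Theory.
Import numFieldNormedType.Exports.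

Local Open Scope classical_set_scope.
Local Open Scope ring_scope.

(** * Integration over ]0, +oo[ *)

(** The cosine transform of e^(-s u^2) is again a Gaussian, but its sine transform is not
    elementary; this is why S_a is characterised by differential equations. The homogeneous system
    is solved by y^m I_m(y) and y^m K_m(y) with m = a - 1/2, of order y^(2a-1) and of order 1 at 0,
    so two solutions have to be compared up to o(y^(2a-1)). For S_a the coefficient of y^(2a-1) is,
    up to sign, the integral of (v - sin v) v^(-2a), which converges at infinity if a > 1 and at 0
    if a < 2: hence the strip 1 < a < 2. At integer a the factor Gamma (1 - a) of the Bessel-Struve
    form has a pole. Changes of variables and exchanges of integrals are carried out for nonnegative
    integrands; hence the recurring 1 - cos, v - sin v, 1 + cos and 1 + s sin. The formulas of the
    claim are matched with the transforms for t different from 0. Continuity of the transforms at 0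
    then yields both the existence of the limits and their values. *)

Section Toolkit.
Context {R : realType}.
Local Notation mu := (@lebesgue_measure R).
Local Notation Rpos := (`]0%R, +oo[%classic : set R).
Implicit Types f g F : R -> R.

(* Wrapping [is_derive], a type class, keeps [apply] from launching a
   proof search on the derivative side conditions. *)
Definition derivative_on (D : set R) F f := forall x, D x -> is_derive x 1 F (f x).
Definition derivative_pos F f := forall x : R, 0 < x -> is_derive x 1 F (f x).

Lemma is_derive1_cts f (x l : R) : is_derive x 1 f l -> {for x, continuous f}.
Proof. by move=> [df _]; exact/differentiable_continuous/derivable1_diffP. Qed.

Lemma is_derive_derivative f (x l : R) : is_derive x 1 f l -> derive1 f x = l.
Proof. by move=> df; rewrite derive1E derive_val. Qed.

Lemma within_cts (a b : R) f : (forall x, a <= x <= b -> {for x, continuous f}) ->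
  {within `[a, b], continuous f}.
Proof.
move=> cf; apply/continuous_in_subspaceT => x; rewrite inE/= in_itv/=.
exact: cf.
Qed.

Lemma itv_FTC2 f F (a b : R) : a < b ->
  (forall x, a <= x <= b -> {for x, continuous f}) ->
  (forall x, a <= x <= b -> is_derive x 1 F (f x)) ->
  (\int[mu]_(x in `[a, b]) (f x)%:E = (F b - F a)%:E)%E.
Proof.
move=> ab cf dF; rewrite EFinB; apply: continuous_FTC2 => //.
- exact: within_cts.
- have cF : {within `[a, b], continuous F}.
    by apply: within_cts => x xab; exact: is_derive1_cts (dF x xab).
  move/continuous_within_itvP : cF => /(_ ab)[_ Fa Fb].
  split => // x; rewrite in_itv/= => /andP[ax xb].
  by have [] := dF x; rewrite ?(ltW ax)// (ltW xb).
- move=> x; rewrite in_itv/= => /andP[ax xb].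
  by apply: is_derive_derivative; apply: dF; rewrite (ltW ax) (ltW xb).
Qed.

Lemma itv_subst F f (G : R -> R) (a b : R) : a < b ->
  (forall x, a <= x <= b -> {for x, continuous f}) ->
  (forall x, a <= x <= b -> is_derive x 1 F (f x)) ->
  (forall x y, a <= x -> x < y -> y <= b -> F x < F y) ->
  (forall y, F a <= y <= F b -> {for y, continuous G}) ->
  (\int[mu]_(x in `[F a, F b]) (G x)%:E =
   \int[mu]_(x in `[a, b]) (G (F x) * f x)%:E)%E.
Proof.
move=> ab cf dF incF cG.
have F'E x : a <= x <= b -> derive1 F x = f x by move=> /dF/is_derive_derivative.
have cF : {within `[a, b], continuous F}.
  by apply: within_cts => x xab; exact: is_derive1_cts (dF x xab).
have [_ cfa cfb] := (continuous_within_itvP f ab).1 (within_cts _ _ _ cf).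
rewrite (@integration_by_substitution_increasing _ F G a b (ltW ab)).
- apply: eq_integral => x; rewrite inE/= in_itv/= => xab.
  by rewrite !fctE F'E.
- move=> x y; rewrite !in_itv/= => /andP[ax xb] /andP[ay yb] xy.
  exact: incF.
- move=> x; rewrite in_itv/= => /andP[ax xb].
  have xab : a <= x <= b by rewrite !ltW.
  rewrite /continuous_at F'E//.
  apply: cvg_trans (cf x xab); apply: near_eq_cvg.
  near=> z; rewrite F'E//.
  by apply/andP; split; near: z; [exact: lt_le_nbhsr|exact: lt_le_nbhsl].
- apply/cvg_ex; exists (f a); apply: cvg_trans cfa; apply: near_eq_cvg.
  near=> z; rewrite F'E//; apply/andP; split => //.
  by near: z; exact: nbhs_right_le.
- apply/cvg_ex; exists (f b); apply: cvg_trans cfb; apply: near_eq_cvg.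
  near=> z; rewrite F'E//; apply/andP; split => //.
  by near: z; exact: nbhs_left_ge.
- move/continuous_within_itvP : cF => /(_ ab)[_ Fa Fb].
  split => // x; rewrite in_itv/= => /andP[ax xb].
  by have [] := dF x; rewrite ?(ltW ax)// (ltW xb).
- exact: within_cts.
Unshelve. all: by end_near. Qed.

(** Improper integrals over D are limits over increasing nondegenerate compact intervals; one notion
    serves both the half-line and the whole line. *)
Definition exhausts (l r : nat -> R) (D : set R) :=
  [/\ {homo l : m n / (m <= n)%N >-> n <= m}, {homo r : m n / (m <= n)%N >-> m <= n},
      (forall n, l n < r n) & D = \bigcup_n [set x | l n <= x <= r n]].

Lemma set_itvccE (a b : R) : [set` `[a, b]] = [set x | a <= x <= b].
Proof. by apply/seteqP; split => x /=; rewrite in_itv. Qed.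

Lemma set_itv0yE : Rpos = [set x : R | 0 < x].
Proof. by apply/seteqP; split => x /=; rewrite in_itv/= andbT. Qed.

Lemma exhausts_gt0 :
  (* Starting at 2 makes the first interval [1/2, 2] nondegenerate; starting at 1 would give
     [1, 1]. *)
  exhausts (fun n => n.+2%:R^-1) (fun n => n.+2%:R) Rpos.
Proof.
have leV m n : (m <= n)%N -> n.+2%:R^-1 <= m.+2%:R^-1 :> R.
  by move=> mn; rewrite lef_pV2 ?posrE// ler_nat !ltnS.
split.
- exact: leV.
- by move=> m n mn; rewrite ler_nat !ltnS.
- by move=> n; rewrite (@lt_trans _ _ 1) ?invf_lt1// ?ltr1n.
- rewrite set_itv0yE; apply/seteqP; split => x /=.
  + move=> x0; exists (maxn (Num.truncn x) (Num.truncn x^-1)) => //=.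
    have xle (z : R) m : (Num.truncn z <= m)%N -> z <= m.+2%:R.
      move=> zm; rewrite (le_trans (ltW (truncnS_gt z)))// ler_nat ltnS.
      exact: leqW.
    rewrite (xle x) ?leq_maxl// andbT -[leRHS]invrK lef_pV2 ?posrE ?invr_gt0//.
    by rewrite xle// leq_maxr.
  + by move=> [n _ /= /andP[+ _]]; apply: lt_le_trans; rewrite invr_gt0.
Qed.

Lemma exhausts_setT : exhausts (fun n => - n.+1%:R) (fun n => n.+1%:R) setT.
Proof.
split.
- by move=> m n mn; rewrite lerN2 ler_nat ltnS.
- by move=> m n mn; rewrite ler_nat ltnS.
- by move=> n; rewrite (@lt_trans _ _ 0)// oppr_lt0.
- apply/seteqP; split => // x _; exists (Num.truncn `|x|) => //=.
  rewrite -ler_norml; exact/ltW/truncnS_gt.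
Qed.

Lemma ge0_integral_exhausts (l r : nat -> R) (D : set R) f : exhausts l r D ->
  (forall x, D x -> {for x, continuous f}) -> (forall x, D x -> 0 <= f x) ->
  (\int[mu]_(x in `[l n, r n]) (f x)%:E)%E @[n --> \oo] -->
    (\int[mu]_(x in D) (f x)%:E)%E.
Proof.
move=> [ll rr lr DE] cf f0.
have DE' : D = \bigcup_n [set` `[l n, r n]].
  by rewrite DE; apply: eq_bigcup => // n _; rewrite set_itvccE.
have inD n x : x \in `[l n, r n] -> D x by move=> xn; rewrite DE'; exists n.
rewrite [in X in _ --> X]DE'; apply: ge0_nondecreasing_set_cvg_integral.
- move=> m n mn; rewrite subsetEset => x /=; rewrite !in_itv/= => /andP[lx xr].
  by rewrite (le_trans (ll _ _ mn))// (le_trans xr)// rr.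
- by move=> n; exact: measurable_itv.
- move=> n; apply/measurable_EFinP; apply: subspace_continuous_measurable_fun => //.
  by apply: within_cts => x xn; apply/cf/(inD n); rewrite in_itv.
- by move=> n x /inD Dx; rewrite lee_fin f0.
Qed.

(** F maps [l n, r n] onto [F (l n), F (r n)], and these images exhaust J because J is convex and F
    maps D onto it. The compact substitution rule makes the two sequences of integrals equal, and
    monotone convergence makes their limits the two sides. *)
Lemma ge0_subst (l r : nat -> R) (D J : set R) F f (G : R -> R) :
  exhausts l r D -> measurable J ->
  derivative_on D F f ->
  (forall x, D x -> {for x, continuous f}) ->
  (forall x, D x -> 0 <= f x) ->
  (forall x y, D x -> D y -> x < y -> F x < F y) ->
  (forall a b y, J a -> J b -> a <= y <= b -> J y) ->
  (forall x, D x -> J (F x)) -> (forall y, J y -> exists2 x, D x & F x = y) ->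
  (forall y, J y -> {for y, continuous G}) -> (forall y, J y -> 0 <= G y) ->
  (\int[mu]_(y in J) (G y)%:E = \int[mu]_(x in D) (G (F x) * f x)%:E)%E.
Proof.
move=> lrD mJ dF cf f0 incF Jitv DJ JD cG G0.
have [ll rr lr DE] := lrD.
have inD n x : l n <= x <= r n -> D x by move=> xn; rewrite DE; exists n.
have Dl n : D (l n) by apply: (inD n); rewrite lexx ltW.
have Dr n : D (r n) by apply: (inD n); rewrite lexx ltW// lr.
have leF x y : D x -> D y -> x <= y -> F x <= F y.
  by move=> Dx Dy; rewrite le_eqVlt => /predU1P[->//|/incF]/(_ Dx Dy)/ltW.
have lrJ : exhausts (F \o l) (F \o r) J.
  split.
  - by move=> m n mn /=; apply: leF => //; exact: ll.
  - by move=> m n mn /=; apply: leF => //; exact: rr.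
  - by move=> n /=; apply: incF.
  - apply/seteqP; split => y.
      move=> /JD[x Dx <-]; move: (Dx); rewrite DE => -[n _ /= /andP[lx xr]].
      by exists n => //=; rewrite !leF.
    by move=> [n _ /=]; apply: Jitv; exact: DJ.
have cGF x : D x -> {for x, continuous (fun x => G (F x) * f x)}.
  move=> Dx; apply: continuousM; last exact: cf.
  apply: (@continuous_comp _ _ _ F G); first exact: is_derive1_cts (dF _ Dx).
  exact/cG/DJ.
have GF0 x : D x -> 0 <= G (F x) * f x.
  by move=> Dx; rewrite mulr_ge0 ?f0//; exact/G0/DJ.
have L := ge0_integral_exhausts _ _ _ _ lrJ cG G0.
have M := ge0_integral_exhausts _ _ _ _ lrD cGF GF0.
apply: (cvg_unique (@ereal_hausdorff R) L); apply: cvg_trans M.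
apply: near_eq_cvg; apply: nearW => n /=.
apply/esym/itv_subst => //.
- by move=> x /inD; exact: cf.
- by move=> x /inD; exact: dF.
- move=> x y lx xy yr; apply: incF => //; apply: (inD n).
    by rewrite lx (le_trans (ltW xy)).
  by rewrite yr (le_trans lx)// ltW.
- by move=> y yF; apply/cG/(Jitv (F (l n)) (F (r n))) => //; exact: DJ.
Qed.

Lemma ge0_integrable (D : set R) f : measurable D -> measurable_fun D f ->
  (forall x, D x -> 0 <= f x) -> (\int[mu]_(x in D) (f x)%:E < +oo)%E ->
  mu.-integrable D (EFin \o f).
Proof.
move=> mD mf f0 fy; apply/integrableP; split; first exact/measurable_EFinP.
apply: le_lt_trans fy; rewrite le_eqVlt; apply/orP; left; apply/eqP; apply: eq_integral => x; rewrite inE => Dx /=.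
by rewrite ger0_norm// f0.
Qed.

Lemma cts_measurable0y f : (forall x : R, 0 < x -> {for x, continuous f}) ->
  measurable_fun Rpos f.
Proof.
move=> cf; apply: open_continuous_measurable_fun; first exact: interval_open.
by move=> x; rewrite inE/= in_itv/= andbT; exact: cf.
Qed.

Lemma cvg_exhausts_gt0 F (l0 l1 : R) :
  F x @[x --> (0:R)^'+] --> l0 -> F x @[x --> +oo] --> l1 ->
  F n.+2%:R - F n.+2%:R^-1 @[n --> \oo] --> l1 - l0.
Proof.
move=> F0 F1.
apply: cvgB.
  apply: (@cvg_comp _ _ _ (fun n : nat => n.+2%:R) F _ +oo) => //.
  have := @cvgr_idn R; rewrite -(@cvg_shiftn 2) => h.
  by under eq_fun do rewrite -addn2.
move/cvg_at_rightP : F0; apply; split => [n|]; first by rewrite invr_gt0.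
have := @cvg_harmonic R; rewrite -(@cvg_shiftn 1) => h.
by apply: cvg_trans h; apply: near_eq_cvg; apply: nearW => n /=; rewrite addn1.
Qed.

(** By monotone convergence the value comes out in the extended reals, so finiteness, and with it
    integrability, is a consequence. [FTC0y] treats signed integrands by dominated convergence and
    has to assume integrability. *)
Lemma ge0_FTC0y f F (l0 l1 : R) :
  (forall x : R, 0 < x -> {for x, continuous f}) ->
  derivative_pos F f -> (forall x : R, 0 < x -> 0 <= f x) ->
  F x @[x --> (0:R)^'+] --> l0 -> F x @[x --> +oo] --> l1 ->
  (\int[mu]_(x in Rpos) (f x)%:E = (l1 - l0)%:E)%E.
Proof.
move=> cf dF f0 F0 F1; pose l n : R := n.+2%:R^-1; pose r n : R := n.+2%:R.
have M : (\int[mu]_(x in `[l n, r n]) (f x)%:E)%E @[n --> \oo] -->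
    (\int[mu]_(x in Rpos) (f x)%:E)%E.
  apply: (ge0_integral_exhausts _ _ _ _ exhausts_gt0) => x.
    by rewrite set_itv0yE; exact: cf.
  by rewrite set_itv0yE; exact: f0.
apply: (cvg_unique (@ereal_hausdorff R) M).
have eqn n : (\int[mu]_(x in `[l n, r n]) (f x)%:E)%E =
    (F (r n) - F (l n))%:E.
  have x0 x : l n <= x <= r n -> 0 < x.
    by move=> /andP[+ _]; apply: lt_le_trans; rewrite invr_gt0.
  have [_ _ lr _] := exhausts_gt0.
  by apply: itv_FTC2 (lr n) _ _ => x /x0; [exact: cf|exact: dF].
rewrite (funext eqn).
apply: cvg_EFin; first exact: nearW.
exact: cvg_exhausts_gt0.
Qed.

Lemma integral_exhausts (l r : nat -> R) (D : set R) f : exhausts l r D ->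
  measurable D -> mu.-integrable D (EFin \o f) ->
  \int[mu]_(x in `[l n, r n]) f x @[n --> \oo] --> \int[mu]_(x in D) f x.
Proof.
move=> [ll rr lr DE] mD intf.
have lrD n : [set` `[l n, r n]] `<=` D by rewrite set_itvccE DE => x; exists n.
apply: fine_cvg; rewrite fineK; last exact: integrable_fin_num.
pose f_ n := ((EFin \o f) \_ [set` `[l n, r n]]).
have eqf n : (\int[mu]_(x in [set` `[l n, r n]]) (EFin \o f) x)%E
    = (\int[mu]_(x in D) f_ n x)%E.
  by rewrite -integral_mkcondr; congr (integral _ _ _); apply/esym/setIidr.
rewrite (funext eqf).
have mfD : measurable_fun D (EFin \o f) by case/integrableP: intf.
apply: (@dominated_cvg _ _ _ mu D mD f_ (EFin \o f) (fun x => `|f x|%:E)).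
- move=> n; apply/(measurable_restrict _ _ _).1 => //.
  by apply: measurable_funS mfD => //; exact: subIsetl.
- move=> x; rewrite DE => -[m _ /= /andP[lx xr]].
  (* Once x has entered the m-th interval, the truncations at x are constant. *)
  apply: cvg_near_cst; near=> n; rewrite /f_ patchE ifT// inE /= in_itv/=.
  have mn : (m <= n)%N by near: n; exact: nbhs_infty_ge.
  by rewrite (le_trans (ll _ _ mn))// (le_trans xr)// rr.
- by [].
- rewrite (_ : (fun x => _) = abse \o (EFin \o f))//.
  exact: integrable_abse.
- move=> n x Dx; rewrite /f_ patchE; case: ifP => _ //=.
  by rewrite normr0 lee_fin.
Unshelve. all: by end_near. Qed.

Lemma FTC0y f F (l0 l1 : R) :
  (forall x : R, 0 < x -> {for x, continuous f}) ->
  derivative_pos F f ->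
  mu.-integrable Rpos (EFin \o f) ->
  F x @[x --> (0:R)^'+] --> l0 -> F x @[x --> +oo] --> l1 ->
  \int[mu]_(x in Rpos) f x = l1 - l0.
Proof.
move=> cf dF intf F0 F1; pose l n : R := n.+2%:R^-1; pose r n : R := n.+2%:R.
have mRpos : measurable Rpos by exact: measurable_itv.
have M := integral_exhausts _ _ _ _ exhausts_gt0 mRpos intf.
apply: (cvg_unique (@Rhausdorff R) M).
have eqn n : \int[mu]_(x in `[l n, r n]) (f x) = F (r n) - F (l n).
  have x0 x : l n <= x <= r n -> 0 < x.
    by move=> /andP[+ _]; apply: lt_le_trans; rewrite invr_gt0.
  have [_ _ lr _] := exhausts_gt0; rewrite /Rintegral.
  by rewrite (itv_FTC2 f F _ _ (lr n) _ _)// => x /x0; [exact: cf|exact: dF].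
rewrite (funext eqn).
exact: cvg_exhausts_gt0.
Qed.

(** Tonelli is applied on the whole plane to f times the indicator of the half-line in each
    variable, since the sign of f is known on the quadrant only. *)
Lemma tonelli0y (f : R -> R -> R) :
  measurable_fun setT (fun z : R * R => f z.1 z.2) ->
  (forall x y : R, 0 < x -> 0 < y -> 0 <= f x y) ->
  (\int[mu]_(x in Rpos) \int[mu]_(y in Rpos) (f x y)%:E =
   \int[mu]_(y in Rpos) \int[mu]_(x in Rpos) (f x y)%:E)%E.
Proof.
move=> mf f0; have mRpos : measurable Rpos by exact: measurable_itv.
(* The indicator is hidden behind three properties, so that simplification cannot unfold it. *)
have [i [mi i1 i0]] : exists i : R -> R, [/\ measurable_fun setT i,
    (forall x, x \in Rpos -> i x = 1) & (forall x, x \notin Rpos -> i x = 0)].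
  exists \1_Rpos; split; first exact: measurable_indic.
    by move=> x xP; rewrite indicE xP.
  by move=> x /negbTE xP; rewrite indicE xP.
pose g z := (f z.1 z.2 * i z.1 * i z.2)%:E.
have g0 z : (0 <= g z)%E.
  rewrite lee_fin; have [z1|/i0 ->] := boolP (z.1 \in Rpos); last by rewrite mulr0 mul0r.
  have [z2|/i0 ->] := boolP (z.2 \in Rpos); last by rewrite mulr0.
  rewrite i1// i1// !mulr1; move: z1 z2; rewrite set_itv0yE !inE; exact: f0.
have mg : measurable_fun setT g.
  apply/measurable_EFinP; apply: measurable_funM; last exact: measurableT_comp.
  by apply: measurable_funM => //; exact: measurableT_comp.
have /= H := @fubini_tonelli _ _ _ _ _ mu mu g mg g0.
transitivity (\int[mu]_x \int[mu]_y g (x, y))%E.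
  rewrite integral_mkcond; apply: eq_integral => x _; rewrite patchE.
  case: ifPn => [/i1|/i0] ix; last by rewrite integral0_eq// => y _; rewrite /g/= ix mulr0 mul0r.
  rewrite integral_mkcond; apply: eq_integral => y _; rewrite patchE /g/= ix mulr1.
  by case: ifPn => [/i1|/i0] ->; rewrite ?mulr1 ?mulr0.
transitivity (\int[mu]_y \int[mu]_x g (x, y))%E; first exact: H.
apply/esym; rewrite integral_mkcond; apply: eq_integral => y _; rewrite patchE.
case: ifPn => [/i1|/i0] iy; last by rewrite integral0_eq// => x _; rewrite /g/= iy mulr0.
rewrite integral_mkcond; apply: eq_integral => x _; rewrite patchE /g/= iy mulr1.
by case: ifPn => [/i1|/i0] ->; rewrite ?mulr1 ?mulr0.
Qed.

End Toolkit.

(** * Derivatives, limits and integrability *)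

Section DerivativeRules.
Context {R : realType}.
Implicit Types (f g : R -> R) (x c a : R).

(** The rules of this section are stated for pointwise lambda terms, the shape that [der_step]
    matches. This one separates computing a derivative from comparing it with the expected
    expression. *)
Lemma der_eq f x a c : is_derive x 1 f a -> a = c -> is_derive x 1 f c.
Proof. by move=> df <-. Qed.

Lemma der_cst x c : is_derive x 1 (fun _ : R => c) 0.
Proof. exact: is_derive_cst. Qed.

Lemma der_id x : is_derive x 1 (fun y : R => y) 1.
Proof. exact: is_derive_id. Qed.

Lemma der_neg f x a : is_derive x 1 f a -> is_derive x 1 (fun y => - f y) (- a).
Proof. by move=> ?; exact: is_deriveN. Qed.

Lemma der_add f g x a b : is_derive x 1 f a -> is_derive x 1 g b ->
  is_derive x 1 (fun y => f y + g y) (a + b).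
Proof. by move=> ? ?; exact: is_deriveD. Qed.

Lemma der_mul f g x a b : is_derive x 1 f a -> is_derive x 1 g b ->
  is_derive x 1 (fun y => f y * g y) (a * g x + f x * b).
Proof.
move=> df dg; have := is_deriveM df dg.
by rewrite /GRing.scale/= addrC (mulrC _ a).
Qed.

Lemma der_comp (h : R -> R) g x a b : is_derive (g x) 1 h a -> is_derive x 1 g b ->
  is_derive x 1 (fun y => h (g y)) (a * b).
Proof. by move=> ? ?; exact: is_derive1_comp. Qed.

Lemma der_expR g x b : is_derive x 1 g b ->
  is_derive x 1 (fun y => expR (g y)) (expR (g x) * b).
Proof. by move=> dg; apply: der_comp => //; exact: is_derive_expR. Qed.

Lemma der_sin g x b : is_derive x 1 g b ->
  is_derive x 1 (fun y => sin (g y)) (cos (g x) * b).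
Proof. by move=> dg; apply: der_comp => //; exact: is_derive_sin. Qed.

Lemma der_cos g x b : is_derive x 1 g b ->
  is_derive x 1 (fun y => cos (g y)) (- sin (g x) * b).
Proof. by move=> dg; apply: (der_comp cos _ _ _ _ (is_derive_cos (g x)) dg). Qed.

Lemma der_powR g x a b : 0 < g x -> is_derive x 1 g b ->
  is_derive x 1 (fun y => g y `^ a) (a * g x `^ (a - 1) * b).
Proof.
by move=> g0 dg; apply: (der_comp (fun z => z `^ a)) => //; exact: is_derive1_powR.
Qed.

Lemma der_exprn g x n b : is_derive x 1 g b ->
  is_derive x 1 (fun y => g y ^+ n) (n%:R * g x ^+ n.-1 * b).
Proof.
move=> dg; have := @is_deriveX R R g n x 1 b dg.
by rewrite exprfctE.
Qed.

Lemma der_inv g x b : g x != 0 -> is_derive x 1 g b ->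
  is_derive x 1 (fun y => (g y)^-1) (- (g x)^-2 * b).
Proof.
move=> g0 dg; exact: (is_deriveV g0 dg).
Qed.

Lemma der_sum n (h : 'I_n -> R -> R) (dh : 'I_n -> R) x :
  (forall i : 'I_n, is_derive x 1 (h i) (dh i)) ->
  is_derive x 1 (fun y => \sum_(i < n) h i y) (\sum_(i < n) dh i).
Proof.
move=> dhE; rewrite (_ : (fun y => _) = \sum_(i < n) h i).
  exact: is_derive_sum.
by apply/funext => y; rewrite fct_sumE.
Qed.

End DerivativeRules.

(** The derivative is an existential variable filled in while the term is traversed. Constants are
    tried first, derivatives of named functions are taken from the context, and [notypeclasses]
    prevents instance search. *)
Ltac der_step := first [notypeclasses refine (der_cst _ _) |
  lazymatch goal with
  | |- is_derive _ _ (fun y => y) _ => exact: der_id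
  | |- is_derive _ _ (fun y => GRing.add (@?f y) (@?g y)) _ => notypeclasses refine (der_add f g _ _ _ _ _)
  | |- is_derive _ _ (fun y => GRing.opp (@?f y)) _ => notypeclasses refine (der_neg f _ _ _)
  | |- is_derive _ _ (fun y => GRing.mul (@?f y) (@?g y)) _ => notypeclasses refine (der_mul f g _ _ _ _ _)
  | |- is_derive _ _ (fun y => GRing.inv (@?g y)) _ => notypeclasses refine (der_inv g _ _ _ _)
  | |- is_derive _ _ (fun y => GRing.exp (@?g y) ?n) _ => notypeclasses refine (der_exprn g _ n _ _)
  | |- is_derive _ _ (fun y => expR (@?g y)) _ => notypeclasses refine (der_expR g _ _ _)
  | |- is_derive _ _ (fun y => sin (@?g y)) _ => notypeclasses refine (der_sin g _ _ _)
  | |- is_derive _ _ (fun y => cos (@?g y)) _ => notypeclasses refine (der_cos g _ _ _)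
  | |- is_derive _ _ (fun y => powR (@?g y) ?a) _ => notypeclasses refine (der_powR g _ a _ _ _)
  | |- is_derive _ _ _ _ => eassumption
  end; cbv beta].
Ltac der_auto := notypeclasses refine (der_eq _ _ _ _ _ _); [repeat der_step|rewrite /=].

(** Continuity is read off differentiability; what remains are the side conditions of the rules for
    inverses and powers. *)
Ltac cts_auto := notypeclasses refine (is_derive1_cts _ _ _ _); der_auto; [..|reflexivity].

Section MeasurableRules.
Context d (T : measurableType d) (R : realType).
Implicit Types (D : set T) (f : T -> R).

Lemma measurable_expR_comp D f : measurable_fun D f -> measurable_fun D (fun x => expR (f x)).
Proof. by move=> mf; exact: measurableT_comp. Qed.

Lemma measurable_sin_comp D f : measurable_fun D f -> measurable_fun D (fun x => sin (f x)).
Proof.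
move=> mf; apply: (@measurableT_comp _ _ _ _ _ _ (@sin R)) => //.
exact: continuous_measurable_fun (@continuous_sin R).
Qed.

Lemma measurable_cos_comp D f : measurable_fun D f -> measurable_fun D (fun x => cos (f x)).
Proof.
move=> mf; apply: (@measurableT_comp _ _ _ _ _ _ (@cos R)) => //.
exact: continuous_measurable_fun (@continuous_cos R).
Qed.

Lemma measurable_powR_comp D f (a : R) : measurable_fun D f ->
  measurable_fun D (fun x => f x `^ a).
Proof.
by move=> mf; apply: (@measurableT_comp _ _ _ _ _ _ (fun w => w `^ a)) => //; exact: measurable_powR.
Qed.

End MeasurableRules.

Ltac meas_step := first [exact: measurable_cst |
  lazymatch goal with
  | |- measurable_fun _ (fun z => fst z) => exact: measurable_fst
  | |- measurable_fun _ (fun z => snd z) => exact: measurable_snd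
  | |- measurable_fun _ (fun z => z) => exact: measurable_id
  | |- measurable_fun _ (fun z => GRing.add (@?f z) (@?g z)) => apply: (@measurable_funD _ _ _ _ f g)
  | |- measurable_fun _ (fun z => GRing.opp (@?f z)) => apply: (@measurable_funN _ _ _ _ f)
  | |- measurable_fun _ (fun z => GRing.mul (@?f z) (@?g z)) => apply: (@measurable_funM _ _ _ _ f g)
  | |- measurable_fun _ (fun z => GRing.exp (@?f z) ?n) => apply: (@measurable_funX _ _ _ _ f n)
  | |- measurable_fun _ (fun z => expR (@?f z)) => apply: (@measurable_expR_comp _ _ _ _ f)
  | |- measurable_fun _ (fun z => powR (@?f z) ?a) => apply: (@measurable_powR_comp _ _ _ _ f a)
  | |- measurable_fun _ (fun z => sin (@?f z)) => apply: (@measurable_sin_comp _ _ _ _ f)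
  | |- measurable_fun _ (fun z => cos (@?f z)) => apply: (@measurable_cos_comp _ _ _ _ f)
  end; cbv beta].

Section Limits.
Context {R : realType}.
Implicit Types (f g : R -> R) (x p t : R).

Lemma squeeze_cvg0 (F : set_system R) {FF : Filter F} f g :
  (\forall x \near F, `|f x| <= g x) -> g x @[x --> F] --> 0 -> f x @[x --> F] --> 0.
Proof.
move=> fg g0; apply: norm_cvg0.
apply: (squeeze_cvgr _ _ g0); last exact: cvg_cst.
by near=> x; rewrite normr_ge0/=; near: x.
Unshelve. all: by end_near. Qed.

Lemma powRV x p : 0 <= x -> (x^-1) `^ p = x `^ (- p).
Proof. by move=> x0; rewrite -powR_inv1// -powRrM mulN1r. Qed.

Lemma powRB1 x p : 0 < x -> x `^ p = x * x `^ (p - 1).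
Proof.
move=> x0; rewrite -[X in X * _]powRr1 ?ltW// -powRD; last first.
  by rewrite (gt_eqF x0) implybT.
by rewrite addrC subrK.
Qed.

Lemma powRDp x p q : 0 < x -> x `^ (p + q) = x `^ p * x `^ q.
Proof. by move=> x0; rewrite powRD// (gt_eqF x0) implybT. Qed.

Lemma cvg_powRN p : 0 < p -> x `^ (- p) @[x --> +oo] --> (0 : R).
Proof.
move=> p0; apply/cvgrPdist_le => e e0; near=> x.
have x0 : 0 < x by near: x; exact: nbhs_pinfty_gt.
rewrite sub0r normrN ger0_norm ?powR_ge0// powRN -[leRHS]invrK lef_pV2 ?posrE ?invr_gt0 ?powR_gt0//.
(* The threshold for x is (1 / e)^(1 / p), beyond which x^p exceeds 1 / e. *)
rewrite -[e^-1](_ : (e^-1 `^ p^-1) `^ p = _); last first.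
  by rewrite -powRrM mulVf ?gt_eqF// powRr1// invr_ge0 ltW.
have ex : e^-1 `^ p^-1 < x by near: x; apply: nbhs_pinfty_gt; exact: num_real.
by apply: ge0_ler_powR; rewrite ?nnegrE ?powR_ge0 ?(ltW p0) ?(ltW x0) ?(ltW ex).
Unshelve. all: by end_near. Qed.

Lemma cvg_1DV : (1 + x)^-1 @[x --> +oo] --> (0 : R).
Proof.
have := @cvg_powRN 1 ltr01; apply: squeeze_cvg0; near=> x.
have x0 : 0 < x by near: x; exact: nbhs_pinfty_gt.
rewrite powR_inv1 ?(ltW x0)// ger0_norm ?invr_ge0 ?addr_ge0 ?(ltW x0)//.
by rewrite lef_pV2 ?posrE ?addr_gt0// lerDr.
Unshelve. all: by end_near. Qed.

Lemma cts_comp_cvg (F : set_system R) {FF : Filter F} f g (l : R) :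
  g x @[x --> F] --> l -> {for l, continuous f} -> f (g x) @[x --> F] --> f l.
Proof. by move=> gl fl; exact: cvg_comp gl fl. Qed.

Lemma cts_powR p x : 0 < x -> {for x, continuous (fun y => y `^ p)}.
Proof. by move=> x0; apply: is_derive1_cts; exact: is_derive1_powR. Qed.

End Limits.

Section RealIntegrable.
Context d (T : measurableType d) (R : realType) (m : {measure set T -> \bar R}).
Variables (D : set T) (mD : measurable D).
Implicit Types f g : T -> R.
Local Notation integrableR f := (m.-integrable D (EFin \o f)).

Lemma integrableRD f g : integrableR f -> integrableR g ->
  integrableR (fun x => f x + g x).
Proof.
move=> If Ig; rewrite (_ : EFin \o _ = ((EFin \o f) \+ (EFin \o g))%E)//.
exact: integrableD.
Qed.

Lemma integrableRB f g : integrableR f -> integrableR g ->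
  integrableR (fun x => f x - g x).
Proof.
move=> If Ig; rewrite (_ : EFin \o _ = ((EFin \o f) \- (EFin \o g))%E)//.
exact: integrableB.
Qed.

Lemma integrableRZl (c : R) f : integrableR f -> integrableR (fun x => c * f x).
Proof.
move=> If; rewrite (_ : EFin \o _ = (fun x => c%:E * (EFin \o f) x)%E)//.
exact: integrableZl.
Qed.

Lemma dominated_integrableR f g : measurable_fun D f -> integrableR g ->
  (forall x, D x -> `|f x| <= g x) -> integrableR f.
Proof.
move=> mf Ig fg; apply: le_integrable Ig => //; first exact/measurable_EFinP.
by move=> x Dx /=; rewrite lee_fin (le_trans (fg x Dx))// ler_norm.
Qed.

Lemma integrableR_EFin f : integrableR f ->
  (\int[m]_(x in D) (f x)%:E = (\int[m]_(x in D) f x)%R%:E)%E.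
Proof. by move=> If; rewrite /Rintegral fineK//; exact: integrable_fin_num. Qed.

End RealIntegrable.
Arguments integrableRD {d T R m D} mD {f g}.
Arguments integrableRB {d T R m D} mD {f g}.
Arguments integrableRZl {d T R m D} mD c {f}.
Arguments dominated_integrableR {d T R m D} mD {f} g.
Arguments integrableR_EFin {d T R m D} mD {f}.

(** * Euler's integral: convergence and functional equation *)

Section Gamma.
Context {R : realType}.
Local Notation mu := (@lebesgue_measure R).
Local Notation Rpos := (`]0%R, +oo[%classic : set R).
Implicit Types x p t : R.

Lemma measurable_Rpos : measurable Rpos.
Proof. exact: measurable_itv. Qed.

Lemma RposP x : Rpos x = (0 < x) :> Prop.
Proof. by rewrite set_itv0yE. Qed.

(** This is p^p e^(1 - p), the maximum of (1 + t)^p e^(-t) over t > -1, reached at 1 + t = p; the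
    bound below is ln z <= z - 1 at z = (1 + t) / p. *)
Definition powexp_cst p : R := expR (1 + p * ln p - p).

Lemma powexp_bound p t : 0 < p -> 0 <= t ->
  (1 + t) `^ p * expR (- t) <= powexp_cst p.
Proof.
move=> p0 t0; have t1 : 0 < 1 + t by rewrite ltr_pwDl.
rewrite /powR gt_eqF// -expRD /powexp_cst ler_expR.
have : ln ((1 + t) / p) <= (1 + t) / p - 1.
  have t1p : -1 < (1 + t) / p - 1 by rewrite ltrBrDl subrr divr_gt0.
  by have := le_ln1Dx t1p; rewrite addrC subrK.
rewrite ln_div ?posrE// => H.
have : p * (ln (1 + t) - ln p) <= p * ((1 + t) / p - 1) by rewrite ler_pM2l.
rewrite [leRHS]mulrBr mulrCA divff ?gt_eqF//; lra.
Qed.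

Definition gammaf x t : R := t `^ (x - 1) * expR (- t).

Lemma cts_gammaf x t : 0 < t -> {for t, continuous (gammaf x)}.
Proof.
by move=> t0; apply: is_derive1_cts; rewrite /gammaf; der_auto; last by []; exact: t0.
Qed.

Lemma gammaf_ge0 x t : 0 <= gammaf x t.
Proof. by rewrite mulr_ge0 ?powR_ge0 ?expR_ge0. Qed.

Lemma gammaf_integrable x : 0 < x -> mu.-integrable Rpos (EFin \o gammaf x).
Proof.
move=> x0; apply: ge0_integrable => //.
- by apply: cts_measurable0y => t; exact: cts_gammaf.
- by move=> t _; exact: gammaf_ge0.
(* A majorant, up to a constant, with the explicit antiderivative (t / (1 + t))^x / x;
   [powexp_bound] trades (1 + t)^(x + 1) for the exponential. *)
pose g t := t `^ (x - 1) * (1 + t) `^ (- (x + 1)).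
have cg t : 0 < t -> {for t, continuous g}.
  move=> t0; have t1 : 0 < 1 + t by rewrite ltr_pwDl// ltW.
  by apply: is_derive1_cts; rewrite /g; der_auto; last by []; [exact: t0|exact: t1].
have g0 t : 0 <= g t by rewrite mulr_ge0 ?powR_ge0.
have intg : (\int[mu]_(t in Rpos) (g t)%:E = (x^-1 - 0)%:E)%E.
  apply: (ge0_FTC0y _ (fun t => x^-1 * (t / (1 + t)) `^ x)) => //.
  - move=> t t0; have t1 : 0 < 1 + t by rewrite ltr_pwDl// ltW.
    der_auto; [exact: divr_gt0|by rewrite gt_eqF|].
    rewrite mul0r add0r 2!mulrA mulVf ?gt_eqF// mul1r powRM ?invr_ge0 ?ltW//.
    rewrite powRV ?ltW// /g.
    rewrite (_ : - (x + 1) = - (x - 1) + - 2%:R); last by ring.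
    rewrite (powRDp (1 + t))// powR_invn ?ltW//; field; exact: lt0r_neq0.
  - rewrite -[X in _ --> X](mulr0 x^-1); apply: cvgMl_tmp.
    apply: (squeeze_cvg0 _ _ (fun t => t `^ x)); last exact: powR_cvg0.
    near=> t; have t0 : 0 < t by near: t; exact: nbhs_right_gt.
    rewrite ger0_norm ?powR_ge0//; have t1 : 0 < 1 + t by rewrite addr_gt0.
    apply: ge0_ler_powR; rewrite ?nnegrE ?(ltW x0) ?(ltW t0) ?divr_ge0 ?(ltW t0) ?(ltW t1)//.
    by rewrite ler_pdivrMr// ler_peMr ?(ltW t0)// lerDl ltW.
  - suff H : (t / (1 + t)) `^ x @[t --> +oo] --> (1 `^ x : R).
      by rewrite powR1 in H; rewrite -[X in _ --> X]mulr1; exact: cvgMl_tmp.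
    apply: (cts_comp_cvg _ (fun y => y `^ x)); last exact: cts_powR.
    have : 1 - (1 + t)^-1 @[t --> +oo] --> (1 - 0 : R).
      by apply: cvgB; [exact: cvg_cst|exact: cvg_1DV].
    rewrite subr0; apply: cvg_trans; apply: near_eq_cvg; near=> t.
    have t0 : 0 < t by near: t; exact: nbhs_pinfty_gt.
    by field; rewrite lt0r_neq0// addr_gt0.
apply: (@le_lt_trans _ _ (\int[mu]_(t in Rpos) (powexp_cst (x + 1) * g t)%:E)%E).
  apply: ge0_le_integral => //.
  - by move=> t _; rewrite lee_fin gammaf_ge0.
  - by apply/measurable_EFinP; apply: cts_measurable0y => t; exact: cts_gammaf.
  - apply/measurable_EFinP; apply: measurable_funM; first exact: measurable_cst.
    exact: (cts_measurable0y _ cg).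
  - move=> t; rewrite RposP => t0; rewrite lee_fin /gammaf /g mulrCA ler_wpM2l ?powR_ge0//.
    have t1 : 0 < 1 + t by rewrite ltr_pwDl// ltW.
    by rewrite powRN ler_pdivlMr ?powR_gt0// mulrC powexp_bound ?addr_gt0 ?ltW.
under eq_integral do rewrite EFinM.
rewrite ge0_integralZl//.
- by rewrite intg -EFinM ltry.
- by apply/measurable_EFinP; apply: cts_measurable0y.
- by move=> t _; rewrite lee_fin.
- by rewrite lee_fin expR_ge0.
Unshelve. all: by end_near. Qed.

Lemma eulerGammaE x : 0 < x ->
  (\int[mu]_(t in Rpos) (gammaf x t)%:E = (eulerGamma x)%:E)%E.
Proof.
move=> x0; rewrite /eulerGamma /Rintegral fineK//.
by apply: integrable_fin_num => //; exact: gammaf_integrable.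
Qed.

(** The difference of the two sides is the integral of the derivative of t^x e^(-t), which vanishes
    at both ends. *)
Lemma eulerGammaS x : 0 < x -> eulerGamma (x + 1) = x * eulerGamma x.
Proof.
move=> x0; have x10 : 0 < x + 1 by rewrite addr_gt0.
have ig := gammaf_integrable _ x0; have ig1 := gammaf_integrable _ x10.
have mRpos := measurable_Rpos.
have xg : \int[mu]_(t in Rpos) (x * gammaf x t) = x * eulerGamma x by rewrite RintegralZl.
have ixg : mu.-integrable Rpos (EFin \o (fun t => x * gammaf x t)).
  exact: integrableRZl.
rewrite -xg; apply/eqP; rewrite eq_sym -subr_eq0 /eulerGamma -RintegralB//; apply/eqP.
rewrite -[RHS](subr0 0); apply: (FTC0y _ (fun t => t `^ x * expR (- t))).
- by move=> t t0; apply: is_derive1_cts; rewrite /gammaf; der_auto; last by []; exact: t0.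
- move=> t t0; der_auto; first exact: t0.
  rewrite /gammaf addrK; ring.
- exact: integrableRB.
- apply: (squeeze_cvg0 _ _ (fun t => t `^ x)); last exact: powR_cvg0.
  near=> t; have t0 : 0 < t by near: t; exact: nbhs_right_gt.
  rewrite ger0_norm ?mulr_ge0 ?powR_ge0 ?expR_ge0//.
  by rewrite ler_piMr ?powR_ge0// expR_le1 oppr_le0 ltW.
- apply: (squeeze_cvg0 _ _ (fun t => powexp_cst (x + 1) * (1 + t)^-1)).
    near=> t; have t0 : 0 < t by near: t; exact: nbhs_pinfty_gt.
    have t1 : 0 < 1 + t by rewrite addr_gt0.
    rewrite ger0_norm ?mulr_ge0 ?powR_ge0 ?expR_ge0// ler_pdivlMr//.
    apply: le_trans (powexp_bound (x + 1) t x10 (ltW t0)).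
    rewrite mulrAC ler_wpM2r ?expR_ge0// [leRHS]powRDp// powRr1 ?(ltW t1)// ler_wpM2r ?(ltW t1)//.
    by apply: ge0_ler_powR; rewrite ?nnegrE ?(ltW x0) ?(ltW t0) ?(ltW t1)// lerDr.
  by rewrite -[X in _ --> X](mulr0 (powexp_cst (x + 1))); apply: cvgMl_tmp; exact: cvg_1DV.
Unshelve. all: by end_near. Qed.

End Gamma.

(** * The Gamma function *)

Section GammaBeta.
Context {R : realType}.
Local Notation mu := (@lebesgue_measure R).
Local Notation Rpos := (`]0%R, +oo[%classic : set R).
Implicit Types (a c m p q x t y : R) (G : R -> R).

Lemma ge0_subst_pos (F f G : R -> R) :
  derivative_pos F f ->
  (forall x : R, 0 < x -> {for x, continuous f}) ->
  (forall x : R, 0 < x -> 0 <= f x) ->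
  (forall x y : R, 0 < x -> x < y -> F x < F y) ->
  (forall x : R, 0 < x -> 0 < F x) ->
  (forall y : R, 0 < y -> exists2 x, 0 < x & F x = y) ->
  (forall y : R, 0 < y -> {for y, continuous G}) ->
  (forall y : R, 0 < y -> 0 <= G y) ->
  (\int[mu]_(y in Rpos) (G y)%:E = \int[mu]_(x in Rpos) (G (F x) * f x)%:E)%E.
Proof.
move=> dF cf f0 incF F0 sF cG G0.
apply: (ge0_subst _ _ _ _ _ _ _ exhausts_gt0 measurable_Rpos).
- by move=> x; rewrite RposP; exact: dF.
- by move=> x; rewrite RposP; exact: cf.
- by move=> x; rewrite RposP; exact: f0.
- by move=> x y; rewrite RposP => x0 _; exact: incF.
- by move=> a b y; rewrite !RposP => a0 _ /andP[+ _]; exact: lt_le_trans.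
- by move=> x; rewrite !RposP; exact: F0.
- by move=> y; rewrite RposP => /sF[x x0 Fx]; exists x => //; rewrite RposP.
- by move=> x; rewrite RposP; exact: cG.
- by move=> x; rewrite RposP; exact: G0.
Qed.

Lemma ge0_subst_scale c G : 0 < c ->
  (forall y : R, 0 < y -> {for y, continuous G}) ->
  (forall y : R, 0 < y -> 0 <= G y) ->
  (\int[mu]_(y in Rpos) (G y)%:E = \int[mu]_(x in Rpos) (G (c * x) * c)%:E)%E.
Proof.
move=> c0 cG G0; apply: (ge0_subst_pos (fun x => c * x) (fun=> c)) => //.
- move=> x x0; der_auto; ring.
- by move=> x _; exact: cvg_cst.
- by move=> x _; exact: ltW.
- by move=> x y _ xy; rewrite ltr_pM2l.
- by move=> x x0; rewrite mulr_gt0.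
- by move=> y y0; exists (y / c); rewrite ?divr_gt0// mulrCA divff ?gt_eqF// mulr1.
Qed.

Lemma ge0_subst_sqr G :
  (forall y : R, 0 < y -> {for y, continuous G}) ->
  (forall y : R, 0 < y -> 0 <= G y) ->
  (\int[mu]_(y in Rpos) (G y)%:E =
   \int[mu]_(x in Rpos) (G (x ^+ 2) * (2 * x))%:E)%E.
Proof.
move=> cG G0; apply: (ge0_subst_pos (fun x => x ^+ 2) (fun x => 2 * x)) => //.
- by move=> x x0; der_auto; rewrite /=; ring.
- move=> x x0; apply: is_derive1_cts; der_auto; reflexivity.
- by move=> x x0; rewrite mulr_ge0// ltW.
- by move=> x y x0 xy; rewrite ltr_pXn2r// nnegrE ltW// (lt_trans x0).
- by move=> x x0; rewrite exprn_gt0.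
- by move=> y y0; exists (Num.sqrt y); rewrite ?sqrtr_gt0// sqr_sqrtr// ltW.
Qed.

Lemma eulerGamma_gt0 x : 0 < x -> 0 < eulerGamma x.
Proof.
move=> x0; rewrite -lte_fin -eulerGammaE//.
(* A lower bound of the integrand on [1, 2]: there 0 <= ln t <= 2, so t^(x-1) >= e^(-2 |x-1|), and
   e^(-t) >= e^(-2). *)
pose c := expR (- (2 * `|x - 1|)) * expR (- 2).
have c0 : 0 < c by rewrite mulr_gt0 ?expR_gt0.
have mI : measurable [set` `[(1:R), 2]] by exact: measurable_itv.
have sI : [set` `[(1:R), 2]] `<=` Rpos.
  by move=> t /=; rewrite !in_itv/= andbT => /andP[+ _]; exact: lt_le_trans.
apply: (@lt_le_trans _ _ (\int[mu]_(t in `[1%R, 2%R]) (c%:E))%E).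
  rewrite integral_cst// mule_gt0 ?lte_fin//=.
  by rewrite lebesgue_measure_itv/= lte_fin ltr1n -EFinD lte_fin subr_gt0 ltr1n.
apply: (@le_trans _ _ (\int[mu]_(t in `[1%R, 2%R]) (gammaf x t)%:E)%E).
  apply: ge0_le_integral => //.
  - by move=> t _; rewrite lee_fin ltW.
  - apply: measurable_funS sI _ => //.
    by apply/measurable_EFinP; apply: cts_measurable0y => t; exact: cts_gammaf.
  - move=> t; rewrite /= in_itv/= => /andP[t1 t2]; rewrite lee_fin /c /gammaf.
    have t0 : 0 < t by rewrite (lt_le_trans _ t1).
    apply: ler_pM; rewrite ?expR_ge0//; last by rewrite ler_expR lerN2.
    rewrite /powR gt_eqF// ler_expR.
    have lt2 : ln t <= 2 by rewrite (le_trans (ltW (ln_sublinear _)))//.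
    have lt0 := ln_ge0 t1.
    apply: (@le_trans _ _ (- (`|x - 1| * ln t))).
      by rewrite lerN2 mulrC ler_wpM2r.
    by rewrite -mulNr ler_wpM2r// lerNl ler_normr lexx orbT.
apply: ge0_subset_integral => //.
- by apply/measurable_EFinP; apply: cts_measurable0y => t; exact: cts_gammaf.
- by move=> t _; rewrite lee_fin gammaf_ge0.
Qed.

Lemma Gamma_pos x : 0 < x -> Gamma x = eulerGamma x.
Proof. by move=> x0; rewrite /Gamma x0 big_ord0 divr1 addr0. Qed.

Lemma Gamma_gt0 x : 0 < x -> 0 < Gamma x.
Proof. by move=> x0; rewrite Gamma_pos// eulerGamma_gt0. Qed.

(** For x <= 0 the shift in [Gamma x] is one more than that in [Gamma (x + 1)]: Euler's integral is
    taken at the same point and the products differ by the factor x. At the poles -1, -2, ... both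
    sides are 0 by convention; at x = 0 the left side is 1 and the right side 0. *)
Lemma GammaS x : x != 0 -> Gamma (x + 1) = x * Gamma x.
Proof.
move=> xn0; have [x0|xle0] := ltP 0 x.
  by rewrite !Gamma_pos ?eulerGammaS// addr_gt0.
have xlt0 : x < 0 by rewrite lt_neqAle xn0.
have E (n : nat) : x * (eulerGamma (x + n.+1%:R) / \prod_(i < n.+1) (x + i%:R)) =
    eulerGamma (x + 1 + n%:R) / \prod_(i < n) (x + 1 + i%:R).
  rewrite big_ord_recl addr0 -natr1 (addrC n%:R) addrA invfM.
  under eq_bigr do rewrite lift0 -natr1 (addrC _%:R) addrA.
  by rewrite mulrCA [x * (_ * _)]mulrA mulfV// mul1r.
rewrite [in RHS]/Gamma ltNge xle0 /= E /Gamma; have [x10|x10] := ltP 0 (x + 1).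
  by rewrite (_ : Num.truncn (- x) = 0%N)//; apply: truncn_def; lra.
rewrite (_ : Num.truncn (- x) = (Num.truncn (- (x + 1))).+1)//.
have x1 : 0 <= - (x + 1) by rewrite oppr_ge0.
have /andP[t1 t2] := truncn_itv x1.
by apply: truncn_def; rewrite -!natr1 in t2 *; lra.
Qed.

Lemma Gamma1 : Gamma (1 : R) = 1.
Proof.
rewrite Gamma_pos//; apply: EFin_inj; rewrite -eulerGammaE//.
transitivity ((0 - (- 1))%:E : \bar R); last by rewrite opprK add0r.
have e1 t : gammaf 1 t = expR (- t) by rewrite /gammaf subrr powRr0 mul1r.
apply: (ge0_FTC0y _ (fun t => - expR (- t))).
- by move=> t t0; exact: cts_gammaf.
- move=> t t0; der_auto; rewrite e1; ring.
- by move=> t _; exact: gammaf_ge0.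
- rewrite -[X in _ --> - X](expR0 R) -[in X in _ --> X](oppr0 R).
  apply: cvgN; apply: (cts_comp_cvg _ expR); last exact: continuous_expR.
  by apply: cvgN; apply: cvg_at_right_filter; exact: cvg_id.
- by rewrite -[X in _ --> X](oppr0 R); apply: cvgN; exact: cvgr_expR.
Qed.

Lemma Gamma_half : Gamma (2^-1 : R) = Num.sqrt pi.
Proof.
have h0 : 0 < 2^-1 :> R by rewrite invr_gt0.
rewrite Gamma_pos//; apply: EFin_inj; rewrite -eulerGammaE//.
rewrite (ge0_subst_sqr (gammaf 2^-1)); last 2 first.
  by move=> y y0; exact: cts_gammaf.
  by move=> y _; exact: gammaf_ge0.
transitivity (\int[mu]_(x in Rpos) (2%:E * (gauss_fun x)%:E))%E.
  apply: eq_integral => x; rewrite inE RposP => x0.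
  rewrite -EFinM; congr EFin; rewrite /gammaf /gauss_fun.
  rewrite (_ : (x ^+ 2) `^ _ = x^-1); last first.
    rewrite -powR_mulrn ?ltW// -powRrM (_ : _ * _ = -1); last by field.
    by rewrite powR_inv1 ?ltW.
  by field; rewrite lt0r_neq0.
rewrite ge0_integralZl//; last 2 first.
  - apply/measurable_EFinP; apply: measurable_funTS; exact: measurable_gauss_fun.
  - by move=> x _; rewrite lee_fin gauss_fun_ge0.
rewrite integral_itv_obnd_cbnd; last first.
  by apply/measurable_EFinP; apply: measurable_funTS; exact: measurable_gauss_fun.
by rewrite integral0y_gauss -EFinM mulrC divfK.
Qed.

Lemma gamma_scale a c : 0 < a -> 0 < c ->
  (\int[mu]_(s in Rpos) (s `^ (a - 1) * expR (- (c * s)))%:E =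
   (Gamma a * c `^ (- a))%:E)%E.
Proof.
move=> a0 c0; have ca0 : 0 < c `^ a by exact: powR_gt0.
have H : (\int[mu]_(s in Rpos) (c `^ a * (s `^ (a - 1) * expR (- (c * s))))%:E =
          (Gamma a)%:E)%E.
  rewrite Gamma_pos// -eulerGammaE// (ge0_subst_scale c (gammaf a))//.
  - apply: eq_integral => x; rewrite inE RposP => x0; congr EFin.
    rewrite /gammaf powRM ?ltW// (powRB1 c a c0); ring.
  - by move=> y y0; exact: cts_gammaf.
  - by move=> y _; exact: gammaf_ge0.
rewrite mulrC EFinM -H powRN.
under [X in (_ * X)%E]eq_integral do rewrite EFinM.
rewrite ge0_integralZl//; last 3 first.
  - apply/measurable_EFinP; apply: cts_measurable0y => s s0.
    by apply: is_derive1_cts; der_auto; last by []; exact: s0.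
  - by move=> s _; rewrite lee_fin mulr_ge0 ?powR_ge0 ?expR_ge0.
  - by rewrite lee_fin ltW.
by rewrite muleA -EFinM mulVf ?gt_eqF// mul1e.
Qed.

(** Gamma (p + q) (1 + w)^(-(p+q)) is the integral of s^(p+q-1) e^(-(1+w)s). Integrating over w
    first leaves Gamma p s^(-p), and then the integrand of Gamma q in s. *)
Lemma beta_integral p q : 0 < p -> 0 < q ->
  (\int[mu]_(w in Rpos) (w `^ (p - 1) * (1 + w) `^ (- (p + q)))%:E =
   (Gamma p * Gamma q / Gamma (p + q))%:E)%E.
Proof.
move=> p0 q0; have pq0 : 0 < p + q by rewrite addr_gt0.
have Gpq := Gamma_gt0 _ pq0.
pose f w s := w `^ (p - 1) * (s `^ (p + q - 1) * expR (- ((1 + w) * s))).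
have f0 w s : 0 <= f w s by rewrite !mulr_ge0 ?powR_ge0 ?expR_ge0.
have mf : measurable_fun setT (fun z : R * R => f z.1 z.2).
  by rewrite /f; repeat meas_step.
have := tonelli0y f mf (fun w s _ _ => f0 w s).
have -> : (\int[mu]_(w in Rpos) \int[mu]_(s in Rpos) (f w s)%:E)%E =
  ((Gamma (p + q))%:E *
   \int[mu]_(w in Rpos) (w `^ (p - 1) * (1 + w) `^ (- (p + q)))%:E)%E.
  rewrite -ge0_integralZl//; last 3 first.
    - apply/measurable_EFinP; apply: cts_measurable0y => s s0.
      apply: is_derive1_cts; der_auto; last by []; [exact: s0|exact: addr_gt0].
    - by move=> w _; rewrite lee_fin mulr_ge0 ?powR_ge0.
    - by rewrite lee_fin ltW.
  apply: eq_integral => w; rewrite inE RposP => w0.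
  rewrite /f; under eq_integral do rewrite EFinM.
  rewrite ge0_integralZl//; last 3 first.
    - apply/measurable_EFinP; apply: cts_measurable0y => s s0.
      by apply: is_derive1_cts; der_auto; last by []; exact: s0.
    - by move=> s _; rewrite lee_fin mulr_ge0 ?powR_ge0 ?expR_ge0.
    - by rewrite lee_fin powR_ge0.
  by rewrite gamma_scale ?addr_gt0// -!EFinM mulrCA.
have -> : (\int[mu]_(s in Rpos) \int[mu]_(w in Rpos) (f w s)%:E)%E =
  (Gamma p * Gamma q)%:E.
  rewrite (Gamma_pos q)// EFinM -eulerGammaE// -ge0_integralZl//; last 3 first.
    - by apply/measurable_EFinP; apply: cts_measurable0y => s; exact: cts_gammaf.
    - by move=> s _; rewrite lee_fin gammaf_ge0.
    - by rewrite lee_fin ltW ?Gamma_gt0.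
  apply: eq_integral => s; rewrite inE RposP => s0.
  transitivity (\int[mu]_(w in Rpos) ((s `^ (p + q - 1) * expR (- s))%:E *
     (w `^ (p - 1) * expR (- (s * w)))%:E))%E.
    apply: eq_integral => w _; rewrite -EFinM; congr EFin; rewrite /f.
    rewrite (_ : - ((1 + w) * s) = - s + - (s * w)); last by ring.
    rewrite expRD; ring.
  rewrite ge0_integralZl//; last 3 first.
    - apply/measurable_EFinP; apply: cts_measurable0y => w w0.
      by apply: is_derive1_cts; der_auto; last by []; exact: w0.
    - by move=> w _; rewrite lee_fin mulr_ge0 ?powR_ge0 ?expR_ge0.
    - by rewrite lee_fin mulr_ge0 ?powR_ge0 ?expR_ge0.
  rewrite gamma_scale// -!EFinM; congr EFin; rewrite /gammaf.
  rewrite (_ : p + q - 1 = (q - 1) + p) ?powRDp//; last by ring.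
  rewrite powRN; field; by rewrite gt_eqF ?powR_gt0.
move=> H; rewrite [X in X%:E]mulrC EFinM -H muleA -EFinM mulVf ?mul1e//.
by rewrite gt_eqF.
Qed.

(** The substitution w = u^2 turns B(1/2, a - 1/2) into twice this integral. *)
Lemma integral_oneDsqr_powR a : 2^-1 < a ->
  (\int[mu]_(u in Rpos) ((1 + u ^+ 2) `^ (- a))%:E =
   (Num.sqrt pi / 2 * Gamma (a - 2^-1) / Gamma a)%:E)%E.
Proof.
move=> ha; have a0 : 0 < a - 2^-1 by rewrite subr_gt0.
have h0 : 0 < 2^-1 :> R by rewrite invr_gt0.
have := beta_integral _ _ h0 a0; rewrite (_ : 2^-1 + (a - 2^-1) = a) ?Gamma_half; last by rewrite addrC subrK.
rewrite (ge0_subst_sqr (fun w => w `^ (2^-1 - 1) * (1 + w) `^ (- a))); last 2 first.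
  move=> w w0; apply: is_derive1_cts; der_auto; last by []; [exact: w0|exact: addr_gt0].
  by move=> w _; rewrite mulr_ge0 ?powR_ge0.
move=> H.
have -> : Num.sqrt pi / 2 * Gamma (a - 2^-1) / Gamma a =
    2^-1 * (Num.sqrt pi * Gamma (a - 2^-1) / Gamma a) by ring.
rewrite EFinM -H -ge0_integralZl//; last 2 first.
- apply/measurable_EFinP; apply: cts_measurable0y => u u0.
  apply: is_derive1_cts; der_auto; last by []; first by rewrite exprn_gt0.
  by rewrite addr_gt0 ?exprn_gt0.
- by move=> u; rewrite RposP => u0; rewrite lee_fin !mulr_ge0 ?powR_ge0 ?ltW.
apply: eq_integral => u; rewrite inE RposP => u0; rewrite -EFinM; congr EFin.
rewrite (_ : (u ^+ 2) `^ _ = u^-1); last first.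
  rewrite -powR_mulrn ?ltW// -powRrM (_ : _ * _ = -1); last by field.
  by rewrite powR_inv1 ?ltW.
by field; rewrite lt0r_neq0.
Qed.

(* The substitution w = z^2, u = (z - 1 / z) / 2 identifies B(m, m) with the
   integral of (1 + u^2)^(- m - 1/2), which is B(1/2, m). *)
Lemma Gamma_duplication m : 0 < m ->
  Num.sqrt pi * Gamma (2 * m) = 2 `^ (2 * m - 1) * Gamma m * Gamma (m + 2^-1).
Proof.
move=> m0.
have h0 : 0 < 2^-1 :> R by rewrite invr_gt0.
have mh0 : 0 < m + 2^-1 by rewrite addr_gt0.
pose G (u : R) := (1 + u ^+ 2) `^ (- (m + 2^-1)).
have sq1 (u : R) : 0 < 1 + u ^+ 2 by rewrite ltr_pwDl// sqr_ge0.
have cG : continuous G.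
  by move=> u; apply: is_derive1_cts; rewrite /G; der_auto; last by []; exact: sq1.
have L : (\int[mu]_u (G u)%:E =
    (Num.sqrt pi * Gamma m / Gamma (m + 2^-1))%:E)%E.
  rewrite ge0_symfun_integralT//; last 2 first.
    by move=> u; exact: powR_ge0.
    by move=> u; rewrite /G /= sqrrN.
  rewrite (_ : [set x | _] = `[0, +oo[%classic); last first.
    by apply/seteqP; split => x/=; rewrite in_itv/= andbT.
  rewrite -integral_itv_obnd_cbnd; last first.
    by apply/measurable_EFinP; apply: cts_measurable0y => u _; exact: cG.
  rewrite integral_oneDsqr_powR ?ltrDr// addrK -EFinM; congr EFin.
  by field; rewrite gt_eqF// Gamma_gt0.
have M : (\int[mu]_u (G u)%:E =
    (2 `^ (2 * m - 1) * (Gamma m * Gamma m / Gamma (m + m)))%:E)%E.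
  rewrite EFinM -beta_integral//.
  rewrite (ge0_subst_sqr (fun w => w `^ (m - 1) * (1 + w) `^ (- (m + m)))); last 2 first.
    move=> w w0; apply: is_derive1_cts; der_auto; last by []; [exact: w0|exact: addr_gt0].
    by move=> w _; rewrite mulr_ge0 ?powR_ge0.
  rewrite -ge0_integralZl//; last 2 first.
  - apply/measurable_EFinP; apply: cts_measurable0y => u u0.
    apply: is_derive1_cts; der_auto; last by []; first by rewrite exprn_gt0.
    by rewrite addr_gt0 ?exprn_gt0.
  - by move=> u; rewrite RposP => u0; rewrite lee_fin !mulr_ge0 ?powR_ge0 ?ltW.
  transitivity (\int[mu]_(z in Rpos) (G ((z - z^-1) / 2) * ((1 + z ^- 2) / 2))%:E)%E.
  apply: (ge0_subst _ _ _ _ _ _ _ exhausts_gt0 measurableT).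
  - move=> z; rewrite RposP => z0; der_auto; first by rewrite gt_eqF.
    by field; rewrite gt_eqF.
  - move=> z; rewrite RposP => z0; apply: is_derive1_cts; der_auto; last by [].
    by rewrite expf_neq0// gt_eqF.
  - by move=> z; rewrite RposP => z0; rewrite divr_ge0// addr_ge0 ?invr_ge0 ?exprn_ge0// ltW.
  - move=> x y; rewrite !RposP => x0 y0 xy; rewrite ltr_pM2r ?invr_gt0//.
    by rewrite ltrB// ltf_pV2 ?posrE.
  - by [].
  - by [].
  (* The preimage of u is the positive root u + r of z^2 - 2uz - 1 = 0, whose inverse is r - u. *)
  - move=> u _; pose r := Num.sqrt (1 + u ^+ 2).
    have r2 : r ^+ 2 = 1 + u ^+ 2 by rewrite sqr_sqrtr// ltW.
    have ru : `|u| < r.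
      by rewrite -(ltr_pXn2r (n := 2)) ?nnegrE ?sqrtr_ge0// r2 real_normK ?num_real// ltrDr.
    have zu : 0 < u + r by have := ler_norm (- u); rewrite normrN; lra.
    exists (u + r); first by rewrite RposP.
    have zu0 : u + r != 0 by rewrite gt_eqF.
    have -> : (u + r)^-1 = r - u.
      by apply: (mulfI zu0); rewrite mulfV//; transitivity (r ^+ 2 - u ^+ 2); [rewrite r2|]; ring.
    by field.
  - by move=> y _; exact: cG.
  - by move=> y _; exact: powR_ge0.
  - apply: eq_integral => z; rewrite inE RposP => z0; rewrite -EFinM; congr EFin.
    have zn0 : z != 0 by rewrite gt_eqF.
    have z2 : 0 < 1 + z ^+ 2 by rewrite addr_gt0 ?exprn_gt0.
    (* In terms of z the base 1 + u^2 is a perfect square, so its power splits into powers of 1 +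
       z^2, of z and of 2; the last one gives the factor 2^(2m-1). *)
    rewrite /G (_ : 1 + _ = ((1 + z ^+ 2) / (2 * z)) ^+ 2); last by field.
    have q0 : 0 < (1 + z ^+ 2) / (2 * z) by rewrite divr_gt0 ?mulr_gt0.
    have -> : (z ^+ 2) `^ (m - 1) = z `^ (2 * m - 1) / z.
      rewrite -powR_mulrn ?(ltW z0)// -powRrM mulrBr mulr1.
      rewrite [in RHS](powRB1 z _ z0) [RHS]mulrC mulKf ?gt_eqF//; congr (_ `^ _); ring.
    rewrite -powR_mulrn ?(ltW q0)// -powRrM (_ : 2%:R * - (m + 2^-1) = - (m + m) - 1); last by field.
    rewrite powRDp// powRN powR_inv1 ?(ltW q0)//.
    rewrite powRM ?(ltW z2) ?invr_ge0 ?mulr_ge0 ?(ltW z0)// powRV ?mulr_ge0 ?(ltW z0)//.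
    rewrite powRM ?(ltW z0)// ![_ `^ (- _)]powRN.
    have -> : 2 `^ (2 * m - 1) = 2 `^ (m + m) / 2 :> R.
      rewrite [in RHS](powRB1 2)// [RHS]mulrC mulKf//; congr (_ `^ _); ring.
    have -> : z `^ (2 * m - 1) = z `^ (m + m) / z.
      rewrite [in RHS](powRB1 z)// [RHS]mulrC mulKf//; congr (_ `^ _); ring.
    by field; rewrite !gt_eqF ?powR_gt0.
have := L; rewrite M => -[].
rewrite (_ : m + m = 2 * m); last by ring.
have g1 : Gamma m != 0 by rewrite gt_eqF ?Gamma_gt0.
have g2 : Gamma (2 * m) != 0 by rewrite gt_eqF ?Gamma_gt0 ?mulr_gt0.
have g3 : Gamma (m + 2^-1) != 0 by rewrite gt_eqF ?Gamma_gt0.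
move=> H; apply: (mulfI g1); apply: (mulIf (invr_neq0 g2)); apply: (mulIf (invr_neq0 g3)).
transitivity (Num.sqrt pi * Gamma m / Gamma (m + 2^-1)); first by field; rewrite g2 g3.
by rewrite -H; field; rewrite g2 g3.
Qed.

End GammaBeta.

(** * Euler's reflection formula *)

Section Reflection.
Context {R : realType}.
Local Notation mu := (@lebesgue_measure R).
Local Notation Rpos := (`]0%R, +oo[%classic : set R).
Implicit Types (c x t : R) (N : nat).

Lemma ge0_integralT_split (f : R -> R) : measurable_fun setT f -> (forall x, 0 <= f x) ->
  (\int[mu]_x (f x)%:E = \int[mu]_(x in Rpos) (f x + f (- x))%:E)%E.
Proof.
move=> mf f0; have mEf : measurable_fun setT (EFin \o f) by exact/measurable_EFinP.
have mfN : measurable_fun setT (fun x => f (- x)).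
  apply: (@measurableT_comp _ _ _ _ _ _ f _ (@GRing.opp R)) => //.
have mRpos := @measurable_Rpos R.
rewrite (_ : setT = `]-oo, 0%R] `|` Rpos); last first.
  apply/seteqP; split => // x _ /=; rewrite !in_itv/= andbT.
  by case: (leP x 0) => ?; [left|right].
rewrite ge0_integral_setU//; last 3 first.
- by apply/measurable_EFinP; exact: measurable_funTS.
- by move=> x _; rewrite lee_fin.
- apply/disj_setPS => x /= []; rewrite !in_itv/= andbT => x0 x1.
  by have := le_lt_trans x0 x1; rewrite ltxx.
have -> : (\int[mu]_(x in `]-oo, 0%R]) (f x)%:E = \int[mu]_(x in Rpos) (f (- x))%:E)%E.
  rewrite [RHS]integral_itv_obnd_cbnd; last first.
    by apply/measurable_EFinP; exact: measurable_funTS.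
  rewrite (@ge0_integration_by_substitution0 _ (fun x => (f (- x))%:E)).
  - by apply: eq_integral => x _; rewrite opprK.
  - exact/measurable_EFinP.
  - by move=> r; rewrite lee_fin.
under [in RHS]eq_integral do rewrite EFinD addeC.
rewrite ge0_integralD//.
- by move=> x _; rewrite lee_fin.
- by apply/measurable_EFinP; exact: measurable_funTS.
- by move=> x _; rewrite lee_fin.
- by apply/measurable_EFinP; exact: measurable_funTS.
Qed.

(* With w = e^v, Gamma x * Gamma (1 - x) = \int w^(x-1) / (1 + w) dw splits into
   logisticL x + logisticL (1 - x); iterating L c + L (c + 1) = 1 / c expands it
   into the partial fractions of pi / sin (pi * x). *)
Definition logisticL c : R := \int[mu]_(v in Rpos) (expR (- (c * v)) / (1 + expR (- v))).

Lemma oneDexpR_gt0 t : 0 < 1 + expR t.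
Proof. by rewrite addr_gt0 ?expR_gt0. Qed.

Lemma cvg_expRN c : 0 < c -> expR (- (c * x)) @[x --> +oo] --> (0 : R).
Proof.
move=> c0; apply/cvgrPdist_le => e e0; near=> x.
rewrite sub0r normrN ger0_norm ?expR_ge0// -[e]lnK// ler_expR.
rewrite lerNl -ler_pdivrMl//; near: x; apply: nbhs_pinfty_ge; exact: num_real.
Unshelve. all: by end_near. Qed.

Lemma expRN_integral c : 0 < c ->
  (\int[mu]_(v in Rpos) (expR (- (c * v)))%:E = (c^-1)%:E)%E.
Proof.
move=> c0; have := gamma_scale 1 c ltr01 c0.
rewrite Gamma1 mul1r powR_inv1 ?ltW// => <-; apply: eq_integral => v _.
by rewrite subrr powRr0 mul1r.
Qed.

Lemma expRN_integrable c : 0 < c ->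
  mu.-integrable Rpos (EFin \o (fun v => expR (- (c * v)))).
Proof.
move=> c0; apply: ge0_integrable => //.
- apply: cts_measurable0y => v _; by cts_auto.
- by rewrite (expRN_integral c c0) ltry.
Qed.

Lemma cts_logistic c t :
  {for t, continuous (fun v => expR (- (c * v)) / (1 + expR (- v)))}.
Proof. by cts_auto; rewrite gt_eqF// oneDexpR_gt0. Qed.

Lemma logistic_integrable c : 0 < c ->
  mu.-integrable Rpos (EFin \o (fun v => expR (- (c * v)) / (1 + expR (- v)))).
Proof.
move=> c0; apply: dominated_integrableR (expRN_integrable c c0) _ => //.
- by apply: cts_measurable0y => v _; exact: cts_logistic.
- move=> v _; rewrite ger0_norm ?divr_ge0 ?expR_ge0 ?(ltW (oneDexpR_gt0 _))//.
  by rewrite ler_pdivrMr ?oneDexpR_gt0// ler_peMr ?expR_ge0// lerDl expR_ge0.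
Qed.

Lemma logisticL_ge0 c : 0 <= logisticL c.
Proof.
by apply: Rintegral_ge0 => v _; rewrite divr_ge0 ?expR_ge0 ?(ltW (oneDexpR_gt0 _)).
Qed.

Lemma logisticLD1 c : 0 < c -> logisticL c + logisticL (c + 1) = c^-1.
Proof.
move=> c0; have c10 : 0 < c + 1 by rewrite addr_gt0.
rewrite /logisticL -RintegralD//; [|exact: logistic_integrable..].
rewrite /Rintegral -[RHS]/(fine (c^-1)%:E) -expRN_integral//; congr fine.
apply: eq_integral => v _; congr EFin.
rewrite (_ : - ((c + 1) * v) = - (c * v) + - v); last by ring.
by rewrite expRD; field; rewrite gt_eqF// oneDexpR_gt0.
Qed.

Lemma logisticL_sum c N : 0 < c -> logisticL c =
  \sum_(n < N) (-1) ^+ n / (c + n%:R) + (-1) ^+ N * logisticL (c + N%:R).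
Proof.
move=> c0; elim: N => [|N IH]; first by rewrite big_ord0 add0r mul1r addr0.
have cN : 0 < c + N%:R by rewrite ltr_pwDl.
have /(canRL (addrK _)) e := logisticLD1 _ cN.
rewrite IH big_ord_recr /= e -natr1 addrA exprS; ring.
Qed.

Lemma logisticL_le c : 0 < c -> logisticL c <= c^-1.
Proof. by move=> c0; rewrite -logisticLD1// lerDl logisticL_ge0. Qed.

Lemma logistic_beta x : 0 < x -> x < 1 ->
  Gamma x * Gamma (1 - x) = logisticL x + logisticL (1 - x).
Proof.
move=> x0 x1; have x10 : 0 < 1 - x by rewrite subr_gt0.
apply: EFin_inj; have := beta_integral _ _ x0 x10.
rewrite (_ : x + (1 - x) = 1) ?Gamma1 ?divr1; last by ring.
move=> <-; rewrite EFinD /logisticL -!integrableR_EFin//; [|exact: logistic_integrable..].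
rewrite -integralD//; [|exact: logistic_integrable..].
transitivity (\int[mu]_v (expR v `^ (x - 1) * (1 + expR v) `^ (- 1) * expR v)%:E)%E.
  apply: (ge0_subst _ _ _ _ expR expR (fun w => w `^ (x - 1) * (1 + w) `^ (- 1))
    exhausts_setT measurable_Rpos).
  - by move=> v _; exact: is_derive_expR.
  - by move=> v _; exact: continuous_expR.
  - by move=> v _; exact: expR_ge0.
  - by move=> v w _ _; rewrite ltr_expR.
  - by move=> a b y; rewrite !RposP => a0 _ /andP[+ _]; exact: lt_le_trans.
  - by move=> v _; rewrite RposP expR_gt0.
  - by move=> y; rewrite RposP => y0; exists (ln y); rewrite ?lnK.
  - move=> y; rewrite RposP => y0; by cts_auto; [exact: y0|exact: addr_gt0].
  - by move=> y _; rewrite mulr_ge0 ?powR_ge0.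
rewrite ge0_integralT_split; last 2 first.
- by repeat meas_step.
- by move=> v; rewrite !mulr_ge0 ?powR_ge0 ?expR_ge0.
apply: eq_integral => v _; rewrite -EFinD; congr EFin.
have e1 w : expR w `^ (x - 1) * (1 + expR w) `^ (-1) * expR w =
    expR (x * w) / (1 + expR w).
  rewrite powR_inv1 ?(ltW (oneDexpR_gt0 _))// mulrAC -expRM -expRD.
  by congr (expR _ / _); ring.
rewrite [X in X + _](e1 v) [X in _ + X](e1 (- v)) [LHS]addrC (mulrN x v); congr (_ + _).
rewrite (_ : x * v = - ((1 - x) * v) + v); last by ring.
rewrite expRD (expRN v); field.
by rewrite expR_eq0 gt_eqF ?oneDexpR_gt0// expRN addrC gt_eqF ?oneDexpR_gt0.
Qed.

Lemma sinDn_pi t N : sin (t + pi * N%:R) = (-1) ^+ N * sin t.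
Proof.
elim: N => [|N IH]; first by rewrite mulr0 addr0 mul1r.
by rewrite -natr1 mulrDr mulr1 addrA sinDpi IH exprS mulN1r mulNr.
Qed.

Lemma sin_npi N : sin (pi * N%:R) = 0 :> R.
Proof. by rewrite -[pi * _]add0r sinDn_pi sin0 mulr0. Qed.

(** Partial sums, symmetric in the poles n and -n, of the expansion of pi / sin (pi * x). *)
Definition csc_sum x N : R :=
  x^-1 + \sum_(n < N) (-1) ^+ n.+1 * ((x + n.+1%:R)^-1 + (x - n.+1%:R)^-1).

Lemma logistic_csc_sum x N : 0 < x -> x < 1 -> (0 < N)%N ->
  `|logisticL x + logisticL (1 - x) - csc_sum x N| <= 2 / N%:R.
Proof.
move=> x0 x1 N0; have x10 : 0 < 1 - x by rewrite subr_gt0.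
(* Taking one term more from L x than from L (1 - x) pairs the poles n and -n, as 1 - x + n = - (x -
   (n + 1)). What remains are the two tails, each at most 1 / N by [logisticL_le]. *)
have -> : csc_sum x N = \sum_(n < N.+1) (-1) ^+ n / (x + n%:R) +
    \sum_(n < N) (-1) ^+ n / (1 - x + n%:R).
  rewrite big_ord_recl /= addr0 expr0 mul1r -addrA; congr (_ + _).
  rewrite -big_split /=; apply: eq_bigr => n _; rewrite /bump /= add1n.
  rewrite (_ : x - n.+1%:R = - (1 - x + n%:R)); last by rewrite -natr1; ring.
  by rewrite invrN exprS; ring.
rewrite {1}(logisticL_sum x N.+1 x0) {1}(logisticL_sum (1 - x) N x10).
set s1 := \sum_(n < N.+1) _; set s2 := \sum_(n < N) _.
rewrite (_ : _ - _ = (-1) ^+ N.+1 * logisticL (x + N.+1%:R) +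
  (-1) ^+ N * logisticL (1 - x + N%:R)); last by ring.
rewrite (le_trans (ler_normD _ _))// !normrM !normrX normrN1 !expr1n !mul1r.
rewrite !ger0_norm ?logisticL_ge0//.
have N0' : 0 < N%:R :> R by rewrite ltr0n.
have h1 : logisticL (x + N.+1%:R) <= N%:R^-1.
  apply: le_trans (logisticL_le _ _) _; first by rewrite addr_gt0.
  have h : N%:R <= x + N.+1%:R by rewrite -natr1; lra.
  by rewrite lef_pV2 ?posrE ?addr_gt0.
have h2 : logisticL (1 - x + N%:R) <= N%:R^-1.
  apply: le_trans (logisticL_le _ _) _; first by rewrite addr_gt0.
  have h : N%:R <= 1 - x + N%:R by lra.
  have p : 0 < 1 - x + N%:R by lra.
  by rewrite lef_pV2 ?posrE.
by rewrite mulrDl mul1r lerD.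
Qed.

Section Dirichlet.
Variables (x : R) (x0 : 0 < x) (x1 : x < 1) (N : nat).

Let M : R := N%:R + 2^-1.
Let K t : R := 2^-1 + \sum_(n < N) cos (n.+1%:R * t).

Lemma dirichlet_kernel t : 2 * sin (t / 2) * K t = sin (M * t).
Proof.
rewrite /K /M; elim: N => [|n IH].
  by rewrite big_ord0 addr0 add0r mulrAC divff// mul1r mulrC.
rewrite big_ord_recr /= addrA mulrDr IH.
have e1 : (n.+1%:R + 2^-1) * t = n.+1%:R * t + t / 2 by field.
have e2 : (n%:R + 2^-1) * t = n.+1%:R * t - t / 2 by rewrite -natr1; field.
by rewrite e1 e2 !sinD sinN cosN; ring.
Qed.

Let xn0 n : x + n.+1%:R != 0.
Proof. by rewrite gt_eqF// addr_gt0. Qed.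
Let xBn0 n : x - n.+1%:R != 0.
Proof. by rewrite lt_eqF// subr_lt0 (lt_le_trans x1)// ler1n. Qed.

(** The product formula for cosines gives this antiderivative of (cos (x * t) - 1) * K t, with H 0 =
    0. Subtracting 1 from the cosine creates a double zero at t = 0, which absorbs the zero of sin
    (t / 2) in the closed form of K. *)
Let H t : R := 2^-1 * (sin (x * t) / x - t) +
  \sum_(n < N) (2^-1 * (sin ((x + n.+1%:R) * t) / (x + n.+1%:R) +
     sin ((x - n.+1%:R) * t) / (x - n.+1%:R)) - sin (n.+1%:R * t) / n.+1%:R).

Lemma der_dirichlet t : is_derive t 1 H ((cos (x * t) - 1) * K t).
Proof.
rewrite /H /K mulrDr mulr_sumr.
der_step.
  der_auto; field; exact: lt0r_neq0.
apply: (der_sum _ _ (fun n : 'I_N => (cos (x * t) - 1) * cos (n.+1%:R * t))) => n.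
der_auto.
have -> : cos ((x + n.+1%:R) * t) = cos (x * t + n.+1%:R * t) by rewrite mulrDl.
have -> : cos ((x - n.+1%:R) * t) = cos (x * t - n.+1%:R * t) by rewrite mulrBl.
rewrite !cosD cosN sinN; field.
by rewrite nat1r xn0 xBn0 pnatr_eq0.
Qed.

(** This is (1 - cos (x * t)) / (2 sin (t / 2)). *)
Let g t := sin (x / 2 * t) ^+ 2 / sin (t / 2).
Let g' t := x * sin (x / 2 * t) * cos (x / 2 * t) / sin (t / 2)
  - sin (x / 2 * t) ^+ 2 * cos (t / 2) / 2 / sin (t / 2) ^+ 2.

Lemma sin_ratio t : 0 < t <= pi -> 0 <= sin (x / 2 * t) <= sin (t / 2) /\ 0 < sin (t / 2).
Proof.
move=> /andP[t0 tpi]; have xt : x / 2 * t < t / 2.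
  by rewrite mulrAC ltr_pM2r// gtr_pMl.
have xt0 : 0 < x / 2 * t by rewrite mulr_gt0// divr_gt0.
have t2 : t / 2 <= pi / 2 by rewrite ler_pM2r.
have p0 := @pi_gt0 R.
split; last by apply: sin_gt0_pi; lra.
apply/andP; split; first by apply: sin_ge0_pi; lra.
by rewrite ltW// ltr_sin// in_itv/=; lra.
Qed.

Lemma der_g t : 0 < t <= pi -> is_derive t 1 g (g' t).
Proof.
move=> /sin_ratio[_ st0]; rewrite /g; der_auto; first by rewrite gt_eqF.
by rewrite /g'; field; rewrite gt_eqF.
Qed.

Lemma g_bound t : 0 < t <= pi -> 0 <= g t <= sin (x / 2 * t).
Proof.
move=> /sin_ratio[/andP[s0 s1] st0]; rewrite /g divr_ge0 ?sqr_ge0 ?(ltW st0)//=.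
by rewrite ler_pdivrMr// expr2 ler_wpM2l.
Qed.

Lemma g'_bound t : 0 < t <= pi -> `|g' t| <= 2.
Proof.
move=> /sin_ratio[/andP[s0 s1] st0].
(* In terms of q the derivative has no denominator left, and 0 <= q <= 1 because sine increases on
   [0, pi / 2] and x < 1. *)
pose q := sin (x / 2 * t) / sin (t / 2).
have q01 : 0 <= q <= 1.
  by rewrite /q divr_ge0 ?(ltW st0)//= ler_pdivrMr// mul1r.
have -> : g' t = q * (x * cos (x / 2 * t)) - q ^+ 2 * (cos (t / 2) / 2).
  by rewrite /g' /q; field; rewrite gt_eqF.
have q2 : 0 <= q ^+ 2 <= 1.
  by case/andP: q01 => q0 q1; rewrite sqr_ge0 expr_le1.
have c1 := cos_max (x / 2 * t); have c2 := cos_max (t / 2).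
rewrite (le_trans (ler_normB _ _))// (_ : 2 = 1 + 1)//.
apply: lerD; rewrite normrM.
  case/andP: q01 => q0 q1; rewrite (ger0_norm q0) -[leRHS]mulr1 ler_pM//.
  by rewrite normrM (ger0_norm (ltW x0)) -[leRHS]mulr1 ler_pM// ltW.
case/andP: q2 => q0 q1; rewrite (ger0_norm q0) -[leRHS]mulr1 ler_pM//.
have h : `|2^-1 : R| <= 1 by rewrite ger0_norm ?invr_ge0//; lra.
by rewrite normrM -[leRHS]mulr1 ler_pM.
Qed.

Let M0 : 0 < M. Proof. by rewrite /M ltr_wpDl. Qed.

(* K is the Dirichlet kernel, and H pi computes csc_sum for H an antiderivative
   of (cos (x * t) - 1) * K t = - g t * sin (M * t). Removing the boundary term
   of one integration by parts leaves Psi, whose derivative is O(1 / M). *)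
Let Psi t := H t - g t * cos (M * t) / M.

Lemma der_Psi t : 0 < t <= pi -> is_derive t 1 Psi (- g' t * cos (M * t) / M).
Proof.
move=> t0; have [_ st0] := sin_ratio t t0.
have dg := der_g t t0; have dH := der_dirichlet t; rewrite /Psi; der_auto.
have -> : (cos (x * t) - 1) * K t = - (g t * sin (M * t)).
  rewrite -dirichlet_kernel (_ : x * t = (x / 2 * t) *+ 2); last by rewrite -mulr_natr; field.
  rewrite cos_mulr2n -mulr_natr cos2sin2 /g; field; exact: lt0r_neq0.
by field; exact: lt0r_neq0.
Qed.

(** The denominator of g vanishes at 0, so the mean value theorem is used on [d, pi]; [Psi_pi_bound]
    then lets d tend to 0. *)
Lemma Psi_variation (d : R) : 0 < d < pi -> `|Psi pi - Psi d| <= 2 * pi / M.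
Proof.
move=> /andP[d0 dpi].
have [||c /andP[dc cpi] ->] := @MVT_segment _ Psi (fun t => - g' t * cos (M * t) / M) d pi (ltW dpi).
- move=> t; rewrite in_itv/= => /andP[dt tpi]; apply: der_Psi.
  by rewrite (lt_trans d0 dt) ltW.
- apply: within_cts => t /andP[dt tpi]; apply: is_derive1_cts (der_Psi t _).
  by rewrite (lt_le_trans d0 dt).
rewrite !bnd_simp in dc cpi.
have c0 : 0 < c <= pi by rewrite (lt_le_trans d0 dc).
rewrite normrM (ger0_norm (_ : 0 <= pi - d)) ?subr_ge0 ?(ltW dpi)//.
rewrite -[leRHS]mulrA [pi / M]mulrC mulrA; apply: ler_pM => //.
- by rewrite subr_ge0 ltW.
- rewrite normrM normfV (ger0_norm (ltW M0)) ler_wpM2r ?invr_ge0 ?(ltW M0)//.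
  by rewrite normrM normrN -[leRHS]mulr1 ler_pM ?g'_bound// cos_max.
- by rewrite gerBl ltW.
Qed.

Lemma cvg_Psi0 : Psi t @[t --> 0^'+] --> 0.
Proof.
rewrite -[X in _ --> X](subr0 0); apply: cvgB.
  have H0 : H 0 = 0.
    rewrite /H !mulr0 sin0 mul0r subrr mulr0 add0r big1// => n _.
    by rewrite !mulr0 sin0 !mul0r addr0 mulr0 subrr.
  by rewrite -[X in _ --> X]H0; apply: cvg_at_right_filter; exact: (is_derive1_cts _ _ _ (der_dirichlet 0)).
apply: (squeeze_cvg0 _ _ (fun t => sin (x / 2 * t) / M)).
  near=> t; have t0 : 0 < t <= pi.
    apply/andP; split; first by near: t; exact: nbhs_right_gt.
    by near: t; apply: nbhs_right_le; exact: pi_gt0.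
  have /andP[g0 g1] := g_bound t t0.
  rewrite normrM normfV (ger0_norm (ltW M0)) ler_wpM2r ?invr_ge0 ?(ltW M0)//.
  by rewrite normrM (ger0_norm g0) (le_trans _ g1)// ler_piMr ?cos_max.
have s0 : sin (x / 2 * 0) / M = 0 by rewrite mulr0 sin0 mul0r.
have cs : {for 0, continuous (fun t => sin (x / 2 * t) / M)} by cts_auto.
by rewrite -[X in _ --> X]s0; apply: cvg_at_right_filter; exact: cs.
Unshelve. all: by end_near. Qed.

Lemma Psi_pi_bound : `|Psi pi| <= 2 * pi / M.
Proof.
apply/ler_addgt0Pr => e e0.
have := cvg_Psi0 => /cvgrPdist_le/(_ _ e0) h.
near (0:R)^'+ => d.
have d0 : 0 < d < pi.
  apply/andP; split; first by near: d; exact: nbhs_right_gt.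
  by near: d; apply: nbhs_right_lt; exact: pi_gt0.
rewrite -(subrK (Psi d) (Psi pi)) (le_trans (ler_normD _ _))// lerD ?Psi_variation//.
have hd : `|0 - Psi d| <= e by near: d; exact: h.
by rewrite sub0r normrN in hd.
Unshelve. all: by end_near. Qed.

Lemma H_pi : H pi = 2^-1 * (sin (pi * x) * csc_sum x N - pi).
Proof.
have e (n : 'I_N) : 2^-1 * (sin ((x + n.+1%:R) * pi) / (x + n.+1%:R) +
     sin ((x - n.+1%:R) * pi) / (x - n.+1%:R)) - sin (n.+1%:R * pi) / n.+1%:R =
   2^-1 * sin (pi * x) * ((-1) ^+ n.+1 * ((x + n.+1%:R)^-1 + (x - n.+1%:R)^-1)).
  have -> : sin (n.+1%:R * pi) = 0 :> R by rewrite mulrC sin_npi.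
  have -> : sin ((x + n.+1%:R) * pi) = (-1) ^+ n.+1 * sin (pi * x).
    by rewrite -sinDn_pi; congr sin; ring.
  have -> : sin ((x - n.+1%:R) * pi) = (-1) ^+ n.+1 * sin (pi * x).
    rewrite [pi * x](_ : _ = (x - n.+1%:R) * pi + pi * n.+1%:R); last by ring.
    by rewrite sinDn_pi mulrA -expr2 sqrr_sign mul1r.
  by rewrite mul0r; ring.
rewrite /H (eq_bigr _ (fun i _ => e i)) -mulr_sumr /csc_sum [x * pi]mulrC; ring.
Qed.

Lemma csc_sum_bound : `|sin (pi * x) * csc_sum x N - pi| <= 20 / M.
Proof.
have -> : sin (pi * x) * csc_sum x N - pi = 2 * (Psi pi + g pi * cos (M * pi) / M).
  by rewrite /Psi H_pi; field; exact: lt0r_neq0.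
(* With pi < 4 the two terms are at most 8 / M and 1 / M; doubling gives 18 / M, rounded up to 20 /
   M. *)
have p4 : pi < 4 :> R by have := @pihalf_lt2 R; rewrite ltr_pdivrMr// -natrM.
have pp : 0 < (pi : R) <= pi by rewrite pi_gt0 lexx.
have /andP[g0 g1] := g_bound pi pp.
have iM : 0 < M^-1 by rewrite invr_gt0.
have b1 : `|g pi * cos (M * pi) / M| <= M^-1.
  rewrite normrM normfV (ger0_norm (ltW M0)) -[leRHS]mul1r ler_pM2r//.
  rewrite normrM (ger0_norm g0) -[leRHS]mulr1 ler_pM ?cos_max//.
  by rewrite (le_trans g1)// sin_le1.
have b2 := Psi_pi_bound.
have b3 : 2 * pi / M <= 8 / M by rewrite ler_pM2r//; lra.
rewrite normrM ger0_norm//; have := ler_normD (Psi pi) (g pi * cos (M * pi) / M).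
lra.
Qed.

End Dirichlet.

Lemma eq0_le_divn (z C : R) : (forall N, (0 < N)%N -> `|z| <= C / N%:R) -> z = 0.
Proof.
move=> h; apply/eqP; rewrite -normr_le0 leNgt; apply/negP => z0.
have N1 := truncnS_gt (C / `|z|); set N := (Num.truncn _).+1 in N1.
have N0 : 0 < N%:R :> R by rewrite ltr0n.
have := h N erefl; rewrite ler_pdivlMr// => h1.
by move: N1; rewrite ltr_pdivrMr// mulrC ltNge h1.
Qed.

Lemma Gamma_reflection x : 0 < x -> x < 1 ->
  Gamma x * Gamma (1 - x) * sin (pi * x) = pi.
Proof.
move=> x0 x1; apply/eqP; rewrite -subr_eq0; apply/eqP.
(* 22 = 2 + 20, from [logistic_csc_sum] and [csc_sum_bound], where M = N + 1/2 is bounded below by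
   N. *)
apply: (eq0_le_divn _ 22) => N N0; rewrite logistic_beta//.
have := logistic_csc_sum _ _ x0 x1 N0; set r := logisticL x + logisticL (1 - x) => h1.
have h2 := csc_sum_bound x x0 x1 N.
have n0 : 0 < N%:R :> R by rewrite ltr0n.
rewrite (_ : r * sin (pi * x) - pi = (r - csc_sum x N) * sin (pi * x) +
  (sin (pi * x) * csc_sum x N - pi)); last by ring.
rewrite (le_trans (ler_normD _ _))// (_ : 22 / N%:R = 2 / N%:R + 20 / N%:R); last by ring.
apply: lerD.
  by rewrite normrM -[leRHS]mulr1 ler_pM// sin_max.
apply: le_trans h2 _; rewrite ler_pM2l// lef_pV2 ?posrE ?addr_gt0// ?invr_gt0//.
by rewrite lerDl invr_ge0.
Qed.

End Reflection.

(** * The cosine transform and Basset's formula *)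

Section Basset.
Context {R : realType}.
Local Notation mu := (@lebesgue_measure R).
Local Notation Rpos := (`]0%R, +oo[%classic : set R).
Implicit Types (a c x y t u s : R).

Lemma RposD (f g : R -> R) : mu.-integrable Rpos (EFin \o f) ->
  mu.-integrable Rpos (EFin \o g) -> mu.-integrable Rpos (EFin \o (fun u => f u + g u)).
Proof. by move=> ? ?; exact: integrableRD. Qed.

Lemma RposB (f g : R -> R) : mu.-integrable Rpos (EFin \o f) ->
  mu.-integrable Rpos (EFin \o g) -> mu.-integrable Rpos (EFin \o (fun u => f u - g u)).
Proof. by move=> ? ?; exact: integrableRB. Qed.

Lemma RposZl c (f : R -> R) : mu.-integrable Rpos (EFin \o f) ->
  mu.-integrable Rpos (EFin \o (fun u => c * f u)).
Proof. by move=> ?; exact: integrableRZl. Qed.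

Lemma der_under (f df : R -> R -> R) (G : R -> R) a :
  (forall y, mu.-integrable Rpos (EFin \o f y)) ->
  (forall u, 0 < u -> derivative_on setT (f^~ u) (df^~ u)) ->
  mu.-integrable Rpos (EFin \o G) ->
  (forall y u, 0 < u -> `|df y u| <= G u) ->
  is_derive a 1 (fun y => \int[mu]_(u in Rpos) f y u) (\int[mu]_(u in Rpos) df a u).
Proof.
move=> intf dfE intG dfG.
have mRpos := @measurable_Rpos R.
have Ia : `]a - 1, a + 1[%classic a by rewrite /= in_itv/=; lra.
have derf y u : Rpos u -> derivable (f^~ u) y 1.
  by rewrite RposP => u0; have [] := dfE u u0 y I.
have d1 y u : Rpos u -> partial1of2 f y u = df y u.
  by rewrite RposP => u0; exact: is_derive_derivative (dfE u u0 y I).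
(* The dominating function has to be nonnegative everywhere, whereas G bounds something on ]0, +oo[
   only. *)
have intnG : mu.-integrable Rpos (EFin \o (fun u => `|G u|)).
  rewrite (_ : EFin \o _ = abse \o (EFin \o G))//.
  exact: integrable_abse.
have ub y u : `]a - 1, a + 1[%classic y -> Rpos u -> `|partial1of2 f y u| <= `|G u|.
  move=> _ Ru; rewrite d1//; move: Ru; rewrite RposP => u0.
  by rewrite (le_trans (dfG _ _ u0))// ler_norm.
split.
  exact: (@derivable_under_integral _ _ _ mu f Rpos mRpos a (a - 1) (a + 1) Ia
    (fun y _ => intf y) (fun y u _ => derf y u) (fun u => `|G u|)
    (fun u => normr_ge0 _) intnG ub).
rewrite -derive1E (@differentiation_under_integral _ _ _ mu f Rpos mRpos a (a - 1) (a + 1) Ia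
    (fun y _ => intf y) (fun y u _ => derf y u) (fun u => `|G u|)
    (fun u => normr_ge0 _) intnG ub).
by apply: eq_Rintegral => u; rewrite inE => Ru; exact: d1.
Qed.

Lemma cvg_right_cts (f : R -> R) (l : R) : {for 0, continuous f} -> f 0 = l ->
  f x @[x --> (0:R)^'+] --> l.
Proof. by move=> cf <-; apply: cvg_at_right_filter; exact: cf. Qed.

Lemma gauss_integrable : mu.-integrable Rpos (EFin \o @gauss_fun R).
Proof.
by apply: integrableS (@integrableT_gauss R) => //; exact: measurable_Rpos.
Qed.

Lemma ugauss_integrable : mu.-integrable Rpos (EFin \o (fun u => u * gauss_fun u)).
Proof.
apply: ge0_integrable => //.
- by apply: cts_measurable0y => t _; rewrite /gauss_fun; cts_auto.
- by move=> u; rewrite RposP => u0; rewrite mulr_ge0 ?gauss_fun_ge0 ?ltW.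
rewrite (_ : (\int[mu]_(x in Rpos) (x * gauss_fun x)%:E)%E = (0 - (- 2^-1))%:E) ?ltry//.
apply: (ge0_FTC0y _ (fun u => - 2^-1 * gauss_fun u)).
- by move=> t _; rewrite /gauss_fun; cts_auto.
- by move=> t _; rewrite /gauss_fun; der_auto; field.
- by move=> u u0; rewrite mulr_ge0 ?gauss_fun_ge0 ?ltW.
- apply: cvg_right_cts; first by rewrite /gauss_fun; cts_auto.
  by rewrite /gauss_fun expr0n oppr0 expR0 mulr1.
- by rewrite -[X in _ --> X](mulr0 (- 2^-1)); apply: cvgMl_tmp; exact: cvg_gauss_fun.
Qed.

Lemma bounded_mul_integrable (D : set R) (f g : R -> R) : measurable D ->
  measurable_fun D f -> mu.-integrable D (EFin \o g) ->
  (forall u, D u -> `|f u| <= 1) ->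
  mu.-integrable D (EFin \o (fun u => f u * g u)).
Proof.
move=> mD mf ig f1.
have mg : measurable_fun D g by case/integrableP: (ig) => /measurable_EFinP.
apply: le_integrable ig => //.
  by apply/measurable_EFinP; exact: measurable_funM.
by move=> u Du /=; rewrite lee_fin normrM -[leRHS]mul1r ler_wpM2r// f1.
Qed.

Lemma measurable_cosM (D : set R) y : measurable_fun D (fun u => cos (y * u)).
Proof.
by apply: measurable_funTS; apply: continuous_measurable_fun => u; cts_auto.
Qed.

Lemma measurable_sinM (D : set R) y : measurable_fun D (fun u => sin (y * u)).
Proof.
by apply: measurable_funTS; apply: continuous_measurable_fun => u; cts_auto.
Qed.

Lemma cos_mul_integrable (g : R -> R) y : mu.-integrable Rpos (EFin \o g) ->
  mu.-integrable Rpos (EFin \o (fun u => cos (y * u) * g u)).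
Proof.
move=> ig; apply: bounded_mul_integrable => //.
  exact: measurable_cosM.
by move=> u _; exact: cos_max.
Qed.

Lemma sin_mul_integrable (g : R -> R) y : mu.-integrable Rpos (EFin \o g) ->
  mu.-integrable Rpos (EFin \o (fun u => sin (y * u) * g u)).
Proof.
move=> ig; apply: bounded_mul_integrable => //.
  exact: measurable_sinM.
by move=> u _; exact: sin_max.
Qed.

(** The transform g satisfies g' = - (y / 2) g: differentiation under the integral produces - u sin
    (y u) e^(-u^2), and [parts] integrates this by parts. So g(y) e^(y^2 / 4) is constant, equal to
    the Gauss integral at y = 0. *)
Lemma gauss_cos y : \int[mu]_(u in Rpos) (cos (y * u) * gauss_fun u) =
  Num.sqrt pi / 2 * expR (- (y ^+ 2 / 4)).
Proof.
pose g (y : R) := \int[mu]_(u in Rpos) (cos (y * u) * gauss_fun u).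
have mRpos := @measurable_Rpos R.
have dg (z : R) : is_derive z 1 g (- (z / 2) * g z).
  have i1 := sin_mul_integrable _ z ugauss_integrable.
  have i2 := cos_mul_integrable _ z gauss_integrable.
  have parts : \int[mu]_(u in Rpos)
      (- (sin (z * u) * (u * gauss_fun u)) + z / 2 * (cos (z * u) * gauss_fun u)) = 0 - 0.
    apply: (FTC0y _ (fun u => 2^-1 * gauss_fun u * sin (z * u))).
    - by move=> u _; rewrite /gauss_fun; cts_auto.
    - by move=> u _; rewrite /gauss_fun; der_auto; field.
    - apply: integrableRD => //; last exact: integrableRZl.
      rewrite (_ : EFin \o _ = EFin \o (fun u => -1 * (sin (z * u) * (u * gauss_fun u)))).
        exact: integrableRZl.
      by apply/funext => u /=; rewrite mulN1r.
    - apply: cvg_right_cts; first by rewrite /gauss_fun; cts_auto.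
      by rewrite mulr0 sin0 mulr0.
    - apply: (squeeze_cvg0 _ _ (@gauss_fun R)); last exact: cvg_gauss_fun.
      near=> u; rewrite normrM -[leRHS]mulr1 ler_pM ?sin_max//.
      rewrite ger0_norm ?mulr_ge0 ?gauss_fun_ge0//.
      by rewrite ler_piMl ?gauss_fun_ge0// invf_le1// ler1n.
  apply: der_eq.
    apply: (der_under _ (fun z u => - (sin (z * u) * (u * gauss_fun u))) _ _ _ _ ugauss_integrable).
    - by move=> w; apply: cos_mul_integrable; exact: gauss_integrable.
    - by move=> u _ w _; der_auto; ring.
    - move=> w u u0; rewrite normrN normrM (ger0_norm (_ : 0 <= u * _)).
        by rewrite -[leRHS]mul1r ler_wpM2r ?sin_max// mulr_ge0 ?gauss_fun_ge0// ltW.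
      by rewrite mulr_ge0 ?gauss_fun_ge0// ltW.
  move: parts; rewrite RintegralD//; last 2 first.
  - rewrite (_ : EFin \o _ = EFin \o (fun u => -1 * (sin (z * u) * (u * gauss_fun u)))).
      exact: integrableRZl.
    by apply/funext => u /=; rewrite mulN1r.
  - exact: integrableRZl.
  rewrite [X in _ + X = _]RintegralZl// subr0 => /eqP; rewrite addr_eq0 => /eqP ->.
  by rewrite mulNr.
pose h (z : R) := g z * expR (z ^+ 2 / 4).
have dh (z : R) : is_derive z 1 h 0.
  by have dgz := dg z; rewrite /h; der_auto; rewrite expr1; field.
have hE : h y = h 0 by exact: (@is_derive_0_is_cst R h y 0 dh).
have h0 : h 0 = Num.sqrt pi / 2.
  rewrite /h expr0n mul0r expR0 mulr1 /g.
  rewrite (@eq_Rintegral _ _ _ mu Rpos (@gauss_fun R)); last first.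
    by move=> u _; rewrite mul0r cos0 mul1r.
  rewrite /Rintegral.
  rewrite integral_itv_obnd_cbnd ?integral0y_gauss//.
  by apply/measurable_EFinP; apply: measurable_funTS; exact: measurable_gauss_fun.
rewrite -h0 -hE /h -mulrA -expRD addrN expR0 mulr1//.
Unshelve. all: by end_near. Qed.

(** The cosine is replaced by the nonnegative 1 - cos, so that scaling by sqrt s here and Tonelli in
    [cosI_Gamma] apply. *)
Lemma gauss_1Bcos s y : 0 < s ->
  (\int[mu]_(u in Rpos) ((1 - cos (y * u)) * expR (- (s * u ^+ 2)))%:E =
   (Num.sqrt pi / 2 * s `^ (- 2^-1) * (1 - expR (- (y ^+ 2 / (4 * s)))))%:E)%E.
Proof.
move=> s0; pose r := s `^ 2^-1; have r0 : 0 < r by exact: powR_gt0.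
have r2 : r ^+ 2 = s.
  by rewrite -powR_mulrn ?ltW// /r -powRrM mulVf// powRr1// ltW.
have mRpos := @measurable_Rpos R.
have ig := @gauss_integrable.
have H z : (\int[mu]_(u in Rpos) ((1 - cos (z * u)) * gauss_fun u)%:E =
    (Num.sqrt pi / 2 * (1 - expR (- (z ^+ 2 / 4))))%:E)%E.
  have ic := cos_mul_integrable _ z ig.
  under eq_integral do rewrite mulrBl mul1r.
  rewrite integrableR_EFin//; last exact: integrableRB.
  rewrite RintegralB// gauss_cos mulrBr mulr1; congr ((_ - _)%:E).
  have := gauss_cos 0; rewrite expr0n mul0r oppr0 expR0 mulr1 => <-.
  by apply: eq_Rintegral => u _; rewrite mul0r cos0 mul1r.
have := H (y / r); rewrite (ge0_subst_scale r) => //.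
- move=> E.
  rewrite (_ : _ * (1 - _) = r^-1 * (Num.sqrt pi / 2 * (1 - expR (- ((y / r) ^+ 2 / 4))))).
    rewrite [RHS]EFinM -E -ge0_integralZl//.
    + apply: eq_integral => u _; rewrite -EFinM; congr EFin.
      rewrite /gauss_fun exprMn r2 mulrA mulfVK ?gt_eqF//.
      field; exact: lt0r_neq0.
    + apply/measurable_EFinP; apply: cts_measurable0y => u _.
      by rewrite /gauss_fun; cts_auto.
    + by move=> u _; rewrite lee_fin !mulr_ge0 ?gauss_fun_ge0 ?subr_ge0 ?cos_le1 ?ltW.
    + by rewrite lee_fin invr_ge0 ltW.
  rewrite powRN -/r -r2 (_ : (y / r) ^+ 2 / 4 = y ^+ 2 / (4 * r ^+ 2)); last first.
    by field; exact: lt0r_neq0.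
  ring.
- by move=> u _; rewrite /gauss_fun; cts_auto.
- by move=> u _; rewrite mulr_ge0 ?gauss_fun_ge0 ?subr_ge0 ?cos_le1.
Qed.

Lemma oneDsqr_gt0 u : 0 < 1 + u ^+ 2.
Proof. by rewrite ltr_pwDl// sqr_ge0. Qed.

Definition tkernel a u : R := (1 + u ^+ 2) `^ (- a).

Lemma tkernel_gt0 a u : 0 < tkernel a u.
Proof. by rewrite powR_gt0// oneDsqr_gt0. Qed.

Lemma cts_tkernel a u : {for u, continuous (tkernel a)}.
Proof. by rewrite /tkernel; cts_auto; exact: oneDsqr_gt0. Qed.

Lemma tkernel_integral a : 2^-1 < a -> \int[mu]_(u in Rpos) tkernel a u =
  Num.sqrt pi / 2 * Gamma (a - 2^-1) / Gamma a.
Proof. by move=> ha; rewrite /Rintegral integral_oneDsqr_powR. Qed.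

Lemma tkernel_integrable a : 2^-1 < a -> mu.-integrable Rpos (EFin \o tkernel a).
Proof.
move=> ha; apply: ge0_integrable => //.
- by apply: cts_measurable0y => u _; exact: cts_tkernel.
- by move=> u _; exact: ltW (tkernel_gt0 a u).
- by rewrite integral_oneDsqr_powR// ltry.
Qed.

Definition cosI a y : R := \int[mu]_(u in Rpos) (cos (y * u) * tkernel a u).
Definition sinI a y : R := \int[mu]_(u in Rpos) (sin (y * u) * tkernel a u).

(** Integrand of the representation K_m(y) = (1/2) (y/2)^(-m) \int_0^oo s^(m-1) e^(-s - y^2/(4s))
    ds. *)
Definition bessel_kernel m y s : R := s `^ (m - 1) * expR (- (s + y ^+ 2 / (4 * s))).

Lemma bessel_kernel_integrable m y : 0 < m -> mu.-integrable Rpos (EFin \o bessel_kernel m y).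
Proof.
move=> m0; apply: dominated_integrableR (gammaf_integrable m m0) _ => //.
- apply: cts_measurable0y => s s0; rewrite /bessel_kernel; cts_auto; first exact: s0.
  by rewrite mulf_neq0// gt_eqF.
- move=> s; rewrite RposP => s0.
  rewrite ger0_norm ?mulr_ge0 ?powR_ge0 ?expR_ge0// ler_wpM2l ?powR_ge0//.
  by rewrite ler_expR lerN2 lerDl divr_ge0 ?sqr_ge0 ?mulr_ge0 ?ltW.
Qed.

(** Tonelli for (1 - cos (y u)) s^(a-1) e^(-(1+u^2)s): integrating over s first gives Gamma a times
    the kernel, over u first a Gaussian transform. The parts coming from the summand 1 agree by
    [tkernel_integral] and are subtracted. *)
Lemma cosI_Gamma a y : 2^-1 < a ->
  Gamma a * cosI a y = Num.sqrt pi / 2 * \int[mu]_(s in Rpos) bessel_kernel (a - 2^-1) y s.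
Proof.
move=> ha; have a0 : 0 < a by rewrite (lt_trans _ ha).
have m0 : 0 < a - 2^-1 by rewrite subr_gt0.
have Ga := Gamma_gt0 _ a0; have mRpos := @measurable_Rpos R.
have ist := tkernel_integrable _ ha.
have icst := cos_mul_integrable _ y ist.
pose f u s := (1 - cos (y * u)) * (s `^ (a - 1) * expR (- ((1 + u ^+ 2) * s))).
have cos1 u : 0 <= 1 - cos (y * u) by rewrite subr_ge0 cos_le1.
have f0 u s : 0 <= f u s by rewrite !mulr_ge0 ?powR_ge0 ?expR_ge0.
have mf : measurable_fun setT (fun z : R * R => f z.1 z.2).
  by rewrite /f; repeat meas_step.
have := tonelli0y f mf (fun w s _ _ => f0 w s).
have -> : (\int[mu]_(u in Rpos) \int[mu]_(s in Rpos) (f u s)%:E)%E =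
  (Gamma a * (\int[mu]_(u in Rpos) tkernel a u - cosI a y))%:E.
  rewrite -RintegralB//.
  have i1 : mu.-integrable Rpos (EFin \o (fun u => tkernel a u - cos (y * u) * tkernel a u)).
    exact: integrableRB.
  rewrite -RintegralZl// -integrableR_EFin//; last exact: integrableRZl.
  apply: eq_integral => u _; rewrite /f; under eq_integral do rewrite EFinM.
  rewrite ge0_integralZl//; last 2 first.
  - by apply/measurable_EFinP; apply: cts_measurable0y => s s0; cts_auto; exact: s0.
  - by move=> s _; rewrite lee_fin mulr_ge0 ?powR_ge0 ?expR_ge0.
  rewrite gamma_scale ?oneDsqr_gt0// -EFinM; congr EFin; rewrite /tkernel; ring.
have -> : (\int[mu]_(s in Rpos) \int[mu]_(u in Rpos) (f u s)%:E)%E =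
  (Num.sqrt pi / 2 * (Gamma (a - 2^-1) - \int[mu]_(s in Rpos) bessel_kernel (a - 2^-1) y s))%:E.
  have ig := gammaf_integrable _ m0; have ib := bessel_kernel_integrable _ y m0.
  have i1 : mu.-integrable Rpos (EFin \o (fun s => gammaf (a - 2^-1) s - bessel_kernel (a - 2^-1) y s)).
    exact: integrableRB.
  rewrite Gamma_pos// -RintegralB// -RintegralZl// -integrableR_EFin//; last first.
    exact: integrableRZl.
  apply: eq_integral => s; rewrite inE RposP => s0.
  transitivity (\int[mu]_(u in Rpos) ((s `^ (a - 1) * expR (- s))%:E *
     ((1 - cos (y * u)) * expR (- (s * u ^+ 2)))%:E))%E.
    apply: eq_integral => u _; rewrite -EFinM; congr EFin; rewrite /f.
    rewrite (_ : - ((1 + u ^+ 2) * s) = - s + - (s * u ^+ 2)); last by ring.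
    rewrite expRD; ring.
  rewrite ge0_integralZl//; last 2 first.
  - by apply/measurable_EFinP; apply: cts_measurable0y => u _; cts_auto.
  - by rewrite lee_fin mulr_ge0 ?powR_ge0 ?expR_ge0.
  rewrite gauss_1Bcos// -EFinM; congr EFin; rewrite /gammaf /bessel_kernel.
  rewrite (_ : a - 2^-1 - 1 = (a - 1) + - 2^-1); last by ring.
  rewrite (powRDp s (a - 1))// opprD expRD; ring.
have h : Gamma a * \int[mu]_(u in Rpos) tkernel a u = Num.sqrt pi / 2 * Gamma (a - 2^-1).
  by rewrite tkernel_integral//; field; exact: lt0r_neq0.
move=> [] E; rewrite mulrBr h in E; lra.
Qed.

(** With s = (y / 2) e^v the exponent s + y^2 / (4s) becomes y cosh v, and the powers of s give e^(m
    v); folding v and -v together yields 2 cosh (m v). *)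
Lemma bessel_kernel_besselK m y : 0 < m -> 0 < y ->
  \int[mu]_(s in Rpos) bessel_kernel m y s = 2 * (y / 2) `^ m * besselK m y.
Proof.
move=> m0 y0; have y2 : 0 < y / 2 by rewrite divr_gt0.
have mRpos := @measurable_Rpos R.
pose k u := expR (- (y * cosh u)) * cosh (m * u).
have coshN u : cosh (- u) = cosh u by rewrite /cosh opprK addrC.
have cosh0 u : 0 <= cosh u by rewrite /cosh divr_ge0// addr_ge0 ?expR_ge0.
have k0 u : 0 <= k u by rewrite mulr_ge0 ?expR_ge0.
have ck u : {for u, continuous k} by rewrite /k /cosh; cts_auto.
pose c := 2 * (y / 2) `^ m; have c0 : 0 < c by rewrite mulr_gt0 ?powR_gt0.
(* An identity of extended reals: finiteness of its left side makes the integral of k finite as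
   well. *)
suff E : ((\int[mu]_(s in Rpos) bessel_kernel m y s)%:E = c%:E * \int[mu]_(u in Rpos) (k u)%:E)%E.
  have -> : besselK m y = \int[mu]_(u in Rpos) k u.
    rewrite /besselK /Rintegral [in RHS]integral_itv_obnd_cbnd//.
    by apply/measurable_EFinP; apply: cts_measurable0y => u _; exact: ck.
  have E2 : (\int[mu]_(u in Rpos) (k u)%:E =
      (c^-1 * \int[mu]_(s in Rpos) bessel_kernel m y s)%:E)%E.
    by rewrite EFinM E muleA -EFinM mulVf ?gt_eqF// mul1e.
  by rewrite -/c [X in _ = c * X]/Rintegral E2 /= mulrA mulfV ?gt_eqF// mul1r.
rewrite -integrableR_EFin//; last exact: bessel_kernel_integrable.
transitivity (\int[mu]_v (bessel_kernel m y (y / 2 * expR v) * (y / 2 * expR v))%:E)%E.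
  apply: (ge0_subst _ _ _ _ (fun v => y / 2 * expR v) (fun v => y / 2 * expR v)
    (bessel_kernel m y) exhausts_setT measurable_Rpos).
  - by move=> v _; der_auto; ring.
  - by move=> v _; cts_auto.
  - by move=> v _; rewrite mulr_ge0 ?expR_ge0// ltW.
  - by move=> v w _ _; rewrite ltr_pM2l// ltr_expR.
  - by move=> a b z; rewrite !RposP => a0 _ /andP[+ _]; exact: lt_le_trans.
  - by move=> v _; rewrite RposP mulr_gt0// expR_gt0.
  - move=> z; rewrite RposP => z0; exists (ln (z / (y / 2))) => //.
    by rewrite lnK ?posrE ?divr_gt0// mulrC divfK// gt_eqF.
  - move=> z; rewrite RposP => z0; rewrite /bessel_kernel; cts_auto; first exact: z0.
    by rewrite mulf_neq0// gt_eqF.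
  - by move=> z _; rewrite mulr_ge0 ?powR_ge0 ?expR_ge0.
have e1 v : bessel_kernel m y (y / 2 * expR v) * (y / 2 * expR v) =
    (y / 2) `^ m * (expR (m * v) * expR (- (y * cosh v))).
  have ev := expR_gt0 v; have z0 : 0 < y / 2 * expR v by rewrite mulr_gt0.
  transitivity ((y / 2 * expR v) `^ m *
      expR (- (y / 2 * expR v + y ^+ 2 / (4 * (y / 2 * expR v))))).
    rewrite (powRB1 _ m z0) /bessel_kernel; ring.
  rewrite powRM ?(ltW y2) ?(ltW ev)//.
  rewrite -mulrA -expRM [v * m]mulrC; congr (_ * (_ * expR (- _))).
  by rewrite /cosh expRN; field; rewrite (gt_eqF ev) (gt_eqF y0).
rewrite ge0_integralT_split; last 2 first.
- rewrite (funext e1); apply: continuous_measurable_fun => v; rewrite /cosh; cts_auto.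
- by move=> v; rewrite e1 !mulr_ge0 ?powR_ge0 ?expR_ge0.
rewrite -ge0_integralZl//.
- apply: eq_integral => v _; rewrite -EFinM; congr EFin.
  rewrite !e1 coshN mulrN /k /c [cosh (m * v)]/cosh; by field.
- by apply/measurable_EFinP; apply: cts_measurable0y => u _; exact: ck.
- by move=> v _; rewrite lee_fin.
- by rewrite lee_fin ltW.
Qed.

End Basset.

(** * The sine transform *)

Section SineSystem.
Context {R : realType}.
Local Notation mu := (@lebesgue_measure R).
Local Notation Rpos := (`]0%R, +oo[%classic : set R).
Implicit Types (a c x y t u s : R).

Lemma powRN1 x a : 0 < x -> x `^ (- a - 1) = x `^ (- (a + 1)).
Proof. by move=> _; congr (_ `^ _); ring. Qed.

Lemma tkernelS a u : (1 + u ^+ 2) * tkernel (a + 1) u = tkernel a u.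
Proof.
rewrite /tkernel [in RHS](powRB1 _ _ (oneDsqr_gt0 u)); congr (_ * _ `^ _); ring.
Qed.

Lemma der_tkernel a u : is_derive u 1 (tkernel a) (- (2 * a * u * tkernel (a + 1) u)).
Proof.
rewrite /tkernel; der_auto; first exact: oneDsqr_gt0.
by rewrite expr1 powRN1 ?oneDsqr_gt0//; ring.
Qed.

Lemma cvg_tkernel a : 0 < a -> tkernel a u @[u --> +oo] --> 0.
Proof.
move=> a0; apply: (squeeze_cvg0 _ _ _ _ (cvg_powRN a a0)); near=> u.
have u1 : 1 <= u by near: u; apply: nbhs_pinfty_ge; exact: num_real.
have u0 : 0 < u by exact: lt_le_trans u1.
rewrite ger0_norm ?(ltW (tkernel_gt0 _ _))// /tkernel !powRN lef_pV2 ?posrE ?powR_gt0 ?oneDsqr_gt0//.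
apply: ge0_ler_powR; rewrite ?nnegrE ?(ltW a0) ?(ltW u0) ?(ltW (oneDsqr_gt0 _))//; nra.
Unshelve. all: by end_near. Qed.

Lemma u_tkernel_le a u : 0 < u -> u * tkernel a u <= tkernel (a - 1) u.
Proof.
move=> u0; rewrite -[a in X in _ <= X](_ : a - 1 + 1 = a) ?subrK//.
rewrite -(tkernelS (a - 1)) subrK ler_wpM2r ?(ltW (tkernel_gt0 _ _))//; nra.
Qed.

Lemma utkernel_integral a : 1 < a ->
  (\int[mu]_(u in Rpos) (u * tkernel a u)%:E = ((2 * (a - 1))^-1)%:E)%E.
Proof.
move=> a1; have a10 : 0 < a - 1 by rewrite subr_gt0.
rewrite (_ : (_^-1)%:E = (0 - (- (2 * (a - 1))^-1))%:E); last by rewrite sub0r opprK.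
apply: (ge0_FTC0y _ (fun u => - (2 * (a - 1))^-1 * tkernel (a - 1) u)).
- by move=> u _; rewrite /tkernel; cts_auto; exact: oneDsqr_gt0.
- move=> u _; have := der_tkernel (a - 1) u; rewrite subrK => d.
  by der_auto; field; exact: lt0r_neq0.
- by move=> u u0; rewrite mulr_ge0 ?(ltW u0) ?(ltW (tkernel_gt0 _ _)).
- apply: cvg_right_cts; first by rewrite /tkernel; cts_auto; exact: oneDsqr_gt0.
  by rewrite /tkernel expr0n addr0 powR1 mulr1.
- by rewrite -[X in _ --> X](mulr0 (- (2 * (a - 1))^-1)); apply: cvgMl_tmp; exact: cvg_tkernel.
Qed.

Lemma utkernel_integrable a : 1 < a -> mu.-integrable Rpos (EFin \o (fun u => u * tkernel a u)).
Proof.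
move=> a1; apply: ge0_integrable => //.
- by apply: cts_measurable0y => u _; rewrite /tkernel; cts_auto; exact: oneDsqr_gt0.
- by move=> u; rewrite RposP => u0; rewrite mulr_ge0 ?(ltW u0) ?(ltW (tkernel_gt0 _ _)).
- by rewrite utkernel_integral// ltry.
Qed.

(** The dominating function u (1 + u^2)^(-a) is integrable only for a > 1; [sinI_system] reaches 1/2
    < a <= 1 in another way. *)
Lemma der_sinI a y : 1 < a -> is_derive y 1 (sinI a)
  (\int[mu]_(u in Rpos) (cos (y * u) * (u * tkernel a u))).
Proof.
move=> a1; have ha : 2^-1 < a by lra.
apply: (der_under _ (fun y u => cos (y * u) * (u * tkernel a u)) _ _ _ _ (utkernel_integrable a a1)).
- by move=> z; apply: sin_mul_integrable; exact: tkernel_integrable.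
- by move=> u _ z _; der_auto; ring.
- move=> z u u0; have ge : 0 <= u * tkernel a u by rewrite mulr_ge0 ?(ltW u0) ?(ltW (tkernel_gt0 _ _)).
  by rewrite normrM (ger0_norm ge) -[leRHS]mul1r ler_wpM2r// cos_max.
Qed.

(** Integration by parts with - tkernel a / (2a) as antiderivative of u * tkernel (a + 1) u; the 1
    is the boundary value at u = 0. *)
Lemma sinI_parts1 a y : 2^-1 < a ->
  \int[mu]_(u in Rpos) (cos (y * u) * (u * tkernel (a + 1) u)) = (1 - y * sinI a y) / (2 * a).
Proof.
move=> ha; have a0 : 0 < a by lra.
have a1 : 1 < a + 1 by lra.
have i1 := sin_mul_integrable _ y (tkernel_integrable _ ha).
have i2 := cos_mul_integrable _ y (utkernel_integrable _ a1).
have mRpos := @measurable_Rpos R.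
have : \int[mu]_(u in Rpos) (y / (2 * a) * (sin (y * u) * tkernel a u)
   + cos (y * u) * (u * tkernel (a + 1) u)) = 0 - (- (2 * a)^-1).
  apply: (FTC0y _ (fun u => - (2 * a)^-1 * (cos (y * u) * tkernel a u))).
  - by move=> u _; rewrite /tkernel; cts_auto; exact: oneDsqr_gt0.
  - by move=> u _; have d := der_tkernel a u; der_auto; field; exact: lt0r_neq0.
  - by apply: integrableRD => //; exact: integrableRZl.
  - apply: cvg_right_cts; first by rewrite /tkernel; cts_auto; exact: oneDsqr_gt0.
    by rewrite /tkernel mulr0 cos0 expr0n addr0 powR1 !mulr1.
  - rewrite -[X in _ --> X](mulr0 (- (2 * a)^-1)); apply: cvgMl_tmp.
    apply: (squeeze_cvg0 _ _ _ _ (cvg_tkernel a a0)); near=> u.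
    rewrite normrM (ger0_norm (ltW (tkernel_gt0 _ _))) -[leRHS]mul1r.
    by rewrite ler_wpM2r ?(ltW (tkernel_gt0 _ _))// cos_max.
rewrite RintegralD//; last exact: integrableRZl.
rewrite RintegralZl// -/(sinI a y) sub0r opprK addrC => /(canRL (addrK _)) ->.
by field; exact: lt0r_neq0.
Unshelve. all: by end_near. Qed.

(** Integration by parts against u * tkernel a u. Its derivative contains u^2 * tkernel (a + 1) u,
    which is tkernel a u - tkernel (a + 1) u by [tkernelS]. *)
Lemma sinI_parts2 a y : 1 < a ->
  y * \int[mu]_(u in Rpos) (cos (y * u) * (u * tkernel a u)) =
  (2 * a - 1) * sinI a y - 2 * a * sinI (a + 1) y.
Proof.
move=> a1; have ha : 2^-1 < a by lra.
have ha1 : 2^-1 < a + 1 by lra.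
have i1 := sin_mul_integrable _ y (tkernel_integrable _ ha).
have i1' := sin_mul_integrable _ y (tkernel_integrable _ ha1).
have i2 := cos_mul_integrable _ y (utkernel_integrable _ a1).
have mRpos := @measurable_Rpos R.
have j1 := RposZl y _ i2.
have j2 := RposZl (2 * a - 1) _ i1.
have j3 := RposZl (2 * a) _ i1'.
have j4 := RposB _ _ j2 j3.
have : \int[mu]_(u in Rpos) (y * (cos (y * u) * (u * tkernel a u)) -
   ((2 * a - 1) * (sin (y * u) * tkernel a u) - 2 * a * (sin (y * u) * tkernel (a + 1) u))) = 0 - 0.
  apply: (FTC0y _ (fun u => sin (y * u) * (u * tkernel a u))).
  - by move=> u _; rewrite /tkernel; cts_auto; exact: oneDsqr_gt0.
  - move=> u _; have d := der_tkernel a u; der_auto.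
    by rewrite -(tkernelS a u); ring.
  - exact: (RposB _ _ j1 j4).
  - apply: cvg_right_cts; first by rewrite /tkernel; cts_auto; exact: oneDsqr_gt0.
    by rewrite mulr0 sin0 mul0r.
  - have a10 : 0 < a - 1 by lra.
    apply: (squeeze_cvg0 _ _ _ _ (cvg_tkernel (a - 1) a10)); near=> u.
    have u0 : 0 < u by near: u; apply: nbhs_pinfty_gt; exact: num_real.
    have ge : 0 <= u * tkernel a u by rewrite mulr_ge0 ?(ltW u0) ?(ltW (tkernel_gt0 _ _)).
    rewrite normrM (ger0_norm ge); apply: le_trans (u_tkernel_le a u u0).
    by rewrite -[leRHS]mul1r ler_wpM2r// sin_max.
rewrite RintegralB// RintegralB// !RintegralZl// -/(sinI a y) -/(sinI (a + 1) y) subr0.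
by move/eqP; rewrite subr_eq0 => /eqP.
Unshelve. all: by end_near. Qed.

Lemma der_sinIS a y : 2^-1 < a ->
  is_derive y 1 (sinI (a + 1)) ((1 - y * sinI a y) / (2 * a)).
Proof.
move=> ha; rewrite -sinI_parts1//; apply: der_sinI; lra.
Qed.

Lemma is_derive_uniq (f : R -> R) x (l l' : R) :
  is_derive x 1 f l -> is_derive x 1 f l' -> l = l'.
Proof. by move=> [_ <-] [_ <-]. Qed.

Lemma is_derive_near_pos (f g : R -> R) x (l : R) : 0 < x ->
  (forall z : R, 0 < z -> f z = g z) -> is_derive x 1 f l -> is_derive x 1 g l.
Proof.
move=> x0 fg; apply: near_eq_is_derive => //.
near=> z; apply: fg; near: z; exact: lt_nbhsr.
Unshelve. all: by end_near. Qed.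

(** f and g stand for S_a and S_(a+1). The equations are kept apart from the integrals because
    closed forms are shown to satisfy them too. *)
Definition sine_system a (f g : R -> R) := forall y : R, 0 < y ->
  is_derive y 1 g ((1 - y * f y) / (2 * a)) /\
  is_derive y 1 f (((2 * a - 1) * f y - 2 * a * g y) / y).

Lemma sinI_system a : 2^-1 < a -> sine_system a (sinI a) (sinI (a + 1)).
Proof.
move=> ha y y0; split; first exact: der_sinIS.
have big (b z : R) : 1 < b -> 0 < z ->
    is_derive z 1 (sinI b) (((2 * b - 1) * sinI b z - 2 * b * sinI (b + 1) z) / z).
  move=> b1 z0; have := der_sinI b z b1; have := sinI_parts2 b z b1 => <-.
  by rewrite mulrC mulKf// gt_eqF.
have a1 : 1 < a + 1 by lra.
have a1h : 2^-1 < a + 1 by lra.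
have ha2 : 2 * a != 0 by rewrite gt_eqF//; lra.
(* The derivative of S_(a+1) has two expressions, (1 - z S_a) / (2a) and D z. Hence S_a = (1 - 2a D)
   / z, which is differentiable because D involves S_(a+1) and S_(a+2) only. *)
pose D (z : R) := ((2 * (a + 1) - 1) * sinI (a + 1) z - 2 * (a + 1) * sinI (a + 1 + 1) z) / z.
have E (z : R) : 0 < z -> (1 - 2 * a * D z) / z = sinI a z.
  move=> z0; have := is_derive_uniq _ _ _ _ (der_sinIS a z ha) (big _ _ a1 z0).
  rewrite -/(D z) => <-; move: (sinI a z) => A; field; rewrite (gt_eqF z0)/=; lra.
notypeclasses refine (is_derive_near_pos (fun z => (1 - 2 * a * D z) / z) _ _ _ y0 E _).
have d1 := der_sinIS a y ha; have d2 := der_sinIS (a + 1) y a1h.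
rewrite /D; der_auto; [by rewrite gt_eqF|by rewrite gt_eqF|].
have e1 := E y y0; rewrite /D in e1; rewrite -e1.
move: (sinI _ y) (sinI _ y) => A B.
field; rewrite (gt_eqF y0)/=; lra.
Qed.

(** The second equation expresses g through f and its derivative, so an identity passes from index a
    to a + 1. The first equation expresses f through the derivative of g, which gives
    [sine_system_down]. *)
Lemma sine_system_up a f f' g g' : 0 < a -> sine_system a f g -> sine_system a f' g' ->
  (forall y : R, 0 < y -> f y = f' y) -> forall y : R, 0 < y -> g y = g' y.
Proof.
move=> a0 s s' ff' y y0; have [_ d] := s y y0; have [_ d'] := s' y y0.
have := is_derive_uniq _ _ _ _ (is_derive_near_pos _ _ _ _ y0 ff' d) d'.
rewrite ff'// => /(mulIf (invr_neq0 (lt0r_neq0 y0))) /addrI /oppr_inj.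
by apply: mulfI; rewrite gt_eqF// mulr_gt0.
Qed.

Lemma sine_system_down a f f' g g' : 0 < a -> sine_system a f g -> sine_system a f' g' ->
  (forall y : R, 0 < y -> g y = g' y) -> forall y : R, 0 < y -> f y = f' y.
Proof.
move=> a0 s s' gg' y y0; have [d _] := s y y0; have [d' _] := s' y y0.
have a2 : 2 * a != 0 by rewrite gt_eqF// mulr_gt0.
have := is_derive_uniq _ _ _ _ (is_derive_near_pos _ _ _ _ y0 gg' d) d'.
move=> /(mulIf (invr_neq0 a2)) /addrI /oppr_inj.
by apply: mulfI; rewrite gt_eqF.
Qed.

(** Only the right limit at 0 enters, not the value there: the functions compared involve powers
    that are singular at 0. *)
Lemma der_ge0_right0 (f df : R -> R) y : 0 < y ->
  (forall x, 0 < x -> x <= y -> is_derive x 1 f (df x) /\ 0 <= df x) ->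
  f x @[x --> (0:R)^'+] --> 0 -> 0 <= f y.
Proof.
move=> y0 dfE f0; apply: (cvgr_to_le f0); near=> x.
have x0 : 0 < x by near: x; exact: nbhs_right_gt.
have xy : x < y by near: x; exact: nbhs_right_lt.
have [||c] := @MVT_segment _ f df x y (ltW xy).
- move=> z; rewrite in_itv/= => /andP[xz zy].
  by have [] := dfE z (lt_trans x0 xz) (ltW zy).
- apply: within_cts => z /andP[xz zy].
  by have [d _] := dfE z (lt_le_trans x0 xz) zy; exact: is_derive1_cts d.
rewrite in_itv/= => /andP[xc cy] fE; rewrite -subr_ge0 fE mulr_ge0//.
  by have [] := dfE c (lt_le_trans x0 xc) cy.
by rewrite subr_ge0 ltW.
Unshelve. all: by end_near. Qed.

Lemma der_bound_right0 (f df h dh : R -> R) y : 0 < y ->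
  (forall x, 0 < x -> x <= y -> is_derive x 1 f (df x)) ->
  (forall x, 0 < x -> x <= y -> is_derive x 1 h (dh x)) ->
  (forall x, 0 < x -> x <= y -> `|df x| <= dh x) ->
  f x @[x --> (0:R)^'+] --> 0 -> h x @[x --> (0:R)^'+] --> 0 ->
  `|f y| <= h y.
Proof.
move=> y0 df_ dh_ dfh f0 h0; rewrite ler_norml; apply/andP; split.
  rewrite -subr_ge0 opprK addrC.
  apply: (der_ge0_right0 (fun x => h x + f x) (fun x => dh x + df x) y y0).
    move=> x x0 xy; have d1 := df_ x x0 xy; have d2 := dh_ x x0 xy; split.
      by der_auto.
    by have := dfh x x0 xy; rewrite ler_norml => /andP[]; lra.
  by rewrite -[X in _ --> X](addr0 0); exact: cvgD.
rewrite -subr_ge0.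
apply: (der_ge0_right0 (fun x => h x - f x) (fun x => dh x - df x) y y0).
  move=> x x0 xy; have d1 := df_ x x0 xy; have d2 := dh_ x x0 xy; split.
    by der_auto.
  by have := dfh x x0 xy; rewrite ler_norml => /andP[]; lra.
by rewrite -[X in _ --> X](subr0 0); exact: cvgB.
Qed.

Lemma cvg_cpow_right0 c p : 0 < p -> c * x `^ p @[x --> (0:R)^'+] --> 0.
Proof.
by move=> p0; rewrite -[X in _ --> X](mulr0 c); apply: cvgMl_tmp; exact: powR_cvg0.
Qed.

Lemma bounded_right0 (f : R -> R) y : 0 < y ->
  (forall x : R, 0 < x -> {for x, continuous f}) -> f x @[x --> (0:R)^'+] --> 0 ->
  exists2 M, 0 <= M & forall x : R, 0 < x -> x <= y -> `|f x| <= M.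
Proof.
move=> y0 cf /cvgrPdist_le/(_ _ ltr01)[e /= e0 he].
(* To the left of d the limit bounds f by 1; on the compact interval [d, y] the maximum of |f| is
   attained. *)
pose d := Num.min (e / 2) y; have e2 : e / 2 < e by lra.
have d0 : 0 < d by rewrite lt_min y0 divr_gt0.
have dy : d <= y by rewrite ge_min lexx orbT.
have cnf : {within `[d, y], continuous (fun x => `|f x|)}.
  apply: within_cts => x /andP[dx _].
  by apply: (@continuous_comp _ _ _ f); [exact/cf/(lt_le_trans d0)|exact: norm_continuous].
have [c _ hc] := EVT_max dy cnf.
exists (Num.max 1 `|f c|); first by rewrite le_max ler01.
move=> x x0 xy; rewrite le_max; have [xd|dx] := ltP x d.
  apply/orP; left; have := he x; rewrite sub0r normrN => h.
  have : `|0 - f x| <= 1.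
    apply: he => //=; rewrite sub0r normrN gtr0_norm// (lt_trans xd)//.
    by rewrite gt_min e2.
  by rewrite sub0r normrN.
by apply/orP; right; apply: hc; rewrite in_itv/= dx xy.
Qed.

(* Iterating the two integral equations from the trivial bound |u| <= M
   yields |u x| <= M x^(2n) / n! for every n. *)
Lemma sine_system_unique0 a (u v : R -> R) : 2^-1 < a ->
  (forall x : R, 0 < x -> is_derive x 1 u (- (2 * a * x `^ (- (2 * a)) * v x))) ->
  (forall x : R, 0 < x -> is_derive x 1 v (- (x `^ (2 * a) * u x / (2 * a)))) ->
  u x @[x --> (0:R)^'+] --> 0 -> v x @[x --> (0:R)^'+] --> 0 ->
  forall y : R, 0 < y -> u y = 0.
Proof.
move=> ha du dv u0 v0 y y0; have a0 : 0 < a by lra.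
have a20 : 0 < 2 * a by rewrite mulr_gt0.
have [|M M0 hM] := bounded_right0 u y y0 _ u0.
  by move=> x x0; exact: is_derive1_cts (du x x0).
have H n : forall x, 0 < x -> x <= y -> `|u x| <= M / n`!%:R * x `^ (2 * n%:R).
  elim: n => [|n IH] x x0 xy; first by rewrite mulr0 powRr0 mulr1 divr1 hM.
  set A := M / n`!%:R in IH; have A0 : 0 <= A by rewrite divr_ge0.
  (* Integrating z^(2a) z^(2n) gives v the exponent p. The factor z^(-2a) and a second integration
     bring u to the exponent q = 2n + 2. *)
  pose p : R := 2 * a + 2 * n%:R + 1; have n0 : 0 <= n%:R :> R by [].
  have p0 : 0 < p by rewrite /p; lra.
  have hv z : 0 < z -> z <= y -> `|v z| <= A / (2 * a) / p * z `^ p.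
    move=> z0 zy.
    apply: (der_bound_right0 v (fun z => - (z `^ (2 * a) * u z / (2 * a)))
      (fun z => A / (2 * a) / p * z `^ p) (fun z => A / (2 * a) * z `^ (p - 1))).
    - by [].
    - by move=> w w0 _; exact: dv.
    - move=> w w0 _; der_auto; first exact: w0.
      by field; rewrite !gt_eqF.
    - move=> w w0 wz; rewrite normrN !normrM normfV.
      rewrite (ger0_norm (powR_ge0 _ _)) (ger0_norm (ltW a20)) /p addrK powRDp//.
      have := IH w w0 (le_trans wz zy); set U := `|u w|; set W := w `^ (2 * n%:R) => UW.
      rewrite [leRHS](_ : _ = w `^ (2 * a) * (A * W) / (2 * a)); last by ring.
      by rewrite ler_wpM2r ?invr_ge0 ?(ltW a20)// ler_wpM2l ?powR_ge0.
    - exact: v0.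
    - exact: cvg_cpow_right0.
  pose q : R := 2 * n%:R + 2; have q0 : 0 < q by rewrite /q ltr_wpDl// mulr_ge0.
  have hu : `|u x| <= A / p / q * x `^ q.
    apply: (der_bound_right0 u (fun z => - (2 * a * z `^ (- (2 * a)) * v z))
      (fun z => A / p / q * z `^ q) (fun z => A / p * z `^ (q - 1))).
    - by [].
    - by move=> w w0 _; exact: du.
    - move=> w w0 _; der_auto; first exact: w0.
      by field; rewrite !gt_eqF.
    - move=> w w0 wx; rewrite normrN !normrM.
      have := hv w w0 (le_trans wx xy).
      rewrite (_ : p = q - 1 + 2 * a) ?(powRDp w (q - 1) (2 * a))//; last by rewrite /p /q; ring.
      rewrite -[q - 1 + 2 * a](_ : p = _); last by rewrite /p /q; ring.
      rewrite ger0_norm// (ger0_norm (ltW a0)) (ger0_norm (powR_ge0 _ _)) powRN => hvw.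
      have wa : 0 < w `^ (2 * a) by exact: powR_gt0.
      rewrite -[leRHS](_ : 2 * a / w `^ (2 * a) *
        (A / (2 * a) / p * (w `^ (q - 1) * w `^ (2 * a))) = _); last first.
        by field; rewrite !gt_eqF.
      by rewrite ler_wpM2l// divr_ge0 ?(ltW wa)// ltW.
    - exact: u0.
    - exact: cvg_cpow_right0.
  apply: le_trans hu _; rewrite (_ : 2 * n.+1%:R = q); last by rewrite /q -natr1; ring.
  have -> : M / (n.+1)`!%:R = A / n.+1%:R by rewrite /A factS natrM invfM; ring.
  rewrite ler_wpM2r ?powR_ge0// -mulrA -invfM ler_wpM2l//.
  (* The two integrations divide by p and q, whose product is at least n + 1: this is what builds up
     the factorial. *)
  have n1 : n.+1%:R <= p * q by rewrite -natr1 /p /q; nra.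
  by rewrite lef_pV2 ?posrE ?mulr_gt0.
apply/eqP; rewrite -normr_le0.
have L : M * exp_coeff (y ^+ 2) n @[n --> \oo] --> M * 0.
  by apply: cvgMl_tmp; exact: cvg_exp_coeff.
rewrite mulr0 in L; apply: (cvgr_to_ge L); near=> n.
have e : y `^ (2 * n%:R) = (y ^+ 2) ^+ n by rewrite -exprM -powR_mulrn ?(ltW y0)// natrM.
by have := H n y y0 (lexx y); rewrite e /exp_coeff mulrA mulrAC.
Unshelve. all: by end_near. Qed.

End SineSystem.

(** * The sine transform near 0 *)

Section SineSmall.
Context {R : realType}.
Local Notation mu := (@lebesgue_measure R).
Local Notation Rpos := (`]0%R, +oo[%classic : set R).
Implicit Types (a c x y t u s v : R).

Lemma sin_le_id v : 0 <= v -> sin v <= v.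
Proof.
rewrite le_eqVlt => /predU1P[<-|v0]; first by rewrite sin0.
rewrite -subr_ge0; apply: (der_ge0_right0 (fun v => v - sin v) (fun v => 1 - cos v) v v0).
  by move=> x _ _; split; [der_auto; ring|rewrite subr_ge0 cos_le1].
by apply: cvg_right_cts; [cts_auto|rewrite sin0 subrr].
Qed.

(** The right side is 1 / s^2 - 1 / (1 + s^2), the Laplace transforms of v and of sin v. *)
Lemma sin_laplace s : 0 < s ->
  (\int[mu]_(v in Rpos) ((v - sin v) * expR (- (s * v)))%:E =
   (s ^- 2 / (1 + s ^+ 2))%:E)%E.
Proof.
move=> s0; have mRpos := @measurable_Rpos R.
have q0 : 0 < 1 + s ^+ 2 by exact: oneDsqr_gt0.
have iE := expRN_integrable s s0.
have i1 : mu.-integrable Rpos (EFin \o (fun v => v * expR (- (s * v)))).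
  apply: ge0_integrable => //.
  - by apply: cts_measurable0y => v _; cts_auto.
  - by move=> v; rewrite RposP => v0; rewrite mulr_ge0 ?expR_ge0// ltW.
  have := gamma_scale 2 s (ltr0Sn R 1) s0.
  rewrite (_ : (2 - 1 : R) = 1); last by ring.
  move=> h; rewrite (_ : integral _ _ _ = (Gamma 2 * s `^ (- 2))%:E) ?ltry//.
  rewrite -h; apply: eq_integral => v; rewrite inE RposP => v0.
  by rewrite powRr1// ltW.
have v1 : \int[mu]_(v in Rpos) (v * expR (- (s * v))) = s ^- 2.
  have := gamma_scale 2 s (ltr0Sn R 1) s0.
  rewrite (_ : (2 - 1 : R) = 1); last by ring.
  rewrite (_ : Gamma 2 = 1); last by rewrite -[2]/(1 + 1) GammaS ?oner_eq0// Gamma1 mulr1.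
  rewrite mul1r powR_invn ?ltW// /Rintegral => h.
  rewrite (_ : integral _ _ _ = (s ^- 2)%:E)//.
  rewrite -h; apply: eq_integral => v; rewrite inE RposP => v0.
  by rewrite powRr1// ltW.
have i2 : mu.-integrable Rpos (EFin \o (fun v => sin v * expR (- (s * v)))).
  rewrite (_ : EFin \o _ = EFin \o (fun v => sin (1 * v) * expR (- (s * v)))).
    exact: sin_mul_integrable.
  by apply/funext => v /=; rewrite mul1r.
have v2 : \int[mu]_(v in Rpos) (sin v * expR (- (s * v))) = (1 + s ^+ 2)^-1.
  rewrite -[RHS]opprK -[RHS]sub0r.
  apply: (FTC0y _ (fun v => - (1 + s ^+ 2)^-1 * ((s * sin v + cos v) * expR (- (s * v))))).
  - by move=> v _; cts_auto.
  - by move=> v _; der_auto; field; rewrite gt_eqF.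
  - by [].
  - apply: cvg_right_cts; first by cts_auto.
    by rewrite sin0 cos0 !mulr0 oppr0 expR0 add0r !mulr1.
  - rewrite -[X in _ --> X](mulr0 (- (1 + s ^+ 2)^-1)); apply: cvgMl_tmp.
    apply: (squeeze_cvg0 _ _ (fun v => (s + 1) * expR (- (s * v)))); last first.
      rewrite -[X in _ --> X](mulr0 (s + 1)); apply: cvgMl_tmp; exact: cvg_expRN.
    near=> v; rewrite normrM (ger0_norm (expR_ge0 _)) ler_wpM2r ?expR_ge0//.
    rewrite (le_trans (ler_normD _ _))// lerD ?cos_max//.
    by rewrite normrM (ger0_norm (ltW s0)) ler_piMr ?(ltW s0)// sin_max.
under eq_integral do rewrite mulrBl.
rewrite integrableR_EFin//; last exact: integrableRB.
rewrite RintegralB// v1 v2; congr EFin; field.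
by rewrite (gt_eqF s0) gt_eqF.
Unshelve. all: by end_near. Qed.

Lemma vBsin_ge0 v : 0 < v -> 0 <= v - sin v.
Proof. by move=> v0; rewrite subr_ge0 sin_le_id// ltW. Qed.

(* Gamma (2 * a) * v^(- 2 * a) is the Laplace transform of s^(2 * a - 1), which
   leads through sin_laplace to a Beta integral. *)
Lemma sin_cubic_integral a : 1 < a -> a < 2 ->
  (\int[mu]_(v in Rpos) ((v - sin v) * v `^ (- (2 * a)))%:E =
   (2^-1 * Gamma (a - 1) * Gamma (2 - a) / Gamma (2 * a))%:E)%E.
Proof.
move=> a1 a2; have a0 : 0 < 2 * a by lra.
have b1 : 0 < a - 1 by lra. have b2 : 0 < 2 - a by lra.
have Ga := Gamma_gt0 _ a0.
pose f v s := (v - sin v) * (s `^ (2 * a - 1) * expR (- (v * s))).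
have mf : measurable_fun setT (fun z : R * R => f z.1 z.2).
  by rewrite /f; repeat meas_step.
have f0 v s : 0 < v -> 0 < s -> 0 <= f v s.
  by move=> v0 s0; rewrite mulr_ge0 ?vBsin_ge0// mulr_ge0 ?powR_ge0 ?expR_ge0.
have cI v : 0 < v -> {for v, continuous (fun v => (v - sin v) * v `^ (- (2 * a)))}.
  by move=> v0; cts_auto; exact: v0.
have := tonelli0y f mf f0.
have -> : (\int[mu]_(v in Rpos) \int[mu]_(s in Rpos) (f v s)%:E)%E =
  ((Gamma (2 * a))%:E * \int[mu]_(v in Rpos) ((v - sin v) * v `^ (- (2 * a)))%:E)%E.
  rewrite -ge0_integralZl//; last 3 first.
  - by apply/measurable_EFinP; apply: cts_measurable0y.
  - by move=> v; rewrite RposP => v0; rewrite lee_fin mulr_ge0 ?vBsin_ge0// powR_ge0.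
  - by rewrite lee_fin ltW.
  apply: eq_integral => v; rewrite inE RposP => v0.
  rewrite /f; under eq_integral do rewrite EFinM.
  rewrite ge0_integralZl//; last 3 first.
  - by apply/measurable_EFinP; apply: cts_measurable0y => s s0; cts_auto; exact: s0.
  - by move=> s _; rewrite lee_fin mulr_ge0 ?powR_ge0 ?expR_ge0.
  - by rewrite lee_fin vBsin_ge0.
  by rewrite gamma_scale// -!EFinM mulrCA.
have -> : (\int[mu]_(s in Rpos) \int[mu]_(v in Rpos) (f v s)%:E)%E =
  (2^-1 * Gamma (a - 1) * Gamma (2 - a))%:E.
  (* After [sin_laplace] the integrand in s is s^(2a-3) / (1 + s^2); w = s^2 makes its integral half
     of B(a - 1, 2 - a). *)
  have := beta_integral _ _ b1 b2.
  rewrite (_ : a - 1 + (2 - a) = 1) ?Gamma1 ?divr1; last by ring.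
  rewrite (ge0_subst_sqr (fun w => w `^ (a - 1 - 1) * (1 + w) `^ (- 1))); last 2 first.
    by move=> w w0; cts_auto; [exact: w0|exact: addr_gt0].
    by move=> w _; rewrite mulr_ge0 ?powR_ge0.
  move=> H; rewrite -mulrA EFinM -H -ge0_integralZl//; last 2 first.
  - apply/measurable_EFinP; apply: cts_measurable0y => u u0.
    by cts_auto; [rewrite exprn_gt0|rewrite addr_gt0 ?exprn_gt0].
  - by move=> u; rewrite RposP => u0; rewrite lee_fin !mulr_ge0 ?powR_ge0 ?ltW.
  apply: eq_integral => s; rewrite inE RposP => s0.
  transitivity (\int[mu]_(v in Rpos) ((s `^ (2 * a - 1))%:E *
     ((v - sin v) * expR (- (s * v)))%:E))%E.
    by apply: eq_integral => v _; rewrite -EFinM /f [v * s]mulrC; congr EFin; ring.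
  rewrite ge0_integralZl//; last 3 first.
  - by apply/measurable_EFinP; apply: cts_measurable0y => v _; cts_auto.
  - by move=> v; rewrite RposP => v0; rewrite lee_fin mulr_ge0 ?expR_ge0 ?vBsin_ge0.
  - by rewrite lee_fin powR_ge0.
  rewrite sin_laplace// -!EFinM; congr EFin.
  have q0 := oneDsqr_gt0 s.
  rewrite powR_inv1 ?(ltW q0)//.
  rewrite -powR_mulrn ?(ltW s0)// -powRrM.
  rewrite (_ : 2 * a - 1 = 2%:R * (a - 1 - 1) + 3%:R); last by ring.
  rewrite powRDp// !powR_mulrn ?(ltW s0)//; field.
  by rewrite (gt_eqF s0) gt_eqF.
move=> H; rewrite [X in X%:E]mulrC EFinM -H muleA -EFinM mulVf ?mul1e//.
by rewrite gt_eqF.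
Qed.

(** The term y / (2 (a - 1)) is the integral of y u (1 + u^2)^(-a). With v = y u the left side
    becomes minus the integral of (v - sin v) (y^2 + v^2)^(-a). This is dominated by its integrand
    at y = 0, hence continuous at y = 0, where [sin_cubic_integral] evaluates it. *)
Lemma sinI_small a : 1 < a -> a < 2 ->
  y `^ (1 - 2 * a) * (sinI a y - y / (2 * (a - 1))) @[y --> (0:R)^'+] -->
  - (2^-1 * Gamma (a - 1) * Gamma (2 - a) / Gamma (2 * a)).
Proof.
move=> a1 a2; have ha : 2^-1 < a by lra. have a0 : 0 < a by lra.
have mRpos := @measurable_Rpos R.
have E := sin_cubic_integral a a1 a2.
have c0 v : 0 < v -> 0 <= (v - sin v) * v `^ (- (2 * a)).
  by move=> v0; rewrite mulr_ge0 ?vBsin_ge0// powR_ge0.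
pose F y v := (v - sin v) * (y ^+ 2 + v ^+ 2) `^ (- a).
have sq y v : 0 < v -> 0 < y ^+ 2 + v ^+ 2.
  by move=> v0; rewrite ltr_wpDl ?sqr_ge0// exprn_gt0.
have cF y v : 0 < v -> {for v, continuous (F y)}.
  by move=> v0; rewrite /F; cts_auto; exact: sq.
have F0 v : 0 < v -> F 0 v = (v - sin v) * v `^ (- (2 * a)).
  by move=> v0; rewrite /F expr0n add0r -powR_mulrn ?ltW// -powRrM mulrN.
have iG : mu.-integrable Rpos (EFin \o (fun v => (v - sin v) * v `^ (- (2 * a)))).
  apply: ge0_integrable => //.
  - by apply: cts_measurable0y => v v0; cts_auto; exact: v0.
  - by move=> v; rewrite RposP; exact: c0.
  - by rewrite E ltry.
have FG y v : 0 < v -> `|F y v| <= (v - sin v) * v `^ (- (2 * a)).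
  move=> v0; rewrite ger0_norm ?mulr_ge0 ?vBsin_ge0 ?powR_ge0//.
  rewrite -F0// /F ler_wpM2l ?vBsin_ge0// expr0n add0r !powRN.
  rewrite lef_pV2 ?posrE ?powR_gt0 ?exprn_gt0 ?sq//.
  apply: ge0_ler_powR; rewrite ?nnegrE ?(ltW a0) ?sqr_ge0 ?addr_ge0 ?sqr_ge0//.
  by rewrite lerDr sqr_ge0.
have iF y : mu.-integrable Rpos (EFin \o F y).
  apply: dominated_integrableR iG _ => //.
  - by apply: cts_measurable0y => v; exact: cF.
  - by move=> v; rewrite RposP; exact: FG.
have cI : {for 0, continuous (fun y => \int[mu]_(v in Rpos) F y v)}.
  apply: (@continuity_under_integral _ _ _ mu F Rpos mRpos (-1) 1 (fun y _ => iF y) _ _ iG).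
  - apply: aeW => v; rewrite RposP => v0 y _; rewrite /F.
    by cts_auto; exact: sq.
  - by move=> y _; apply: aeW => v; rewrite RposP; exact: FG.
  - by rewrite inE/= in_itv/= ltrN10 ltr01.
rewrite -[X in _ --> X]mulN1r.
have -> : 2^-1 * Gamma (a - 1) * Gamma (2 - a) / Gamma (2 * a) =
    \int[mu]_(v in Rpos) F 0 v.
  apply: EFin_inj; apply: etrans (esym E) _.
  rewrite -(integrableR_EFin (m := mu) mRpos (iF 0)).
  by apply: eq_integral => v; rewrite inE RposP => v0; rewrite F0.
have L : -1 * \int[mu]_(v in Rpos) F y v @[y --> (0:R)^'+] --> -1 * \int[mu]_(v in Rpos) F 0 v.
  by apply: cvgMl_tmp; apply: cvg_at_right_filter; exact: cI.
apply: cvg_trans L; apply: near_eq_cvg; near=> y.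
have y0 : 0 < y by near: y; exact: nbhs_right_gt.
rewrite mulN1r -[sinI a y - _]opprB mulrN; congr (- _).
have i1 := sin_mul_integrable _ y (tkernel_integrable _ ha).
have i2 := utkernel_integrable _ a1.
have -> : y / (2 * (a - 1)) = \int[mu]_(u in Rpos) (y * (u * tkernel a u)).
  by rewrite RintegralZl// /Rintegral utkernel_integral.
rewrite -RintegralB//; last exact: integrableRZl.
rewrite -RintegralZl//; last by apply: integrableRB => //; exact: integrableRZl.
rewrite /Rintegral; congr fine.
rewrite (ge0_subst_scale y (F y))//.
- apply: eq_integral => u; rewrite inE RposP => u0; congr EFin.
  have -> : F y (y * u) = (y * u - sin (y * u)) * (y `^ (- (2 * a)) * tkernel a u).
    rewrite /F (_ : y ^+ 2 + _ = y ^+ 2 * (1 + u ^+ 2)); last by ring.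
    rewrite powRM ?sqr_ge0 ?(ltW (oneDsqr_gt0 _))// -powR_mulrn ?ltW// -powRrM mulrN.
    by rewrite -/(tkernel a u).
  rewrite (_ : 1 - 2 * a = - (2 * a) + 1); last by ring.
  by rewrite powRDp// powRr1 ?ltW//; ring.
- by move=> v; exact: cF.
- by move=> v v0; rewrite mulr_ge0 ?vBsin_ge0 ?powR_ge0.
Unshelve. all: by end_near. Qed.

End SineSmall.

(** * Bessel and Struve series *)

Section Series.
Context {R : realType}.
Implicit Types (a p q x y : R) (c d : nat -> R) (k n : nat).

Definition psum c x : R := limn (pseries c x).

(** Domination by an exponential series gives convergence everywhere. It is stable under index
    shifts and under multiplication by k, so such series can be differentiated term by term. *)
Definition exp_dominated c := exists2 B, 0 <= B & exists2 A, 0 <= A &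
  forall k, `|c k| <= A * (B ^+ k / k`!%:R).

Lemma exp_dominated_cvg c x : exp_dominated c -> cvgn (pseries c x).
Proof.
move=> [B B0 [A A0 hA]]; apply: normed_cvg.
apply: (@series_le_cvg _ _ (fun k => A * exp_coeff (B * `|x|) k)).
- by move=> k; exact: normr_ge0.
- by move=> k; rewrite mulr_ge0 ?exp_coeff_ge0// mulr_ge0.
- move=> k /=; rewrite normrM normrX.
  have -> : A * exp_coeff (B * `|x|) k = A * (B ^+ k / k`!%:R) * `|x| ^+ k.
    by rewrite /exp_coeff /= exprMn; ring.
  by rewrite ler_wpM2r ?exprn_ge0.
- exact/is_cvg_seriesZ/is_cvg_series_exp_coeff.
Qed.

Lemma exp_dominated_shift c : exp_dominated c -> exp_dominated (fun k => c k.+1).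
Proof.
move=> [B B0 [A A0 hA]]; exists B => //; exists (A * B); first by rewrite mulr_ge0.
move=> k; apply: le_trans (hA k.+1) _; rewrite exprS.
have -> : A * B * (B ^+ k / k`!%:R) = A * (B * B ^+ k / k`!%:R) by ring.
rewrite ler_wpM2l// ler_wpM2l ?mulr_ge0 ?exprn_ge0//.
rewrite lef_pV2 ?posrE ?ltr0n ?fact_gt0// ler_nat factS.
by rewrite leq_pmull.
Qed.

Lemma exp_dominated_natM c : exp_dominated c -> exp_dominated (fun k => k%:R * c k).
Proof.
(* The factor k is absorbed by k < 2^k. *)
move=> [B B0 [A A0 hA]]; exists (2 * B); first by rewrite mulr_ge0.
exists A => // k; rewrite normrM ger0_norm// exprMn -mulrA mulrCA.
apply: ler_pM => //; rewrite -natrX ler_nat ltnW// ltn_expl//.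
Qed.

Lemma exp_dominated_diffs c : exp_dominated c -> exp_dominated (pseries_diffs c).
Proof. by move=> /exp_dominated_natM/exp_dominated_shift. Qed.

Lemma der_psum c x : exp_dominated c -> is_derive x 1 (psum c) (psum (pseries_diffs c) x).
Proof.
move=> hc; apply: (@pseries_snd_diffs _ c (`|x| + 1)).
- exact: exp_dominated_cvg.
- by apply: exp_dominated_cvg; exact: exp_dominated_diffs.
- by apply: exp_dominated_cvg; do 2 apply: exp_dominated_diffs.
- by rewrite [ltRHS]ger0_norm ?addr_ge0// ltrDl.
Qed.

Lemma psum_shift c x : cvgn (pseries (fun k => c k.+1) x) ->
  psum c x = c 0%N + x * psum (fun k => c k.+1) x.
Proof.
move=> hc; apply/cvg_lim => //; rewrite -(cvg_shiftS (pseries c x)).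
have L : c 0%N + x * pseries (fun k => c k.+1) x n @[n --> \oo] -->
    c 0%N + x * psum (fun k => c k.+1) x.
  by apply: cvgD; [exact: cvg_cst|exact: cvgMl_tmp].
apply: cvg_trans L; apply: near_eq_cvg; apply: nearW => n.
rewrite /pseries /series /= big_nat_recl//= expr0 mulr1 mulr_sumr; congr (_ + _).
by apply: eq_bigr => i _; rewrite exprS; ring.
Qed.

Lemma psum_lin c d s t x : cvgn (pseries c x) -> cvgn (pseries d x) ->
  psum (fun k => s * c k + t * d k) x = s * psum c x + t * psum d x.
Proof.
move=> hc hd; apply/cvg_lim => //.
have L : s * pseries c x n + t * pseries d x n @[n --> \oo] -->
    s * psum c x + t * psum d x.
  by apply: cvgD; exact: cvgMl_tmp.
apply: cvg_trans L; apply: near_eq_cvg; apply: nearW => n.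
rewrite /pseries /series /= !mulr_sumr -big_split /=.
by apply: eq_bigr => i _; ring.
Qed.

Lemma psum_natM c x : exp_dominated c ->
  psum (fun k => k%:R * c k) x = x * psum (pseries_diffs c) x.
Proof.
move=> hc; rewrite psum_shift ?mul0r ?add0r//.
by apply: exp_dominated_cvg; exact: exp_dominated_diffs.
Qed.

Lemma psum0 c : psum c 0 = c 0%N.
Proof.
apply/cvg_lim => //; rewrite -(cvg_shiftS (pseries c 0)).
apply: cvg_near_cst; apply: nearW => n.
rewrite /pseries /series /= big_nat_recl//= expr0 mulr1 big1 ?addr0// => i _.
by rewrite exprS mul0r mulr0.
Qed.

(** Coefficients shared by both series in powers of (y / 2)^2: p = 1 gives I, since Gamma (k + 1) =
    k!, and p = 3/2 gives L. *)
Definition rgamma2 p q k : R := (Gamma (k%:R + p) * Gamma (k%:R + q))^-1.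

Definition nonpole q := forall k, k%:R + q != 0.

Lemma nonpoleS q : nonpole q -> nonpole (q + 1).
Proof. by move=> hq k; have := hq k.+1; rewrite -natr1 -addrA (addrC 1). Qed.

Lemma nonpole_gt0 q : 0 < q -> nonpole q.
Proof. by move=> q0 k; rewrite gt_eqF// ltr_wpDl. Qed.

Lemma Gamma_neq0 q : nonpole q -> Gamma q != 0.
Proof.
move=> hq; rewrite /Gamma mulf_neq0 ?invr_neq0//.
  rewrite gt_eqF// eulerGamma_gt0//; case: ifPn => [q0|]; first by rewrite addr0.
  by rewrite -leNgt => q0; have := truncnS_gt (- q); lra.
by apply/prodf_neq0 => i _; rewrite addrC; exact: hq.
Qed.

Lemma rgamma2S p q k : nonpole p -> nonpole q ->
  rgamma2 p q k = (k%:R + p) * (k%:R + q) * rgamma2 p q k.+1.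
Proof.
move=> hp hq; have hkp := hp k; have hkq := hq k.
have e (r : R) : k.+1%:R + r = k%:R + r + 1 by rewrite -natr1; ring.
rewrite /rgamma2 !e !GammaS//.
move: hkp hkq; move: (Gamma (k%:R + p)) (Gamma (k%:R + q)) => A B.
move: (k%:R + p) (k%:R + q) => u v u0 v0; rewrite !invfM.
by move: A^-1 B^-1 => A' B'; field; rewrite u0 v0.
Qed.

Lemma bounded_nonincr (b : nat -> R) n : (forall k, 0 <= b k) ->
  (forall k, (n <= k)%N -> b k.+1 <= b k) -> exists A, forall k, b k <= A.
Proof.
move=> b0 hb; exists (\sum_(j < n.+1) b j) => k.
have bs j : (j <= n)%N -> b j <= \sum_(j < n.+1) b j.
  move=> jn; rewrite (bigD1 (Ordinal (jn : j < n.+1)%N))//= lerDl.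
  by apply: sumr_ge0.
have [kn|nk] := leqP k n; first exact: bs.
apply: (@le_trans _ _ (b n)); last exact: bs.
elim: k nk => // k IH; rewrite ltnS leq_eqVlt => /predU1P[<-|nk]; first exact: hb.
by apply: le_trans (IH nk); apply: hb; exact: ltnW.
Qed.

(** Times k! the coefficients are nonincreasing in absolute value once k + q >= 1: each step
    multiplies them by (k + 1) / ((k + p) (k + q)) <= 1. *)
Lemma rgamma2_dominated p q : 1 <= p -> nonpole q -> exp_dominated (rgamma2 p q).
Proof.
move=> p1 hq; have p0 : 0 < p by exact: lt_le_trans p1.
have hp := nonpole_gt0 p p0.
have [||A hA] := @bounded_nonincr (fun k => `|rgamma2 p q k| * k`!%:R) (Num.truncn (1 - q)).+1.
- by move=> k; rewrite mulr_ge0.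
- move=> k /= nk.
  have kq : 1 <= k%:R + q.
    have := truncnS_gt (1 - q); have : (Num.truncn (1 - q)).+1%:R <= k%:R :> R by rewrite ler_nat.
    lra.
  have kp : k.+1%:R <= k%:R + p by rewrite -natr1; lra.
  rewrite (rgamma2S p q k hp hq) factS natrM !normrM.
  have k0 : 0 <= k%:R :> R by [].
  rewrite (ger0_norm (_ : 0 <= k%:R + p)); last by lra.
  rewrite (ger0_norm (_ : 0 <= k%:R + q)); last by lra.
  rewrite -[leRHS]mulrA mulrCA; apply: ler_wpM2r; first by rewrite mulr_ge0.
  by rewrite -[leLHS]mulr1 ler_pM.
exists 1 => //; exists A; first by apply: le_trans (hA 0%N); rewrite mulr_ge0.
by move=> k; rewrite expr1n mulrA mulr1 ler_pdivlMr ?ltr0n ?fact_gt0.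
Qed.

(** Termwise 1 / Gamma (k + q) = (k + q) / Gamma (k + q + 1); on the series the factor k acts as x
    d/dx. *)
Lemma psum_rgamma2_r p q x : 1 <= p -> nonpole q ->
  psum (rgamma2 p q) x = q * psum (rgamma2 p (q + 1)) x
    + x * psum (pseries_diffs (rgamma2 p (q + 1))) x.
Proof.
move=> p1 hq; have dom := rgamma2_dominated p (q + 1) p1 (nonpoleS _ hq).
rewrite -psum_natM// -[X in _ = _ + X]mul1r -psum_lin; last 2 first.
- exact: exp_dominated_cvg.
- by apply: exp_dominated_cvg; exact: exp_dominated_natM.
congr psum; apply/funext => k; rewrite mul1r -mulrDl addrC.
rewrite /rgamma2 addrA GammaS//.
have := hq k; move: (Gamma (k%:R + p)) (Gamma (k%:R + q)) => A B.
move: (k%:R + q) => u u0; rewrite !invfM.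
by move: A^-1 B^-1 => A' B'; field.
Qed.

Lemma diffs_rgamma2_1 q : pseries_diffs (rgamma2 1 q) = rgamma2 1 (q + 1).
Proof.
apply/funext => k; rewrite /pseries_diffs /rgamma2.
rewrite -[X in Gamma (X + q)]natr1 -[k%:R + 1 + q]addrA [1 + q]addrC.
have k1 : k.+1%:R != 0 :> R by rewrite pnatr_eq0.
rewrite (GammaS k.+1%:R k1) natr1; move: k1.
move: (Gamma _) (Gamma _) => A B; move: (k.+1%:R : R) => u u0; rewrite !invfM.
by move: A^-1 B^-1 => A' B'; field.
Qed.

Lemma Gamma_3half : Gamma (3 / 2 : R) = Num.sqrt pi / 2.
Proof.
rewrite (_ : 3 / 2 = 2^-1 + 1); last by field.
by rewrite GammaS ?invr_eq0 ?pnatr_eq0// Gamma_half mulrC.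
Qed.

(** The left side multiplies the coefficients by 2k + 1 = 2 (k + 1/2), which lowers Gamma (k + 3/2)
    to Gamma (k + 1/2). Shifting the index returns to p = 3/2 with q + 1, and the detached term k =
    0 is the inhomogeneity of Struve's equation. *)
Lemma psum_rgamma2_3half q x : nonpole q ->
  psum (rgamma2 (3 / 2) q) x + 2 * x * psum (pseries_diffs (rgamma2 (3 / 2) q)) x =
  2 / (Num.sqrt pi * Gamma q) + 2 * x * psum (rgamma2 (3 / 2) (q + 1)) x.
Proof.
move=> hq; have p1 : 1 <= 3 / 2 :> R by lra.
have dom := rgamma2_dominated _ _ p1 hq.
have dom1 := rgamma2_dominated _ _ p1 (nonpoleS _ hq).
rewrite -mulrA -psum_natM// -[X in X + _ = _]mul1r -psum_lin; last 2 first.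
- exact: exp_dominated_cvg.
- by apply: exp_dominated_cvg; exact: exp_dominated_natM.
have hp k : k%:R + 2^-1 != 0 :> R by rewrite gt_eqF// ltr_wpDl.
have e k : 1 * rgamma2 (3 / 2) q k + 2 * (k%:R * rgamma2 (3 / 2) q k) =
    2 * (Gamma (k%:R + 2^-1) * Gamma (k%:R + q))^-1.
  rewrite /rgamma2 (_ : k%:R + 3 / 2 = k%:R + 2^-1 + 1); last by field.
  rewrite GammaS//; have := hp k.
  move: (Gamma (k%:R + 2^-1)) (Gamma (k%:R + q)) => A B.
  have ek : k%:R = k%:R + 2^-1 - 2^-1 :> R by field.
  rewrite [X in 2 * (X * _)]ek.
  move: (k%:R + 2^-1) => u u0; rewrite !invfM.
  by move: A^-1 B^-1 => A' B'; field.
have eS : (fun k => 2 * (Gamma (k.+1%:R + 2^-1) * Gamma (k.+1%:R + q))^-1) =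
    (* The zero summand brings a scalar multiple into the form of [psum_lin]. *)
    (fun k => 2 * rgamma2 (3 / 2) (q + 1) k + 0 * rgamma2 (3 / 2) (q + 1) k).
  apply/funext => k; rewrite mul0r addr0 /rgamma2 -natr1.
  by congr (2 * (Gamma _ * Gamma _)^-1); [field|ring].
have cS : cvgn (pseries (fun k => 2 * (Gamma (k.+1%:R + 2^-1) * Gamma (k.+1%:R + q))^-1) x).
  apply: exp_dominated_cvg; have [B B0 [A A0 hA]] := dom1.
  exists B => //; exists (2 * A); first by rewrite mulr_ge0.
  move=> k; have /(congr1 (fun f => f k)) /= -> := eS.
  by rewrite mul0r addr0 normrM ger0_norm// -mulrA ler_wpM2l.
rewrite (funext e) psum_shift// eS psum_lin; [|exact: exp_dominated_cvg..].
by rewrite !add0r Gamma_half mul0r addr0; congr (_ + _); ring.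
Qed.

Definition bessel_sum q x : R := psum (rgamma2 1 q) x.
Definition struve_sum q x : R := psum (rgamma2 (3 / 2) q) x.

(* Up to a power of y / 2, the combination of besselI (a - 1/2) and
   struveL (1/2 - a) with the same expansion at 0 as sinI a. *)
Definition sine_series a y : R := Num.sqrt pi / 2 * Gamma (1 - a) *
  ((y / 2) `^ (2 * a - 1) * bessel_sum (a + 2^-1) ((y / 2) ^+ 2)
   - y / 2 * struve_sum (2 - a) ((y / 2) ^+ 2)).

Definition nonnat a := forall k, a != k%:R.

Lemma nonnatS a : 0 < a -> nonnat a -> nonnat (a + 1).
Proof.
move=> a0 ha [|k]; first by rewrite gt_eqF ?addr_gt0.
by rewrite -natr1 (inj_eq (addIr _)).
Qed.

Lemma nonpole_natB a n : nonnat a -> nonpole (n%:R - a).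
Proof.
by move=> ha k; rewrite addrA -natrD subr_eq0 eq_sym.
Qed.

Lemma der_bessel_sum q x : nonpole q -> is_derive x 1 (bessel_sum q) (bessel_sum (q + 1) x).
Proof.
move=> hq; have := der_psum _ x (rgamma2_dominated 1 q (lexx 1) hq).
by rewrite diffs_rgamma2_1.
Qed.

Definition struve_sum' q x : R := psum (pseries_diffs (rgamma2 (3 / 2) q)) x.

Lemma der_struve_sum q x : nonpole q -> is_derive x 1 (struve_sum q) (struve_sum' q x).
Proof.
move=> hq; have p1 : 1 <= 3 / 2 :> R by lra.
exact: der_psum _ x (rgamma2_dominated _ _ p1 hq).
Qed.

Lemma der_sine_series (C a : R) (q1 q2 : R) y : 0 < y -> nonpole q1 -> nonpole q2 ->
  is_derive y 1 (fun y => C * ((y / 2) `^ (2 * a - 1) * bessel_sum q1 ((y / 2) ^+ 2)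
   - y / 2 * struve_sum q2 ((y / 2) ^+ 2)))
  (C * ((y / 2) `^ (2 * a - 1) / y * ((2 * a - 1) * bessel_sum q1 ((y / 2) ^+ 2)
      + 2 * (y / 2) ^+ 2 * bessel_sum (q1 + 1) ((y / 2) ^+ 2))
    - 2^-1 * (struve_sum q2 ((y / 2) ^+ 2)
      + 2 * (y / 2) ^+ 2 * struve_sum' q2 ((y / 2) ^+ 2)))).
Proof.
move=> y0 h1 h2; have y2 : 0 < y / 2 by rewrite divr_gt0.
have dsq : is_derive y 1 (fun z : R => (z / 2) ^+ 2) (y / 2).
  by der_auto; rewrite expr1; field.
have d1 := der_comp (bessel_sum q1) _ _ _ _ (der_bessel_sum q1 _ h1) dsq.
have d2 := der_comp (struve_sum q2) _ _ _ _ (der_struve_sum q2 _ h2) dsq.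
der_auto; first exact: y2.
rewrite (powRB1 _ (2 * a - 1) y2).
move: (_ `^ _) (bessel_sum _ _) (bessel_sum _ _) (struve_sum _ _) (struve_sum' _ _).
by move=> W B1 B2 S1 S2; field; exact: lt0r_neq0.
Qed.

(** Once powers are expanded, the first equation reduces to [R1] and [R3], the second to [R2]. The
    factor sqrt pi / 2 * Gamma (1 - a) in [sine_series] is what turns the constant in [R3] into the
    inhomogeneous term 1 / (2a); [Gm] relates the factors of a and a + 1. *)
Lemma sine_series_system a : 0 < a -> nonnat a ->
  sine_system a (sine_series a) (sine_series (a + 1)).
Proof.
move=> a0 ha y y0; have y2 : 0 < y / 2 by rewrite divr_gt0.
have ha0 : a != 0 by exact: (ha 0%N).
have n1 : nonpole (a + 2^-1) by apply: nonpole_gt0; rewrite addr_gt0.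
have n1' : nonpole (a + 1 + 2^-1) by apply: nonpole_gt0; rewrite !addr_gt0.
have n2 : nonpole (2 - a) by exact: (nonpole_natB a 2 ha).
have n3 : nonpole (1 - a) by exact: (nonpole_natB a 1 ha).
have n3' : nonpole (2 - (a + 1)) by rewrite (_ : 2 - (a + 1) = 1 - a); last by ring.
have q1 : a + 1 + 2^-1 = a + 2^-1 + 1 by ring.
have q2 : 2 - (a + 1) = 1 - a by ring.
have q3 : 2 - a = 1 - a + 1 by ring.
have p32 : 1 <= 3 / 2 :> R by lra.
set X := y / 2 in y2 *; set W := X ^+ 2.
have Gm : Gamma (1 - (a + 1)) = - a^-1 * Gamma (1 - a).
  rewrite (_ : 1 - (a + 1) = - a); last by ring.
  by rewrite (_ : 1 - a = - a + 1) ?GammaS ?oppr_eq0 ?mulNr ?mulrN ?opprK ?mulKf//; ring.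
have G1 : Gamma (1 - a) != 0 by exact: Gamma_neq0.
have sp : Num.sqrt pi != 0 :> R by rewrite gt_eqF// sqrtr_gt0 pi_gt0.
have R1 : bessel_sum (a + 2^-1) W =
    (a + 2^-1) * bessel_sum (a + 2^-1 + 1) W + W * bessel_sum (a + 2^-1 + 1 + 1) W.
  by rewrite /bessel_sum psum_rgamma2_r// diffs_rgamma2_1.
have R2 : struve_sum (1 - a) W = (1 - a) * struve_sum (1 - a + 1) W + W * struve_sum' (1 - a + 1) W.
  by rewrite /struve_sum psum_rgamma2_r.
have R3 : struve_sum (1 - a) W + 2 * W * struve_sum' (1 - a) W =
    2 / (Num.sqrt pi * Gamma (1 - a)) + 2 * W * struve_sum (1 - a + 1) W.
  exact: psum_rgamma2_3half.
split.
- have := der_sine_series (Num.sqrt pi / 2 * Gamma (1 - (a + 1))) (a + 1) _ _ y y0 n1' n3'.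
  rewrite -/X -/W => d; notypeclasses refine (der_eq _ _ _ _ d _).
  rewrite /sine_series -/X -/W Gm q1 q2 R3 q3 R1.
  rewrite (_ : 2 * (a + 1) - 1 = 2 * a - 1 + 2%:R); last by ring.
  rewrite (powRDp X (2 * a - 1))// powR_mulrn ?(ltW y2)// /W.
  move: G1; move: (Gamma _) (_ `^ _) (bessel_sum _ _) (bessel_sum _ _) (struve_sum _ _).
  move=> G P B1 B2 S1 G1; rewrite /X; field.
  by rewrite sp ha0 G1 gt_eqF.
- have := der_sine_series (Num.sqrt pi / 2 * Gamma (1 - a)) a _ _ y y0 n1 n2.
  rewrite -/X -/W => d; notypeclasses refine (der_eq _ _ _ _ d _).
  rewrite /sine_series -/X -/W Gm q1 q2 R2 q3.
  rewrite (_ : 2 * (a + 1) - 1 = 2 * a - 1 + 2%:R); last by ring.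
  rewrite (powRDp X (2 * a - 1))// powR_mulrn ?(ltW y2)// /W.
  move: G1; move: (Gamma _) (_ `^ _) (bessel_sum _ _) (bessel_sum _ _) (struve_sum _ _) (struve_sum' _ _).
  move=> G P B1 B2 S1 S2 G1; rewrite /X; field.
  by rewrite ha0 gt_eqF.
Qed.

End Series.

(** * Non-integer a: the sine transform as a Bessel-Struve combination *)

Section Generic.
Context {R : realType}.
Implicit Types (a m p q x y : R) (k n : nat).

Lemma cvg_psum_right0 (f : R -> R) (l : R) : is_derive (0:R) 1 f l ->
  f ((y / 2) ^+ 2) @[y --> (0:R)^'+] --> f 0.
Proof.
move=> df; have -> : f 0 = f ((0 / 2) ^+ 2) by rewrite mul0r expr0n.
apply: cvg_at_right_filter; apply: (@continuous_comp _ _ _ (fun y : R => (y / 2) ^+ 2) f).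
  by cts_auto.
by rewrite mul0r expr0n; exact: is_derive1_cts df.
Qed.

Lemma cvg_half_powR p : 0 < p -> (y / 2) `^ p @[y --> (0:R)^'+] --> 0.
Proof.
move=> p0; have L := cvg_cpow_right0 (2^-1 `^ p) p p0.
apply: cvg_trans L; apply: near_eq_cvg; near=> y.
have y0 : 0 < y by near: y; exact: nbhs_right_gt.
by rewrite powRM ?(ltW y0)// mulrC.
Unshelve. all: by end_near. Qed.

Lemma cvg_half : (y / 2 : R) @[y --> (0:R)^'+] --> (0:R).
Proof. by apply: cvg_right_cts; [cts_auto|rewrite mul0r]. Qed.

Lemma sine_series_right0 a : 2^-1 < a -> nonnat a ->
  sine_series a y @[y --> (0:R)^'+] --> 0.
Proof.
move=> ha na; have a2 : 0 < 2 * a - 1 by lra.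
have n1 : nonpole (a + 2^-1) by apply: nonpole_gt0; lra.
have n2 : nonpole (2 - a) by exact: (nonpole_natB a 2 na).
have L1 := cvg_psum_right0 _ _ (der_bessel_sum _ 0 n1).
have L2 := cvg_psum_right0 _ _ (der_struve_sum _ 0 n2).
rewrite -[X in _ --> X](mulr0 (Num.sqrt pi / 2 * Gamma (1 - a))); apply: cvgMl_tmp.
rewrite -[X in _ --> X](subr0 0); apply: cvgB.
  rewrite -[X in _ --> X](mul0r (bessel_sum (a + 2^-1) 0)).
  by apply: cvgM => //; exact: cvg_half_powR.
rewrite -[X in _ --> X](mul0r (struve_sum (2 - a) 0)).
by apply: cvgM => //; exact: cvg_half.
Qed.

Lemma sinI0 a : sinI a 0 = 0 :> R.
Proof.
rewrite /sinI (_ : (fun u => _) = fun=> 0).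
  by rewrite /Rintegral integral0.
by apply/funext => u; rewrite mul0r sin0 mul0r.
Qed.

Lemma sinI_right0 a : 2^-1 < a -> sinI (a + 1) y @[y --> (0:R)^'+] --> 0.
Proof.
move=> ha; apply: cvg_right_cts; last exact: sinI0.
exact: is_derive1_cts (der_sinIS a 0 ha).
Qed.

(** The first Struve term is exactly y / (2 (a - 1)) and cancels. The later ones contribute
    O(y^(4-2a)), which vanishes as a < 2, so the leading coefficient of the Bessel series
    remains. *)
Lemma sine_series_small a : 1 < a -> a < 2 ->
  y `^ (1 - 2 * a) * (sine_series a y - y / (2 * (a - 1))) @[y --> (0:R)^'+] -->
  - (2^-1 * Gamma (a - 1) * Gamma (2 - a) / Gamma (2 * a)).
Proof.
move=> a1 a2; have a0 : 0 < a by lra.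
have na : nonnat a.
  move=> k; apply/eqP => ak; move: a1 a2; rewrite ak ltr1n ltr_nat.
  by case: k {ak} => [|[|k]].
have n1 : nonpole (a + 2^-1) by apply: nonpole_gt0; lra.
have n2 : nonpole (2 - a) by exact: (nonpole_natB a 2 na).
have n3 : nonpole (1 - a) by exact: (nonpole_natB a 1 na).
have p32 : 1 <= 3 / 2 :> R by lra.
pose r := rgamma2 (3 / 2) (2 - a); have dom : exp_dominated r by exact: rgamma2_dominated.
pose rs k := r k.+1; have doms : exp_dominated rs by exact: exp_dominated_shift.
set kap := Num.sqrt pi / 2 * Gamma (1 - a).
have G1 := Gamma_neq0 _ n3.
have sp : Num.sqrt pi != 0 :> R by rewrite gt_eqF// sqrtr_gt0 pi_gt0.
have r0 : kap * r 0%N = (1 - a)^-1.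
  rewrite /r /rgamma2 !add0r Gamma_3half (_ : 2 - a = 1 - a + 1); last by ring.
  rewrite GammaS; last by have := n3 0%N; rewrite add0r.
  rewrite /kap; move: G1; move: (Gamma _) => G G1; field.
  by rewrite G1 sp; lra.
have E y : 0 < y -> kap * (2 `^ (1 - 2 * a) * bessel_sum (a + 2^-1) ((y / 2) ^+ 2)
    - y `^ (4 - 2 * a) / 8 * psum rs ((y / 2) ^+ 2)) =
    y `^ (1 - 2 * a) * (sine_series a y - y / (2 * (a - 1))).
  move=> y0; rewrite /sine_series -/kap.
  have -> : struve_sum (2 - a) ((y / 2) ^+ 2) = r 0%N + (y / 2) ^+ 2 * psum rs ((y / 2) ^+ 2).
    by rewrite /struve_sum psum_shift//; exact: exp_dominated_cvg.
  have -> : y / (2 * (a - 1)) = - (y / 2 * (kap * r 0%N)).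
    by rewrite r0; field; lra.
  rewrite (_ : 4 - 2 * a = 1 - 2 * a + 3%:R); last by ring.
  rewrite (powRDp y (1 - 2 * a))// powR_mulrn ?(ltW y0)//.
  have -> : (y / 2) `^ (2 * a - 1) = 2 `^ (1 - 2 * a) / y `^ (1 - 2 * a).
    rewrite powRM ?(ltW y0)// powRV// -[2 * a - 1]opprB !powRN invrK mulrC; by [].
  have yp : y `^ (1 - 2 * a) != 0 by rewrite gt_eqF// powR_gt0.
  by move: (psum _ _) (bessel_sum _ _) (r _) yp; move: (y `^ _) => P S B r_ yp; field.
(* Both constants are reduced to Gamma (a - 1), Gamma (1 - a) and Gamma (a + 1/2); the duplication
   formula for Gamma (2a) then matches them. *)
have c : - (2^-1 * Gamma (a - 1) * Gamma (2 - a) / Gamma (2 * a)) =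
    kap * (2 `^ (1 - 2 * a) * bessel_sum (a + 2^-1) 0 - 0 * psum rs 0).
  rewrite /bessel_sum psum0 /rgamma2 !add0r Gamma1 mul1r mul0r subr0.
  have := Gamma_duplication a a0.
  have -> : Gamma (2 - a) = (1 - a) * Gamma (1 - a).
    by rewrite (_ : 2 - a = 1 - a + 1) ?GammaS//; [have := n3 0%N; rewrite add0r|ring].
  have -> : Gamma a = (a - 1) * Gamma (a - 1).
    by rewrite -{1}(subrK 1 a) GammaS// subr_eq0 gt_eqF.
  have g1 : Gamma (2 * a) != 0 by rewrite gt_eqF// Gamma_gt0// mulr_gt0.
  have g2 : Gamma (a + 2^-1) != 0 by rewrite gt_eqF// Gamma_gt0//; lra.
  rewrite -[1 - 2 * a]opprB powRN /kap.
  have p2 : 2 `^ (2 * a - 1) != 0 :> R by rewrite gt_eqF// powR_gt0.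
  move: g1 g2 p2; move: (2 `^ _) (Gamma (2 * a)) (Gamma (a + _)) (Gamma (a - 1)) (Gamma (1 - a)).
  move=> P g2a gah ga1 g1a h1 h2 h3 D.
  rewrite -[Num.sqrt pi](mulfK h1) D; field.
  by rewrite h1 h2 h3.
rewrite c.
have L : kap * (2 `^ (1 - 2 * a) * bessel_sum (a + 2^-1) ((y / 2) ^+ 2)
    - y `^ (4 - 2 * a) / 8 * psum rs ((y / 2) ^+ 2)) @[y --> (0:R)^'+] -->
    kap * (2 `^ (1 - 2 * a) * bessel_sum (a + 2^-1) 0 - 0 * psum rs 0).
  apply: cvgMl_tmp; apply: cvgB.
    by apply: cvgMl_tmp; exact: cvg_psum_right0 (der_bessel_sum _ 0 n1).
  apply: cvgM; last exact: cvg_psum_right0 (der_psum _ 0 doms).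
  have p4 : 0 < 4 - 2 * a by lra.
  have := cvg_cpow_right0 8^-1 (4 - 2 * a) p4.
  by under eq_cvg do rewrite mulrC.
apply: cvg_trans L; apply: near_eq_cvg; near=> y.
by apply: E; near: y; exact: nbhs_right_gt.
Unshelve. all: by end_near. Qed.

Lemma sinI_sine_series12 a : 1 < a -> a < 2 -> forall y : R, 0 < y -> sinI a y = sine_series a y.
Proof.
move=> a1 a2; have a0 : 0 < a by lra. have ha : 2^-1 < a by lra.
have na : nonnat a.
  move=> k; apply/eqP => ak; move: a1 a2; rewrite ak ltr1n ltr_nat.
  by case: k {ak} => [|[|k]].
have s1 := sinI_system a ha; have s2 := sine_series_system a a0 na.
(* The integrating factor y^(1-2a) removes the term (2a - 1) f / y, which leaves the equations of
   [sine_system_unique0]. That u tends to 0 is the agreement of the two expansions to order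
   y^(2a-1). *)
pose u y := y `^ (1 - 2 * a) * (sinI a y - sine_series a y).
pose v y := sinI (a + 1) y - sine_series (a + 1) y.
move=> y y0; have : u y = 0.
  apply: (sine_system_unique0 a u v ha) => //.
  - move=> x x0; have [_ d1] := s1 x x0; have [_ d2] := s2 x x0.
    rewrite /u; der_auto; first exact: x0.
    rewrite (_ : 1 - 2 * a - 1 = - (2 * a)); last by ring.
    rewrite (_ : 1 - 2 * a = - (2 * a) + 1); last by ring.
    rewrite (powRDp x (- (2 * a)))// powRr1 ?(ltW x0)// /v.
    move: (sinI _ _) (sinI _ _) (sine_series _ _) (sine_series _ _) (_ `^ _) => A B C D E.
    by field; rewrite gt_eqF.
  - move=> x x0; have [d1 _] := s1 x x0; have [d2 _] := s2 x x0.
    rewrite /v /u; der_auto.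
    rewrite (_ : 1 - 2 * a = - (2 * a) + 1); last by ring.
    rewrite (powRDp x (- (2 * a)))// powRr1 ?(ltW x0)// powRN.
    have xp : x `^ (2 * a) != 0 by rewrite gt_eqF// powR_gt0.
    move: xp; move: (sinI _ _) (sine_series _ _) (_ `^ _) => A B E xp.
    by field; rewrite xp gt_eqF.
  - have := cvgB (sinI_small a a1 a2) (sine_series_small a a1 a2).
    rewrite subrr => L0; rewrite (_ : u = (fun x => x `^ (1 - 2 * a) * (sinI a x - x / (2 * (a - 1)))
      - x `^ (1 - 2 * a) * (sine_series a x - x / (2 * (a - 1))))); first exact: L0.
    by apply/funext => x; rewrite /u; ring.
  - have ha1 : 2^-1 < a + 1 by lra.
    have := cvgB (sinI_right0 a ha) (sine_series_right0 (a + 1) ha1 (nonnatS a a0 na)).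
    by rewrite [X in _ --> X]subrr => L0; exact: L0.
rewrite /u => /eqP; rewrite mulf_eq0 powR_eq0 (gt_eqF y0)/= subr_eq0 => /eqP.
by [].
Qed.

Lemma sinI_sine_series a y : 2^-1 < a -> nonnat a -> 0 < y -> sinI a y = sine_series a y.
Proof.
move=> ha na y0; have a0 : 0 < a by lra.
have up n : forall b, n.+1%:R < b -> b < n.+2%:R ->
    forall z : R, 0 < z -> sinI b z = sine_series b z.
  elim: n => [|n IH] b nb bn z z0; first exact: sinI_sine_series12.
  have nb1 : n.+1%:R < b - 1 by rewrite ltrBrDr natr1.
  have bn1 : b - 1 < n.+2%:R by rewrite ltrBlDr natr1.
  have b0 : 0 < b - 1 by apply: lt_trans nb1.
  have hb : 2^-1 < b - 1 by apply: le_lt_trans nb1; rewrite (@le_trans _ _ 1) ?ler1n//; lra.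
  have nb' : nonnat (b - 1).
    move=> k; apply/eqP => bk; move: nb1 bn1; rewrite bk !ltr_nat ltnS => h1 h2.
    by have := leq_trans h1 h2; rewrite ltnn.
  have := sine_system_up _ _ _ _ _ b0 (sinI_system _ hb) (sine_series_system _ b0 nb') (IH _ nb1 bn1) z z0.
  by rewrite subrK.
have /andP[t1 t2] := truncn_itv (ltW a0).
have na' := na (Num.truncn a).
move: t1 t2 na'; case: (Num.truncn a) => [|n] t1 t2 na'; last first.
  by apply: (up n) => //; rewrite lt_neqAle eq_sym na' t1.
(* Here 1/2 < a < 1, so that a + 1 lies in the strip between 1 and 2. *)
apply: (sine_system_down _ _ _ _ _ a0 (sinI_system _ ha) (sine_series_system _ a0 na)) => //.
by apply: (up 0%N); lra.
Qed.

Lemma Gamma_nat1 k : Gamma (k%:R + 1 : R) = k`!%:R.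
Proof.
elim: k => [|k IH]; first by rewrite add0r Gamma1.
have k1 : k.+1%:R != 0 :> R by rewrite pnatr_eq0.
by rewrite GammaS// -natr1 IH factS natrM natr1.
Qed.

Lemma lim_seriesMl (c : R) (u : nat -> R) : cvgn (series u) ->
  limn (series (fun k => c * u k)) = c * limn (series u).
Proof. by move=> cu; exact: (lim_seriesZ c cu). Qed.

Lemma besselI_sum m x : 0 < x -> nonpole (m + 1) ->
  besselI m x = (x / 2) `^ m * bessel_sum (m + 1) ((x / 2) ^+ 2).
Proof.
move=> x0 hm; have x2 : 0 < x / 2 by rewrite divr_gt0.
rewrite /bessel_sum /psum /pseries -lim_seriesMl; last first.
  by apply: exp_dominated_cvg; apply: rgamma2_dominated.
congr (limn (series _)); apply/funext => k.
rewrite powRDp// powRrM powR_mulrn ?(ltW x2)// powR_mulrn ?exprn_ge0 ?(ltW x2)//.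
rewrite /= /rgamma2 Gamma_nat1 addrA; ring.
Qed.

Lemma struveL_sum m x : 0 < x -> nonpole (3 / 2 - m) ->
  struveL (- m) x = (x / 2) `^ (1 - m) * struve_sum (3 / 2 - m) ((x / 2) ^+ 2).
Proof.
move=> x0 hm; have x2 : 0 < x / 2 by rewrite divr_gt0.
rewrite /struve_sum /psum /pseries -lim_seriesMl; last first.
  by apply: exp_dominated_cvg; apply: rgamma2_dominated => //; lra.
congr (limn (series _)); apply/funext => k.
rewrite -addrA (_ : - m + 1 = 1 - m); last by ring.
rewrite powRDp// powRrM powR_mulrn ?(ltW x2)// powR_mulrn ?exprn_ge0 ?(ltW x2)//.
rewrite /= /rgamma2 (_ : k%:R - m + 3 / 2 = k%:R + (3 / 2 - m)); last by ring.
ring.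
Qed.

(** From x - 1 to x the first Gamma factor gains x - 1, the second loses - (x - 1), and the sine
    changes sign; induction on the integer part starts from 0 < x < 1. *)
Lemma Gamma_reflection_nonnat x : nonnat x -> 0 < x ->
  Gamma x * Gamma (1 - x) * sin (pi * x) = pi.
Proof.
move=> nx x0; have /andP[t1 t2] := truncn_itv (ltW x0).
have {}t1 : (Num.truncn x)%:R < x by rewrite lt_neqAle eq_sym nx t1.
move: (Num.truncn x) t1 t2 => n; elim: n x x0 {nx} => [|n IH] x x0 nlx xn.
  exact: Gamma_reflection.
have n0 : 0 <= n%:R :> R by [].
have nlx' : n%:R < x - 1 by rewrite ltrBrDr natr1.
have xn' : x - 1 < n.+1%:R by rewrite ltrBlDr natr1.
have x1 : 0 < x - 1 by exact: le_lt_trans nlx'.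
rewrite -[RHS](IH (x - 1))// -{1}(subrK 1 x) GammaS ?gt_eqF//.
rewrite (_ : 1 - (x - 1) = 1 - x + 1); last by ring.
rewrite GammaS; last by rewrite -opprB oppr_eq0 gt_eqF.
rewrite (_ : pi * x = pi * (x - 1) + pi); last by ring.
rewrite sinDpi; ring.
Qed.

Lemma Gamma_reflection_half m : nonnat (m + 2^-1) -> 0 < m ->
  Gamma (2^-1 - m) * Gamma (2^-1 + m) * cos (pi * m) = pi.
Proof.
move=> nm m0; have h : 0 < m + 2^-1 by rewrite addr_gt0.
rewrite -[RHS](Gamma_reflection_nonnat _ nm h) mulrDr sinDpihalf.
rewrite (_ : 1 - (m + 2^-1) = 2^-1 - m); last by field.
by rewrite (addrC 2^-1 m) (mulrC (Gamma (2^-1 - m))).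
Qed.

(** For a = m + 1/2 the factor Gamma (1 - a) of [sine_series], multiplied by Gamma (m + 1/2) cos (pi
    m), is pi by reflection. *)
Lemma sinI_bessel_struve m y : 0 < m -> nonnat (m + 2^-1) -> 0 < y ->
  Gamma (m + 2^-1) * cos (pi * m) * sinI (m + 2^-1) y =
  pi * Num.sqrt pi / 2 * (y / 2) `^ m * (besselI m y - struveL (- m) y).
Proof.
move=> m0 hm y0; have y2 : 0 < y / 2 by rewrite divr_gt0.
have h : 2^-1 < m + 2^-1 by rewrite ltrDr.
rewrite sinI_sine_series// besselI_sum//; last by apply: nonpole_gt0; rewrite addr_gt0.
have n2 : 3 / 2 - m = 2 - (m + 2^-1) by field.
rewrite struveL_sum// ?n2; last exact: (nonpole_natB _ 2 hm).
rewrite -[X in _ = X * Num.sqrt pi / 2 * _ * _](Gamma_reflection_half m hm m0) /sine_series.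
rewrite (_ : m + 2^-1 + 2^-1 = m + 1); last by field.
rewrite (_ : 2 * (m + 2^-1) - 1 = m + m); last by field.
rewrite (_ : 1 - (m + 2^-1) = 2^-1 - m); last by field.
rewrite (addrC 2^-1 m) (powRDp (y / 2) m)// (powRDp (y / 2) 1 (- m))// powRr1 ?(ltW y2)// powRN.
have xp : (y / 2) `^ m != 0 by rewrite gt_eqF// powR_gt0.
move: xp; move: (_ `^ _) (bessel_sum _ _) (struve_sum _ _) (Gamma _) (Gamma _) (cos _).
by move=> P B S G1 G2 C xp; field.
Qed.

End Generic.

(** * The exponential integral *)

Section ExponentialIntegral.
Context {R : realType}.
Local Notation mu := (@lebesgue_measure R).
Local Notation Rpos := (`]0%R, +oo[%classic : set R).
Implicit Types (x y z t : R) (k n : nat).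

(* The junk value 0^-1 = 0 makes the constant coefficient vanish. *)
Definition ein_coeff k : R := (k%:R * k`!%:R)^-1.
(** The entire function \int_0^y (e^t - 1) / t dt, the nonlogarithmic part of Ei. *)
Definition ein y : R := psum ein_coeff y.
Definition ein' y : R := psum (pseries_diffs ein_coeff) y.

Lemma ein_coeff_dominated : exp_dominated ein_coeff.
Proof.
exists 1 => //; exists 1 => // k; rewrite mul1r expr1n mul1r /ein_coeff ger0_norm ?invr_ge0//.
case: k => [|k]; first by rewrite mul0r invr0 fact0 invr1.
have k0 : 0 < k.+1%:R :> R by [].
have f0 : 0 < (k.+1)`!%:R :> R by rewrite ltr0n fact_gt0.
by rewrite lef_pV2 ?posrE ?mulr_gt0// ler_peMl ?ler1n// ltW.
Qed.

Lemma der_ein y : is_derive y 1 ein (ein' y).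
Proof. by apply: der_psum; exact: ein_coeff_dominated. Qed.

Lemma ein0 : ein 0 = 0.
Proof. by rewrite /ein psum0 /ein_coeff mul0r invr0. Qed.

Lemma mul_ein' y : y * ein' y = expR y - 1.
Proof.
have dom : exp_dominated (fun k => k`!%:R^-1 : R).
  exists 1 => //; exists 1 => // k.
  by rewrite mul1r expr1n mul1r ger0_norm ?invr_ge0.
have E : expR y = psum (fun k => k`!%:R^-1) y.
  by rewrite expRE.
rewrite E psum_shift; last exact: exp_dominated_cvg _ _ (exp_dominated_shift _ dom).
rewrite fact0 invr1 addrAC subrr add0r; congr (_ * psum _ _); apply/funext => k.
rewrite /pseries_diffs /ein_coeff invfM mulrA mulfV ?mul1r//.
Qed.

Lemma ein_le_expR y : 0 < y -> `|ein y| <= expR y.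
Proof.
move=> y0; have ein'_ge0 z : 0 < z -> 0 <= ein' z.
  move=> z0; rewrite -(pmulr_rge0 _ z0) mul_ein' subr_ge0.
  by rewrite -expR0 ler_expR ltW.
have c0 : ein x @[x --> (0:R)^'+] --> 0.
  by apply: cvg_right_cts ein0; exact: is_derive1_cts (der_ein 0).
have e0 : 0 <= ein y.
  by apply: (der_ge0_right0 ein ein' y y0) => // x x0 _; split; [exact: der_ein|exact: ein'_ge0].
rewrite ger0_norm// -subr_ge0; apply: le_trans (_ : 0 <= expR y - 1 - ein y) _; last lra.
apply: (der_ge0_right0 (fun x => expR x - 1 - ein x) (fun x => expR x - ein' x) y y0).
  move=> x x0 _; have d := der_ein x; split; first by der_auto; ring.
  rewrite -(pmulr_rge0 _ x0) mulrBr mul_ein' subr_ge0.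
  have : expR (- x) >= 1 - x by exact: expR_ge1Dx.
  rewrite expRN => h; have ex := expR_gt0 x.
  have : expR x * (1 - x) <= 1 by rewrite mulrC -ler_pdivlMr// mul1r.
  lra.
apply: cvg_right_cts; last by rewrite ein0 expR0 !subrr.
by have d := der_ein 0; cts_auto.
Qed.

(** Antiderivatives of e^y / y and of e^(-y) / y on y > 0; Ei (y) and Ei (-y) differ from them by
    one common constant. *)
Definition expint y : R := ln y + ein y.
Definition expintN y : R := ln y + ein (- y).

Lemma der_expint y : 0 < y -> is_derive y 1 expint (expR y / y).
Proof.
move=> y0; have d1 := is_derive1_ln y0; have d2 := der_ein y; rewrite /expint; der_auto.
rewrite -(mulfK (lt0r_neq0 y0) (_ + _)); congr (_ / y).
by rewrite mulrDl mulVf ?gt_eqF// mulrC mul_ein'; ring.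
Qed.

Lemma der_ein_comp_opp y : is_derive y 1 (fun z => ein (- z)) (- ein' (- y)).
Proof.
have := der_comp ein _ y _ _ (der_ein (- y)) (der_neg _ _ _ (der_id y)).
by rewrite mulrN1.
Qed.

Lemma der_expintN y : 0 < y -> is_derive y 1 expintN (expR (- y) / y).
Proof.
move=> y0; have d1 := is_derive1_ln y0; have d2 := der_ein_comp_opp y; rewrite /expintN; der_auto.
rewrite -(mulfK (lt0r_neq0 y0) (_ + _)); congr (_ / y).
by rewrite mulrDl mulVf ?gt_eqF// mulNr -mulrN mulrC mul_ein'; ring.
Qed.

Definition eint t : R := expR (- t) / t.

Lemma cts_eint t : t != 0 -> {for t, continuous eint}.
Proof. by move=> t0; rewrite /eint; cts_auto. Qed.

Lemma itv_gt0_Rpos y : 0 < y -> `[y, +oo[ `<=` Rpos.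
Proof.
by move=> y0 t/=; rewrite !in_itv/= !andbT; exact: lt_le_trans.
Qed.

Lemma eint_le y t : 0 < y -> y <= t -> 0 <= eint t <= y^-1 * gammaf 1 t.
Proof.
move=> y0 yt; have t0 : 0 < t by exact: lt_le_trans yt.
rewrite /eint /gammaf subrr powRr0 mul1r divr_ge0 ?expR_ge0 ?(ltW t0)//=.
by rewrite mulrC ler_wpM2r ?expR_ge0// lef_pV2.
Qed.

Lemma gammaf1_integrable y : 0 < y -> mu.-integrable `[y, +oo[ (EFin \o (fun t => y^-1 * gammaf 1 t)).
Proof.
move=> y0; have I : mu.-integrable `[y, +oo[ (EFin \o gammaf 1).
  apply: (@integrableS _ _ R mu Rpos); [exact: measurable_Rpos|by []| |exact: gammaf_integrable].
  exact: itv_gt0_Rpos.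
by apply: (integrableRZl _ _ I).
Qed.

Lemma eint_integrable y : 0 < y -> mu.-integrable `[y, +oo[ (EFin \o eint).
Proof.
move=> y0; apply: (dominated_integrableR _ _ _ (gammaf1_integrable y y0)) => //.
  apply: (@measurable_funS _ _ _ _ Rpos); [exact: measurable_Rpos|exact: itv_gt0_Rpos|].
  by apply: cts_measurable0y => x x0; apply: cts_eint; rewrite gt_eqF.
move=> t /=; rewrite in_itv/= andbT => yt.
by have /andP[h1 h2] := eint_le y t y0 yt; rewrite ger0_norm.
Qed.

Lemma eint_itv y z : 0 < y -> y < z -> \int[mu]_(t in `[y, z]) eint t = expintN z - expintN y.
Proof.
move=> y0 yz; have h1 t : y <= t <= z -> {for t, continuous eint}.
  by move=> /andP[yt _]; apply: cts_eint; rewrite gt_eqF// (lt_le_trans y0).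
have h2 t : y <= t <= z -> is_derive t 1 expintN (eint t).
  by move=> /andP[yt _]; exact: der_expintN _ (lt_le_trans y0 yt).
by rewrite /Rintegral (itv_FTC2 _ _ _ _ yz h1 h2).
Qed.

Lemma eint_itvN y z : 0 < y -> y < z ->
  \int[mu]_(t in `[- z, - y]) eint t = expint y - expint z.
Proof.
move=> y0 yz.
have h t : - z <= t <= - y -> 0 < - t by move=> /andP[_ ty]; rewrite ltrNr oppr0 (le_lt_trans ty)// ltrNl oppr0.
have yz' : - z < - y by rewrite ltrN2.
have h1 t : - z <= t <= - y -> {for t, continuous eint}.
  by move=> /h t0; apply: cts_eint; rewrite lt_eqF// -oppr_gt0.
have h2 t : - z <= t <= - y -> is_derive t 1 (fun t => expint (- t)) (eint t).
  move=> /h t0; have d := der_comp expint _ t _ _ (der_expint (- t) t0) (der_neg _ _ _ (der_id t)).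
  by apply: der_eq d _; rewrite /eint invrN mulrN1 mulrN opprK.
by rewrite /Rintegral (itv_FTC2 _ _ _ _ yz' h1 h2)/= !opprK.
Qed.

Lemma Ei_neg y : 0 < y -> Ei (- y) = - \int[mu]_(t in `[y, +oo[) eint t.
Proof. by move=> y0; rewrite /Ei oppr_gt0 lt_gtF// opprK. Qed.

Lemma Ei_neg_diff y z : 0 < y -> y < z -> Ei (- z) - Ei (- y) = expintN z - expintN y.
Proof.
move=> y0 yz; have z0 : 0 < z by exact: lt_trans yz.
rewrite !Ei_neg// -(eint_itv y z)//.
have If := eint_integrable y y0.
have b1 : (BLeft y <= BRight z)%O by rewrite bnd_simp ltW.
have b2 : (BRight z <= +oo)%O by [].
have := Rintegral_itvB If b1 b2.
rewrite Rintegral_itv_obnd_cbnd; last first.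
  apply: (@integrableS _ _ R mu `[y, +oo[) => // t/=.
  by rewrite !in_itv/= !andbT => /(lt_trans yz)/ltW.
lra.
Qed.

(** This is Euler's constant; the proof uses that it is the same for both signs of the argument. *)
Definition expint_cst : R := Ei (- 1) - expintN 1.

Lemma Ei_negE y : 0 < y -> Ei (- y) = expintN y + expint_cst.
Proof.
move=> y0; rewrite /expint_cst; have [y1|y1|->] := ltgtP y 1.
- by have := Ei_neg_diff y 1 y0 y1; lra.
- by have := Ei_neg_diff 1 y ltr01 y1; lra.
- lra.
Qed.

(** In the truncated principal value the terms ln e of the two integrals cancel, leaving ein e - ein
    (- e), which tends to 0. *)
Lemma Ei_posE y : 0 < y -> Ei y = expint y + expint_cst.
Proof.
move=> y0; rewrite /Ei y0; apply/cvg_lim => //.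
have L : expint y - (ein e - ein (- e)) + expint_cst @[e --> (0:R)^'+] --> expint y + expint_cst.
  apply: cvg_right_cts; last by rewrite oppr0 subrr subr0.
  by have d1 := der_ein 0; have d2 := der_ein_comp_opp 0; cts_auto.
apply: cvg_trans L; apply: near_eq_cvg; near=> e.
have e0 : 0 < e by near: e; exact: nbhs_right_gt.
have ey : e < y by near: e; exact: nbhs_right_lt.
have := Ei_negE e e0; rewrite Ei_neg// => h.
by rewrite eint_itvN// /expint; move: h; rewrite /expintN/eint; lra.
Unshelve. all: by end_near. Qed.

Lemma Ei_neg_bound y : 0 < y -> `|Ei (- y)| <= eulerGamma 1 / y.
Proof.
move=> y0; rewrite Ei_neg// normrN ger0_norm; last first.
  by apply: Rintegral_ge0 => t; rewrite /= in_itv/= andbT => /(eint_le y t y0)/andP[].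
rewrite -lee_fin -integrableR_EFin//; last exact: eint_integrable.
apply: (@le_trans _ _ (\int[mu]_(t in `[y, +oo[) (y^-1 * gammaf 1 t)%:E)%E).
  apply: ge0_le_integral => //.
  - by move=> t; rewrite /= in_itv/= andbT lee_fin => /(eint_le y t y0)/andP[].
  - exact: measurable_int (eint_integrable y y0).
  - exact: measurable_int (gammaf1_integrable y y0).
  - by move=> t; rewrite /= in_itv/= andbT lee_fin => /(eint_le y t y0)/andP[].
have I : mu.-integrable Rpos (EFin \o (fun t => y^-1 * gammaf 1 t)).
  by apply: integrableRZl; [exact: measurable_Rpos|exact: gammaf_integrable].
apply: (@le_trans _ _ (\int[mu]_(t in Rpos) (y^-1 * gammaf 1 t)%:E)%E).
  apply: ge0_subset_integral => //.
  - exact: measurable_int I.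
  - by move=> t _; rewrite lee_fin mulr_ge0 ?invr_ge0 ?(ltW y0) ?gammaf_ge0.
  - exact: itv_gt0_Rpos.
rewrite integrableR_EFin; [|exact: measurable_Rpos|]; last first.
  exact: I.
rewrite lee_fin RintegralZl; [|exact: measurable_Rpos|exact: gammaf_integrable].
by rewrite mulrC.
Qed.

Lemma der_Ei_pos y : 0 < y -> is_derive y 1 Ei (expR y / y).
Proof.
move=> y0.
apply: (is_derive_near_pos (fun z => expint z + expint_cst) _ _ _ y0 _ _) => [z z0|].
  by rewrite Ei_posE.
by have d := der_expint y y0; der_auto; rewrite addr0.
Qed.

Lemma der_Ei_neg y : 0 < y -> is_derive y 1 (fun z => Ei (- z)) (expR (- y) / y).
Proof.
move=> y0.
apply: (is_derive_near_pos (fun z => expintN z + expint_cst) _ _ _ y0 _ _) => [z z0|].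
  by rewrite Ei_negE.
by have d := der_expintN y y0; der_auto; rewrite addr0.
Qed.

(** P = [eiP] and Q = [eiQ] satisfy P' = - P + 1/y and Q' = Q + 1/y, so (P - Q) / 2 solves S'' = S -
    1/y. *)
Definition eiP y : R := expR (- y) * Ei y.
Definition eiQ y : R := expR y * Ei (- y).

Lemma der_eiP y : 0 < y -> is_derive y 1 eiP (- eiP y + y^-1).
Proof.
move=> y0; have d := der_Ei_pos y y0; rewrite /eiP; der_auto.
rewrite mulrN1 mulNr mulrA -expRD addNr expR0 mul1r; ring.
Qed.

Lemma der_eiQ y : 0 < y -> is_derive y 1 eiQ (eiQ y + y^-1).
Proof.
move=> y0; have d := der_Ei_neg y y0; rewrite /eiQ; der_auto.
by rewrite mulr1 mulrA -expRD subrr expR0 mul1r.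
Qed.

Lemma mul_ln_right0 : y * ln y @[y --> (0:R)^'+] --> 0.
Proof.
have h : 0 < 2^-1 :> R by [].
apply: (squeeze_cvg0 _ _ (fun y => 2 * y `^ 2^-1)); last exact: cvg_cpow_right0.
near=> y; have y0 : 0 < y by near: y; exact: nbhs_right_gt.
have y1 : y < 1 by near: y; exact: nbhs_right_lt.
rewrite normrM gtr0_norm// ltr0_norm; last by rewrite ln_lt0// y0.
have p0 : 0 < y `^ (- 2^-1) by exact: powR_gt0.
(* The bound ln z <= z at z = y^(-1/2) gives - ln y <= 2 y^(-1/2). *)
have := ltW (ln_sublinear p0); rewrite ln_powR => h1.
have : - ln y <= 2 * y `^ (- 2^-1) by lra.
rewrite -(ler_pM2l y0) => /le_trans; apply.
rewrite powRN mulrCA ler_pM2l// ler_pdivrMr ?powR_gt0// -powRDp//.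
by rewrite (_ : 2^-1 + 2^-1 = 1 :> R) ?powRr1 ?(ltW y0)//; lra.
Unshelve. all: by end_near. Qed.

(** The logarithms combine to - ln y (e^y - e^(-y)). By [mul_ein'] the second factor is y (ein' y +
    ein' (- y)), so y ln y tending to 0 disposes of them; the other terms are continuous and vanish
    at 0. *)
Lemma eiPQ_right0 : eiP y - eiQ y @[y --> (0:R)^'+] --> 0.
Proof.
have d1 := der_ein 0; have d2 := der_ein_comp_opp 0.
have L1 : expR (- y) * (ein y - ein (- y)) @[y --> (0:R)^'+] --> 0.
  by apply: cvg_right_cts; [cts_auto|rewrite oppr0 subrr mulr0].
have L2 : (expR y - expR (- y)) * (ein (- y) + expint_cst) @[y --> (0:R)^'+] --> 0.
  by apply: cvg_right_cts; [cts_auto|rewrite oppr0 subrr mul0r].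
have dd := der_psum _ 0 (exp_dominated_diffs _ ein_coeff_dominated).
have dd1 : is_derive (0:R) 1 ein' (psum (pseries_diffs (pseries_diffs ein_coeff)) 0) by exact: dd.
have dd2 : is_derive (0:R) 1 (fun y => ein' (- y)) (- psum (pseries_diffs (pseries_diffs ein_coeff)) 0).
  have d3 : is_derive (0:R) 1 (fun y : R => - y) (- 1) := der_neg _ _ _ (der_id _).
  have d4 : is_derive (- (0:R)) 1 ein' (psum (pseries_diffs (pseries_diffs ein_coeff)) 0).
    by rewrite oppr0.
  by have := der_comp ein' _ _ _ _ d4 d3; rewrite mulrN1.
have L3 : ein' y + ein' (- y) @[y --> (0:R)^'+] --> ein' 0 + ein' (- 0).
  by apply: (cvg_right_cts (fun y => ein' y + ein' (- y))) => //; cts_auto.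
have L : expR (- y) * (ein y - ein (- y)) - (expR y - expR (- y)) * (ein (- y) + expint_cst) -
    y * ln y * (ein' y + ein' (- y)) @[y --> (0:R)^'+] --> 0.
  rewrite -[X in _ --> X](subr0 0) -[X in _ --> _ - X](mul0r (ein' 0 + ein' (- 0))).
  apply: cvgB; last exact: cvgM mul_ln_right0 L3.
  by rewrite -[X in _ --> X](subr0 0); exact: cvgB L1 L2.
apply: cvg_trans L; apply: near_eq_cvg; near=> y.
have y0 : 0 < y by near: y; exact: nbhs_right_gt.
rewrite /= /eiP /eiQ Ei_posE// Ei_negE// /expint /expintN.
have h1 := mul_ein' y; have h2 := mul_ein' (- y).
have -> : y * ln y * (ein' y + ein' (- y)) = ln y * (expR y - expR (- y)).
  by rewrite (_ : ln y * _ = ln y * (expR y - 1 - (expR (- y) - 1))); [rewrite -h1 -h2; ring|ring].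
ring.
Unshelve. all: by end_near. Qed.

Lemma der0_pos_cst (f : R -> R) : (forall x, 0 < x -> is_derive x 1 f 0) ->
  forall x y, 0 < x -> 0 < y -> f x = f y.
Proof.
move=> df; have le x y : 0 < x -> x <= y -> f x = f y.
  move=> x0 xy; have [||c _] := @MVT_segment _ f (fun=> 0) x y xy.
  - by move=> z; rewrite in_itv/= => /andP[xz _]; apply: df; exact: lt_trans xz.
  - apply: within_cts => z /andP[xz _].
    exact: is_derive1_cts (df z (lt_le_trans x0 xz)).
  - by rewrite mul0r => /subr0_eq.
move=> x y x0 y0; case/orP: (le_total x y) => h; first exact: le.
by apply/esym; exact: le.
Qed.

(** This crude decay, from |Ei y| = O(e^y), suffices to exclude a multiple of e^y in [sinI1E]. *)
Lemma eiP_decay : expR (- y) * eiP y @[y --> +oo] --> 0.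
Proof.
apply: (squeeze_cvg0 _ _ (fun y => (2 + `|expint_cst|) * expR (- y))); last first.
  rewrite -[X in _ --> X](mulr0 (2 + `|expint_cst|)); apply: cvgMl_tmp.
  exact: cvgr_expR.
near=> y; have y1 : 1 < y by near: y; exact: nbhs_pinfty_gt.
have y0 : 0 < y by exact: lt_trans y1.
rewrite /eiP Ei_posE// !normrM !(ger0_norm (expR_ge0 _)) mulrCA mulrC ler_wpM2r ?expR_ge0//.
rewrite expRN ler_pdivrMl ?expR_gt0// /expint.
have h1 : `|ln y| <= expR y.
  rewrite ger0_norm ?ln_ge0 ?(ltW y1)//; have := ltW (ln_sublinear y0) => /le_trans; apply.
  by apply: le_trans (expR_ge1Dx y); rewrite lerDr.
have h2 := ein_le_expR y y0.
have h3 : `|expint_cst| <= expR y * `|expint_cst|.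
  by rewrite ler_peMl// -expR0 ler_expR ltW.
have := ler_normD (ln y + ein y) expint_cst; have := ler_normD (ln y) (ein y); lra.
Unshelve. all: by end_near. Qed.

Lemma eiQ_decay : expR (- y) * eiQ y @[y --> +oo] --> 0.
Proof.
apply: (squeeze_cvg0 _ _ (fun y => eulerGamma 1 * y^-1)); last first.
  rewrite -[X in _ --> X](mulr0 (eulerGamma 1)); apply: cvgMl_tmp.
  have L : (y `^ (- 1) : R) @[y --> +oo] --> (0:R) := cvg_powRN 1 ltr01.
  apply: cvg_trans L; apply: near_eq_cvg; near=> y.
  have y0 : 0 < y by near: y; exact: nbhs_pinfty_gt.
  by rewrite powR_inv1 ?ltW.
near=> y; have y0 : 0 < y by near: y; exact: nbhs_pinfty_gt.
by rewrite /eiQ mulrA -expRD addNr expR0 mul1r Ei_neg_bound.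
Unshelve. all: by end_near. Qed.

Lemma cts_under (f : R -> R -> R) (G : R -> R) x :
  (forall y, mu.-integrable Rpos (EFin \o f y)) ->
  (forall y u, 0 < u -> {for y, continuous (f^~ u)}) ->
  mu.-integrable Rpos (EFin \o G) -> (forall y u, 0 < u -> `|f y u| <= G u) ->
  {for x, continuous (fun y => \int[mu]_(u in Rpos) f y u)}.
Proof.
move=> intf cf intG fG; have mRpos := @measurable_Rpos R.
apply: (@continuity_under_integral _ _ _ mu f Rpos mRpos (x - 1) (x + 1) _ _ G intG) => //.
- by apply: aeW => u; rewrite RposP => u0 y _; exact: cf.
- by move=> y _; apply: aeW => u; rewrite RposP => u0; exact: fG.
- by rewrite inE/= in_itv/=; lra.
Qed.

Lemma cts_cosI a x : 2^-1 < a -> {for x, continuous (cosI a)}.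
Proof.
move=> ha; have I := tkernel_integrable a ha; apply: (cts_under _ (tkernel a)) => //.
- by move=> y; exact: cos_mul_integrable.
- by move=> y u _; cts_auto.
- move=> y u _; rewrite normrM (ger0_norm (ltW (tkernel_gt0 _ _))) ler_piMl ?(ltW (tkernel_gt0 _ _))//.
  by rewrite ler_norml cos_geN1 cos_le1.
Qed.

Lemma cts_sinI a x : 2^-1 < a -> {for x, continuous (sinI a)}.
Proof.
move=> ha; have I := tkernel_integrable a ha; apply: (cts_under _ (tkernel a)) => //.
- by move=> y; exact: sin_mul_integrable.
- by move=> y u _; cts_auto.
- move=> y u _; rewrite normrM (ger0_norm (ltW (tkernel_gt0 _ _))) ler_piMl ?(ltW (tkernel_gt0 _ _))//.
  by rewrite ler_norml sin_geN1 sin_le1.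
Qed.

Lemma sinI_bound a y : 2^-1 < a -> `|sinI a y| <= \int[mu]_(u in Rpos) tkernel a u.
Proof.
move=> ha; have I := tkernel_integrable a ha; have mR := @measurable_Rpos R.
have Is : mu.-integrable Rpos (EFin \o (fun u => sin (y * u) * tkernel a u)).
  exact: sin_mul_integrable.
have h := @le_normr_Rintegral _ _ R mu Rpos _ mR Is; refine (le_trans h _).
apply: le_Rintegral => //; first exact: (integrable_norm Is).
move=> u _; rewrite normrM (ger0_norm (ltW (tkernel_gt0 _ _))) ler_piMl ?(ltW (tkernel_gt0 _ _))//.
by rewrite ler_norml sin_geN1 sin_le1.
Qed.

Definition sine_odd1 y : R := 2^-1 * (eiP y - eiQ y).
(** The second equation at a = 1 solved for S_2, namely (S_1 - y S_1') / 2, with S_1' = - (P + Q) /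
    2. *)
Definition sine_odd2 y : R := 2^-1 * sine_odd1 y + 4^-1 * y * (eiP y + eiQ y).

Lemma sine_odd1_system : sine_system 1 sine_odd1 sine_odd2.
Proof.
move=> y y0; have d1 := der_eiP y y0; have d2 := der_eiQ y y0; split.
  rewrite /sine_odd2 /sine_odd1; der_auto; move: (eiP y) (eiQ y) => P Q; field; lra.
rewrite /sine_odd2 /sine_odd1; der_auto; move: (eiP y) (eiQ y) => P Q; field; lra.
Qed.

Lemma sinI1E y : 0 < y -> sinI 1 y = 2^-1 * (eiP y - eiQ y).
Proof.
have h1 : 2^-1 < 1 :> R by lra.
have s1 := sinI_system 1 h1; have s2 := sine_odd1_system.
pose d y := sinI 1 y - sine_odd1 y.
(* By the second equation e is the derivative of d, and the first gives e' = d. So d is a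
   combination of e^y and e^(-y), with coefficients c / 2 and c' / 2. *)
pose e y := (d y - 2 * (sinI (1 + 1) y - sine_odd2 y)) / y.
have dd x : 0 < x -> is_derive x 1 d (e x).
  move=> x0; have [_ d1] := s1 x x0; have [_ d2] := s2 x x0.
  rewrite /e /d; der_auto; move: (sinI _ _) (sinI _ _) (sine_odd1 _) (sine_odd2 _) => A B C D.
  by field; rewrite gt_eqF.
have de x : 0 < x -> is_derive x 1 e (d x).
  move=> x0; have [d1 _] := s1 x x0; have [d2 _] := s2 x x0; have d3 := dd x x0.
  rewrite /e; der_auto; first by rewrite gt_eqF.
  rewrite /e /d; move: (sinI _ _) (sinI _ _) (sine_odd1 _) (sine_odd2 _) => A B C D.
  by field; rewrite gt_eqF.
have [c cE] : exists c, forall x, 0 < x -> expR (- x) * (d x + e x) = c.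
  exists (expR (- 1) * (d 1 + e 1)) => x x0.
  apply: (der0_pos_cst (fun x => expR (- x) * (d x + e x))) => // z z0.
  by have d1 := dd z z0; have d2 := de z z0; der_auto; ring.
have [c' c'E] : exists c', forall x, 0 < x -> expR x * (d x - e x) = c'.
  exists (expR 1 * (d 1 - e 1)) => x x0.
  apply: (der0_pos_cst (fun x => expR x * (d x - e x))) => // z z0.
  by have d1 := dd z z0; have d2 := de z z0; der_auto; ring.
have eN x : expR x * expR (- x) = 1 by rewrite -expRD subrr expR0.
have dE x : 0 < x -> d x = 2^-1 * (c * expR x + c' * expR (- x)).
  move=> x0; rewrite -(cE x x0) -(c'E x x0).
  rewrite [RHS](_ : _ = 2^-1 * (expR x * expR (- x)) * (2 * d x)); last by ring.
  by rewrite eN; field.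
(* e^(-x) d x tends to c / 2 by the explicit form, and to 0 since S_1 is bounded and P and Q are
   o(e^x). *)
have c0 : c = 0.
  have L1 : expR (- x) * d x @[x --> +oo] --> 2^-1 * (c + c' * 0 ^+ 2).
    have L : 2^-1 * (c + c' * expR (- x) ^+ 2) @[x --> +oo] --> 2^-1 * (c + c' * 0 ^+ 2).
      apply: cvgMl_tmp; apply: cvgD; first exact: cvg_cst.
      apply: cvgMl_tmp; rewrite expr2; under eq_cvg do rewrite expr2.
      by apply: cvgM; exact: cvgr_expR.
    apply: cvg_trans L; apply: near_eq_cvg; near=> x.
    have x0 : 0 < x by near: x; exact: nbhs_pinfty_gt.
    have h : 2^-1 * (c * (expR x * expR (- x)) + c' * expR (- x) ^+ 2) =
        2^-1 * (c + c' * expR (- x) ^+ 2) by rewrite eN mulr1.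
    by rewrite dE// -h; ring.
  have L2 : expR (- x) * d x @[x --> +oo] --> (0 - 2^-1 * (0 - 0) : R).
    have L : expR (- x) * sinI 1 x - 2^-1 * (expR (- x) * eiP x - expR (- x) * eiQ x) @[x --> +oo] -->
        (0 - 2^-1 * (0 - 0) : R).
      apply: cvgB; last by apply: cvgMl_tmp; apply: cvgB; [exact: eiP_decay|exact: eiQ_decay].
      apply: (squeeze_cvg0 _ _ (fun x => expR (- x) * \int[mu]_(u in Rpos) tkernel 1 u)).
        apply: nearW => x; rewrite normrM ger0_norm ?expR_ge0// ler_wpM2l ?expR_ge0//.
        exact: sinI_bound.
      rewrite -[X in _ --> X](mul0r (\int[mu]_(u in Rpos) tkernel 1 u)).
      by apply: cvgMr_tmp; exact: cvgr_expR.
    apply: cvg_trans L; apply: near_eq_cvg; apply: nearW => x.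
    by rewrite /d /sine_odd1; ring.
  have h : 2^-1 * (c + c' * 0 ^+ 2) = 0 - 2^-1 * (0 - 0) .
    exact: (cvg_unique (@norm_hausdorff _ R^o) L1 L2).
  by move: h; rewrite expr2 !mulr0 addr0 subr0 mulr0 subr0; lra.
(* With c = 0, the limit of d at 0 is c' / 2, and it is 0 because S_1 and P - Q vanish there. *)
have c'0 : c' = 0.
  have L1 : d x @[x --> (0:R)^'+] --> 2^-1 * (c * expR 0 + c' * expR (- 0)).
    have L : 2^-1 * (c * expR x + c' * expR (- x)) @[x --> (0:R)^'+] -->
        2^-1 * (c * expR 0 + c' * expR (- 0)).
      by apply: (cvg_right_cts (fun x => 2^-1 * (c * expR x + c' * expR (- x)))) => //; cts_auto.
    apply: cvg_trans L; apply: near_eq_cvg; near=> x.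
    by rewrite dE//; near: x; exact: nbhs_right_gt.
  have L2 : d x @[x --> (0:R)^'+] --> (0 - 2^-1 * 0 : R).
    apply: cvgB; last by apply: cvgMl_tmp; exact: eiPQ_right0.
    by apply: cvg_right_cts; [exact: cts_sinI|exact: sinI0].
  have h : 2^-1 * (c * expR 0 + c' * expR (- 0)) = 0 - 2^-1 * 0 .
    exact: (cvg_unique (@norm_hausdorff _ R^o) L1 L2).
  by move: h; rewrite c0 oppr0 expR0; lra.
by move=> y0; apply/eqP; rewrite -subr_eq0; have := dE y y0; rewrite c0 c'0 /d /sine_odd1 !mul0r addr0 mulr0 => ->.
Unshelve. all: by end_near. Qed.

End ExponentialIntegral.

(** * Odd degrees of freedom *)

Section OddDegrees.
Context {R : realType}.
Implicit Types (x y : R) (i j k m n : nat).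

(* The index i stands for k - 1 in calB_odd. *)
Definition odd_term i y : R := y ^+ i * (eiP y - (-1) ^+ i * eiQ y)
  - \sum_(j < i) j`!%:R * (1 + (-1) ^+ (i + j)) * y ^+ (i - j - 1).

(** Writing T_i for [odd_term i], the identity is y T_i' = i T_i - T_(i+1). The subtracted
    polynomial is what closes the family: the 1/y in P' and Q' produces (1 - (-1)^i) y^i, the term j
    = 0 of the sum in T_(i+1). *)
Lemma der_odd_term i y : 0 < y ->
  is_derive y 1 (odd_term i) ((i%:R * odd_term i y - odd_term i.+1 y) / y).
Proof.
move=> y0; have d1 := der_eiP y y0; have d2 := der_eiQ y y0.
have d3 : is_derive y 1 (fun y => \sum_(j < i) j`!%:R * (1 + (-1) ^+ (i + j)) * y ^+ (i - j - 1))
    (\sum_(j < i) j`!%:R * (1 + (-1) ^+ (i + j)) * ((i - j - 1)%:R * y ^+ (i - j - 1).-1)).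
  by apply: der_sum => j; der_auto; ring.
rewrite /odd_term; der_auto.
rewrite -[LHS](mulfK (lt0r_neq0 y0)); congr (_ / y).
rewrite big_ord_recl /= fact0 mul1r addn0 subn0 subn1 /=.
under [X in _ - (_ - (_ + X))]eq_bigr do rewrite /bump /= add1n addnS addSn 2!exprS !mulN1r opprK subSS.
have Y : i%:R * y ^+ i.-1 * y = i%:R * y ^+ i :> R.
  by case: i {d3} => [|i]; rewrite ?mul0r// -mulrA -exprSr.
have S : (\sum_(j < i) j`!%:R * (1 + (-1) ^+ (i + j)) * ((i - j - 1)%:R * y ^+ (i - j - 1).-1)) * y =
    i%:R * (\sum_(j < i) j`!%:R * (1 + (-1) ^+ (i + j)) * y ^+ (i - j - 1))
    - \sum_(j < i) j.+1`!%:R * (1 + (-1) ^+ (i + j)) * y ^+ (i - j - 1).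
  rewrite mulr_suml mulr_sumr -sumrB; apply: eq_bigr => j _; have ji := ltn_ord j.
  have -> : i%:R = (i - j - 1)%:R + j.+1%:R :> R by rewrite -natrD; congr (_%:R); lia.
  rewrite factS natrM.
  (* At exponent 0 the predecessor is truncated, but then the coefficient is 0. *)
  have Y' : (i - j - 1)%:R * y ^+ (i - j - 1).-1 * y = (i - j - 1)%:R * y ^+ (i - j - 1) :> R.
    by case: (i - j - 1)%N => [|k]; rewrite ?mul0r// -mulrA -exprSr.
  rewrite -mulrA Y'; ring.
rewrite mulrBl S; move: (\sum_(j < i) _) (\sum_(j < i) _) => A B.
rewrite !exprS; set s := (-1) ^+ i; move: (eiP y) (eiQ y) => P Q.
have -> : (i%:R * y ^+ i.-1 * 1 * (P - s * Q) + y ^+ i * (- P + y^-1 - (0 * Q + s * (Q + y^-1)))) * y =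
   (i%:R * y ^+ i.-1 * y) * (P - s * Q) + y ^+ i * (- y * P + y * y^-1 - s * (y * Q + y * y^-1)).
  by ring.
by rewrite Y mulfV ?gt_eqF//; ring.
Qed.

(** With N = 2m + 1 - i both sides are (N + 1) C(N, m): the right one because N C(N-1, m) = (N - m)
    C(N, m) and 2 (N - m) + i = N + 1. The bound on i gives m <= N, so no subtraction is
    truncated. *)
Lemma bin_odd_rec m i : (i <= m.+1)%N ->
  (m.+1 * 'C(2 * m.+1 - i, m.+1) =
  2 * ((2 * m + 1 - i) * 'C(2 * m - i, m)) + i * 'C(2 * m + 1 - i, m))%N.
Proof.
move=> im; have [N NE] : exists N, (2 * m + 1 - i = N)%N by exists (2 * m + 1 - i)%N.
have mN : (m <= N)%N by lia.
have -> : (2 * m.+1 - i = N.+1)%N by lia.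
have -> : (2 * m - i = N.-1)%N by lia.
rewrite NE; have <- := mul_bin_diag N.+1 m; rewrite /= (mul_bin_diag N) mul_bin_left mulnA -mulnDl.
by congr (_ * _)%N; lia.
Qed.

(** The sum of [calB_odd] for nu = 2m + 1, that is a = m + 1, without the common factor
    2^(-(2m+1)). *)
Definition odd_sum m y : R :=
  \sum_(i < m.+1) 'C(2 * m - i, m)%:R * (2 ^+ i / i`!%:R) * odd_term i y.

(** The equation 2a S_(a+1) = (2a - 1) S_a - y S_a' at a = m + 1, in terms of coefficients: by
    [der_odd_term] the subtracted sum is y times the derivative of [odd_sum m]. *)
Lemma odd_sumS m y : odd_sum m.+1 y = 2 / m.+1%:R *
  ((2 * m + 1)%:R * odd_sum m y -
   \sum_(i < m.+1) 'C(2 * m - i, m)%:R * (2 ^+ i / i`!%:R) *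
     (i%:R * odd_term i y - odd_term i.+1 y)).
Proof.
have m0 : m.+1%:R != 0 :> R by rewrite pnatr_eq0.
pose T i := 2 ^+ i / i`!%:R * odd_term i y.
have E : m.+1%:R * odd_sum m.+1 y =
    2 * \sum_(i < m.+2) ((2 * m + 1 - i) * 'C(2 * m - i, m))%:R * T i
    + \sum_(i < m.+2) (i * 'C(2 * m + 1 - i, m))%:R * T i.
  rewrite /odd_sum !mulr_sumr -big_split /=; apply: eq_bigr => i _.
  have := bin_odd_rec m i (ltn_ord i).
  move=> /(congr1 (fun n => n%:R : R)); rewrite natrM natrD (natrM _ 2) => e.
  transitivity (m.+1%:R * 'C(2 * m.+1 - i, m.+1)%:R * T i); first by rewrite /T; ring.
  by rewrite e; ring.
(* The index m + 1 drops out of the first sum: for m = 0 through the linear factor, otherwise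
   through the binomial. *)
have last0 : ((2 * m + 1 - m.+1) * 'C(2 * m - m.+1, m) = 0)%N.
  by case: m {m0 T E} => [//|m]; rewrite bin_small ?muln0//; lia.
move: E; rewrite [X in 2 * X]big_ord_recr /= last0 mul0r addr0.
rewrite [X in _ + X]big_ord_recl /= mul0n mul0r add0r => E.
apply: (mulfI m0); rewrite E mulrA (mulrCA _ 2) mulfV// mulr1.
rewrite /odd_sum [(2 * m + 1)%:R * _]mulr_sumr -sumrB !mulr_sumr -big_split /=; apply: eq_bigr => i _.
have im := ltn_ord i.
have -> : (2 * m + 1 - bump 0 i = 2 * m - i)%N by rewrite /bump/=; lia.
have -> : (2 * m + 1)%:R = (2 * m + 1 - i)%:R + i%:R :> R by rewrite -natrD; congr (_%:R); lia.
rewrite !natrM /bump /= add1n /T exprS factS natrM.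
have i0 : i.+1%:R != 0 :> R by rewrite pnatr_eq0.
have f0 : i`!%:R != 0 :> R by rewrite pnatr_eq0 -lt0n fact_gt0.
move: i0 f0; move: (i.+1%:R) (i`!%:R) (odd_term i y) (odd_term _ y) => a b F G a0 b0.
by field; rewrite a0 b0.
Qed.

Lemma sinI_odd m y : 0 < y ->
  sinI (m%:R + 1) y = (2 ^+ (2 * m + 1))^-1 * odd_sum m y.
Proof.
elim: m y => [|m IH] y y0.
  rewrite add0r sinI1E// /odd_sum big_ord1 /odd_term big_ord0 /= !expr0 fact0 bin0 divr1 subr0 expr1.
  by rewrite !mul1r.
have m1 : 2^-1 < m%:R + 1 :> R by have := ler0n R m; lra.
have [_ d1] := sinI_system _ m1 y y0.
have d2 : is_derive y 1 (odd_sum m)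
    ((\sum_(i < m.+1) 'C(2 * m - i, m)%:R * (2 ^+ i / i`!%:R) *
     (i%:R * odd_term i y - odd_term i.+1 y)) / y).
  rewrite mulr_suml; apply: der_sum => i.
  by have d := der_odd_term i y y0; der_auto; ring.
have d3 : is_derive y 1 (fun y => (2 ^+ (2 * m + 1))^-1 * odd_sum m y)
  ((2 ^+ (2 * m + 1))^-1 * ((\sum_(i < m.+1) 'C(2 * m - i, m)%:R * (2 ^+ i / i`!%:R) *
     (i%:R * odd_term i y - odd_term i.+1 y)) / y)).
  by der_auto; ring.
have := is_derive_uniq _ _ _ _ (is_derive_near_pos _ _ _ _ y0 IH d1) d3.
rewrite IH// odd_sumS -[m.+1%:R]natr1 mulrA => /(mulIf (invr_neq0 (lt0r_neq0 y0))).
have -> : (2 * m.+1 + 1 = (2 * m + 1) + 2)%N by lia.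
rewrite (exprD 2 (2 * m + 1)%N 2) invfM.
move: (\sum_(i < _) _) (odd_sum m y) (sinI _ _) => A B C.
have p0 : (2 ^+ (2 * m + 1))^-1 != 0 :> R by rewrite invr_neq0// expf_neq0.
move: p0; move: (_ ^-1) => p p0 E.
have m0 : 2 * (m%:R + 1) != 0 :> R by have := ler0n R m; lra.
apply: (mulfI m0); move: E; rewrite natrD natrM => E.
transitivity ((2 * (m%:R + 1) - 1) * (p * B) - p * A); first by rewrite -E; ring.
field; have := ler0n R m; lra.
Qed.

Lemma odd_sum_calB m y : 0 < y ->
  \sum_(1 <= k < ((2 * m + 1).+1./2).+1)
      'C(2 * m + 1 - k, (2 * m + 1).-1./2)%:R * ((2 : R) ^ (k%:Z - (2 * m + 1)%N%:Z - 1) / (k.-1)`!%:R)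
      * (y ^+ (k - 1)
           * (expR (- y) * Ei y + (-1) ^+ k * (expR y * Ei (- y)))
         - \sum_(1 <= j < k)
             (j.-1)`!%:R * (1 + (-1) ^+ (k + j)) * y ^+ (k - j - 1)) =
  (2 ^+ (2 * m + 1))^-1 * odd_sum m y.
Proof.
move=> y0.
have -> : ((2 * m + 1).+1./2 = m.+1)%N by rewrite addn1 mul2n -doubleS doubleK.
have -> : ((2 * m + 1).-1./2 = m)%N by rewrite addn1 mul2n doubleK.
rewrite big_add1 big_mkord mulr_sumr; apply: eq_bigr => i _.
have -> : (2 * m + 1 - i.+1 = 2 * m - i)%N by lia.
have -> : i.+1%:Z - (2 * m + 1)%N%:Z - 1 = i%:Z - (2 * m + 1)%N%:Z :> int by lia.
rewrite expfzDr// -exprnP -exprnN.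
rewrite big_add1 /= big_mkord subn1 /= /odd_term exprS mulN1r.
have -> : \sum_(j < i) j`!%:R * (1 + (-1) ^+ (i.+1 + j.+1)) * y ^+ (i.+1 - j.+1 - 1) =
    \sum_(j < i) j`!%:R * (1 + (-1) ^+ (i + j)) * y ^+ (i - j - 1) :> R.
  by apply: eq_bigr => j _; rewrite addnS addSn 2!exprS !mulN1r opprK subSS.
by rewrite -/(eiP y) -/(eiQ y); ring.
Qed.

End OddDegrees.

(** * Densities and expectations *)

Section Density.
Context d (T : measurableType d) (R : realType) (P : probability T R).
Local Notation mu := (@lebesgue_measure R).
Implicit Types (X : {RV P >-> R}) (f g : R -> R).

Lemma bounded_integrable_prob (h : T -> R) c : measurable_fun setT h ->
  (forall w, `|h w| <= c) -> P.-integrable setT (EFin \o h).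
Proof.
move=> mh hc; apply: (dominated_integrableR measurableT (cst c)) => //.
by apply: finite_measure_integrable_cst.
Qed.

(** [has_pdf] gives the law of X on sets. It makes f almost everywhere equal to the Radon-Nikodym
    derivative of the law, which carries the identity from sets to functions. The bound 2 is that of
    1 + cos and 1 + sin. *)
Lemma has_pdf_integral X f g : has_pdf X f -> measurable_fun setT f ->
  (forall x, 0 <= f x) -> measurable_fun setT g -> (forall x, `|g x| <= 2) ->
  (\int[P]_w (g (X w))%:E = \int[mu]_x (g x * f x)%:E)%E.
Proof.
move=> Xf mf f0 mg g2.
have mX : measurable_fun setT (X : T -> measurableTypeR R) by exact: (@measurable_funPT _ _ _ _ X).
(* lebesgue_measure lives on measurableTypeR R, whose display is not that of R,
   so X has to be retyped before Radon-Nikodym applies. *)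
pose Y : {mfun T >-> measurableTypeR R} := @mfun_Sub _ _ T (measurableTypeR R) X (mem_set mX).
have Yf (A : set (measurableTypeR R)) : measurable A ->
  distribution P Y A = (\int[mu]_(x in A) (f x)%:E)%E by exact: Xf.
have mEf : measurable_fun setT (EFin \o f : measurableTypeR R -> _) by exact/measurable_EFinP.
have mEg : measurable_fun setT (EFin \o g : measurableTypeR R -> _) by exact/measurable_EFinP.
have Ig : (distribution P Y).-integrable setT (EFin \o g).
  apply: (dominated_integrableR measurableT (cst 2)) => //.
  exact: finite_measure_integrable_cst.
have IgY : P.-integrable setT ((EFin \o g) \o Y).
  apply: (bounded_integrable_prob (g \o Y) 2); first exact: measurableT_comp.
  by move=> w; exact: g2.
have -> : (\int[P]_w (g (X w))%:E = \int[distribution P Y]_x (g x)%:E)%E.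
  by rewrite (integral_distribution mEg IgY).
have dom : distribution P Y `<< mu.
  apply/null_content_dominatesP => A mA A0; rewrite Yf//.
  by apply: null_set_integral => //; exact: measurable_funTS.
rewrite -(Radon_Nikodym_change_of_variables dom measurableT Ig).
set D := Radon_Nikodym _ _.
have ID : mu.-integrable setT D by exact: Radon_Nikodym_integrable.
have mD : measurable_fun setT D by exact: (measurable_int mu ID).
have Df : ae_eq mu setT D (EFin \o f).
  apply: integral_ae_eq => //.
  by move=> A _ mA; rewrite -Radon_Nikodym_integral// -Yf.
apply: ae_eq_integral => //.
- exact: emeasurable_funM.
- by apply/measurable_EFinP; exact: measurable_funM.
- by move: Df; apply: filterS => x /= /[apply] ->; rewrite EFinM.
Qed.

(** The integral against the density is computed for the nonnegative 1 + g; the total mass 1 is then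
    subtracted on the side of the expectation. *)
Lemma expectation_pdf X f g (v : R) : has_pdf X f -> measurable_fun setT f ->
  (forall x, 0 <= f x) -> measurable_fun setT g -> (forall x, `|g x| <= 1) ->
  (\int[mu]_x ((1 + g x) * f x)%:E = v%:E)%E ->
  fine 'E_P[fun w => g (X w)] = v - 1.
Proof.
move=> Xf mf f0 mg g1 vE.
have mX : measurable_fun setT X by [].
have mgX : measurable_fun setT (fun w => g (X w)) by exact: (measurableT_comp mg mX).
have I1 : P.-integrable setT (EFin \o (fun=> 1 : R)) by exact: finite_measure_integrable_cst.
have Ig : P.-integrable setT (EFin \o (fun w => g (X w))).
  by apply: (bounded_integrable_prob _ 1) => // w; exact: g1.
have m1g : measurable_fun setT (fun x => 1 + g x) by exact: measurable_funD.
have b1g x : `|1 + g x| <= 2.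
  by have := ler_normD 1 (g x); have := g1 x; rewrite normr1; lra.
have := has_pdf_integral X f _ Xf mf f0 m1g b1g; rewrite vE => E.
rewrite expectation.unlock; have : (\int[P]_w (1 + g (X w))%:E = 1 + \int[P]_w (g (X w))%:E)%E.
  under eq_integral do rewrite EFinD.
  rewrite integralD//= integral_cst//= probability_setT mule1 //.
rewrite E => /(congr1 fine); rewrite fineD//; last exact: integrable_fin_num.
by move=> /= ->; rewrite [RHS]addrC addKr.
Qed.

End Density.

(** * The asymmetric Student distribution *)

Section StudentTransforms.
Context {R : realType}.
Local Notation mu := (@lebesgue_measure R).
Local Notation Rpos := (`]0%R, +oo[%classic : set R).
Implicit Types (a b bs nu t x y c : R).

Lemma Kcst_gt0 nu : 0 < nu -> 0 < Kcst nu.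
Proof.
move=> nu0; have h : 0 < (nu + 1) / 2 by rewrite divr_gt0// addr_gt0.
have h' : 0 < nu / 2 by rewrite divr_gt0.
by rewrite /Kcst divr_gt0 ?Gamma_gt0// mulr_gt0 ?Gamma_gt0// sqrtr_gt0 mulr_gt0 ?pi_gt0.
Qed.

(** Either branch of [ast_pdf], extended evenly to the whole line, so that the left half can be
    reflected onto x > 0. *)
Definition half_pdf b bs nu x : R :=
  b / bs * Kcst nu * (1 + nu^-1 * (x / (2 * bs)) ^+ 2) `^ (- ((nu + 1) / 2)).

(** The factor in front of (1 + u^2)^(-a) du after the substitution x = [half_scale bs nu] * u. *)
Definition half_cst b nu : R :=
  2 * b * Gamma ((nu + 1) / 2) / (Num.sqrt pi * Gamma (nu / 2)).

Definition half_scale bs nu : R := 2 * bs * Num.sqrt nu.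

Section Half.
Variables (b bs nu : R) (b0 : 0 < b) (bs0 : 0 < bs) (nu0 : 0 < nu).

Let a := (nu + 1) / 2.
Let c := half_scale bs nu.

Lemma half_scale_gt0 : 0 < half_scale bs nu.
Proof. by rewrite /half_scale !mulr_gt0// sqrtr_gt0. Qed.

Lemma half_pdf_base_gt0 x : 0 < 1 + nu^-1 * (x / (2 * bs)) ^+ 2.
Proof. by rewrite ltr_pwDl// mulr_ge0 ?invr_ge0 ?sqr_ge0 ?ltW. Qed.

Lemma half_pdf_ge0 x : 0 <= half_pdf b bs nu x.
Proof.
have K0 := Kcst_gt0 nu nu0.
by rewrite /half_pdf mulr_ge0 ?powR_ge0// mulr_ge0 ?(ltW K0)// divr_ge0 ?ltW.
Qed.

Lemma half_pdf_scale u : half_pdf b bs nu (c * u) * c = half_cst b nu * tkernel a u.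
Proof.
have s0 : 0 < Num.sqrt nu by rewrite sqrtr_gt0.
have -> : half_pdf b bs nu (c * u) = b / bs * Kcst nu * tkernel a u.
  rewrite /half_pdf /tkernel; congr (_ * (_ `^ _)).
  rewrite -{1}(sqr_sqrtr (ltW nu0)) /c /half_scale; move: (Num.sqrt nu) s0 => s s0.
  by field; rewrite !gt_eqF.
rewrite /c /half_scale /Kcst /half_cst sqrtrM ?pi_ge0// -/a.
have sp : Num.sqrt pi != 0 :> R by rewrite gt_eqF// sqrtr_gt0 pi_gt0.
have g0 : Gamma (nu / 2) != 0 by rewrite gt_eqF// Gamma_gt0// divr_gt0.
move: s0 sp g0; move: (Gamma (nu / 2)) (Gamma a) (Num.sqrt pi) (Num.sqrt nu) (tkernel a u).
by move=> G1 G2 sp s S s0 sp0 G0; field; rewrite G0 sp0 !gt_eqF.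
Qed.

Lemma half_pdf_integral (w : R -> R) : (forall x, {for x, continuous w}) ->
  (forall x, 0 <= w x) ->
  (\int[mu]_(x in Rpos) (w x * half_pdf b bs nu x)%:E =
   \int[mu]_(u in Rpos) (half_cst b nu * (w (c * u) * tkernel a u))%:E)%E.
Proof.
move=> cw w0; have c0 := half_scale_gt0.
rewrite (ge0_subst_scale c _ c0); last first.
- by move=> x _; rewrite mulr_ge0 ?half_pdf_ge0.
- move=> x _; apply: (@continuousM _ _ w (half_pdf b bs nu)); first exact: cw.
  by rewrite /half_pdf; cts_auto; exact: half_pdf_base_gt0.
apply: eq_integral => u _; congr (_%:E).
by rewrite -mulrA half_pdf_scale mulrCA.
Qed.

Lemma half_index_gt : 2^-1 < a.
Proof. by have := nu0; rewrite /a; lra. Qed.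

(** The half with weight b has mass b: alpha on the left and 1 - alpha on the right. *)
Lemma half_cst_tkernel : half_cst b nu * \int[mu]_(u in Rpos) tkernel a u = b.
Proof.
rewrite tkernel_integral; last exact: half_index_gt.
have -> : a - 2^-1 = nu / 2 by rewrite /a; field.
have Ga : Gamma a != 0 by rewrite gt_eqF// Gamma_gt0// (lt_trans _ half_index_gt).
have sp : Num.sqrt pi != 0 :> R by rewrite gt_eqF// sqrtr_gt0 pi_gt0.
have g0 : Gamma (nu / 2) != 0 by rewrite gt_eqF// Gamma_gt0// divr_gt0.
rewrite /half_cst -/a; move: Ga sp g0; move: (Gamma (nu / 2)) (Gamma a) (Num.sqrt pi).
by move=> A B C A0 B0 C0; field; rewrite A0 B0 C0.
Qed.

(* The summand 1 makes the integrand nonnegative, as the change of variables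
   requires. *)
Lemma half_pdf_cos t :
  (\int[mu]_(x in Rpos) ((1 + cos (t * x)) * half_pdf b bs nu x)%:E =
   (b + half_cst b nu * cosI a (t * c))%:E)%E.
Proof.
rewrite half_pdf_integral; last 2 first.
- by move=> x; cts_auto.
- by move=> x; have := cos_geN1 (t * x); lra.
have I := tkernel_integrable a half_index_gt.
have Ic := cos_mul_integrable (tkernel a) (t * c) I.
have -> : (\int[mu]_(u in Rpos) (half_cst b nu * ((1 + cos (t * (c * u))) * tkernel a u))%R%:E =
    \int[mu]_(u in Rpos) (half_cst b nu * tkernel a u + half_cst b nu * (cos (t * c * u) * tkernel a u))%R%:E)%E.
  by apply: eq_integral => u _; congr (_%:E); rewrite ?/k (mulrA t c u); ring.
rewrite integrableR_EFin; [|exact: measurable_Rpos|]; last first.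
  by apply: RposD; exact: RposZl.
congr (_%:E); rewrite RintegralD; [|exact: measurable_Rpos|exact: RposZl|exact: RposZl].
by rewrite !RintegralZl ?half_cst_tkernel//; exact: measurable_Rpos.
Qed.

(** s = 1 serves the right half and s = -1 the left one, where reflecting x changes the sign of the
    sine; in both cases 1 + s sin is nonnegative. *)
Lemma half_pdf_sin s t : s ^+ 2 = 1 ->
  (\int[mu]_(x in Rpos) ((1 + s * sin (t * x)) * half_pdf b bs nu x)%:E =
   (b + s * (half_cst b nu * sinI a (t * c)))%:E)%E.
Proof.
move=> s2; have s1 : `|s| = 1 by apply/eqP; rewrite -sqrp_eq1// real_normK ?num_real// s2.
rewrite half_pdf_integral; last 2 first.
- by move=> x; cts_auto.
- move=> x; have : `|s * sin (t * x)| <= 1.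
    by rewrite normrM s1 mul1r ler_norml sin_geN1 sin_le1.
  by rewrite ler_norml => /andP[]; lra.
have I := tkernel_integrable a half_index_gt.
have Ic := sin_mul_integrable (tkernel a) (t * c) I.
pose k := s * half_cst b nu.
have -> : (\int[mu]_(u in Rpos) (half_cst b nu * ((1 + s * sin (t * (c * u))) * tkernel a u))%R%:E =
    \int[mu]_(u in Rpos) (half_cst b nu * tkernel a u + k * (sin (t * c * u) * tkernel a u))%R%:E)%E.
  by apply: eq_integral => u _; congr (_%:E); rewrite ?/k (mulrA t c u); ring.
rewrite integrableR_EFin; [|exact: measurable_Rpos|]; last first.
  by apply: RposD; exact: RposZl.
congr (_%:E); rewrite RintegralD; [|exact: measurable_Rpos|exact: RposZl|exact: RposZl].
rewrite RintegralZl; [|exact: measurable_Rpos|exact: I].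
rewrite RintegralZl; [|exact: measurable_Rpos|exact: Ic].
by rewrite half_cst_tkernel /sinI /k mulrA.
Qed.

Lemma cosI_norm t : cosI a (t * c) = cosI a (`|t| * c).
Proof.
have [t0|t0] := leP 0 t; first by rewrite ger0_norm.
rewrite ltr0_norm// /cosI; apply: eq_Rintegral => u _.
by rewrite !mulNr cosN.
Qed.

Lemma sinI_sg t : sinI a (t * c) = Num.sg t * sinI a (`|t| * c).
Proof.
have [t0|t0|<-] := ltgtP 0 t; last by rewrite mul0r sgr0 mul0r sinI0.
- by rewrite gtr0_norm// gtr0_sg// mul1r.
- rewrite ltr0_norm// ltr0_sg// mulN1r /sinI -[RHS]mulN1r -RintegralZl; last 2 first.
  + exact: measurable_Rpos.
  + by apply: sin_mul_integrable; exact: tkernel_integrable _ half_index_gt.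
  by apply: eq_Rintegral => u _; rewrite !mulNr sinN !mulNr mul1r opprK.
Qed.

Lemma calA_formulaE t : t != 0 ->
  calA_formula b bs nu t = half_cst b nu * cosI a (t * c).
Proof.
move=> t0; have nt0 : 0 < `|t| by rewrite normr_gt0.
have y0 : 0 < `|t| * c by rewrite mulr_gt0// half_scale_gt0.
have m0 : 0 < nu / 2 by rewrite divr_gt0.
have := cosI_Gamma a (`|t| * c) half_index_gt.
have -> : a - 2^-1 = nu / 2 by rewrite /a; field.
rewrite bessel_kernel_besselK// -cosI_norm /calA_formula => E.
have -> : bs * Num.sqrt nu * `|t| = `|t| * c / 2 by rewrite /c /half_scale; field.
have -> : 2 * bs * Num.sqrt nu * `|t| = `|t| * c by rewrite /c /half_scale; ring.
have sp : Num.sqrt pi != 0 :> R by rewrite gt_eqF// sqrtr_gt0 pi_gt0.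
have g0 : Gamma (nu / 2) != 0 by rewrite gt_eqF// Gamma_gt0.
rewrite /half_cst -/a.
transitivity (2 * b * (Gamma a * cosI a (t * c)) / (Num.sqrt pi * Gamma (nu / 2))); last first.
  by move: (cosI _ _) (Gamma a) (_^-1) => C G S; ring.
rewrite E; move: sp g0; move: (Gamma _) (Num.sqrt pi) (besselK _ _) (_ `^ _) => G s K p s0 G0.
by field; rewrite G0 s0.
Qed.

Lemma calB_formulaE t : t != 0 ->
  calB_formula b bs nu t = half_cst b nu * sinI a (t * c).
Proof.
move=> t0; have nt0 : 0 < `|t| by rewrite normr_gt0.
have y0 : 0 < `|t| * c by rewrite mulr_gt0// half_scale_gt0.
have m0 : 0 < nu / 2 by rewrite divr_gt0.
have yE : 2 * bs * Num.sqrt nu * `|t| = `|t| * c by rewrite /c /half_scale; ring.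
rewrite /calB_formula sinI_sg; case: ifPn => [/andP[/eqP nuE on]|nodd].
  have [m nE] : exists m, Num.truncn nu = (2 * m + 1)%N.
    by exists (Num.truncn nu)./2; rewrite -[LHS]odd_double_half on mul2n addnC.
  have {}nuE : nu = (2 * m + 1)%:R by rewrite -nE.
  have aE : a = m%:R + 1 by rewrite /a nuE natrD natrM; field.
  rewrite nE /calB_odd; cbv zeta; rewrite -nuE yE odd_sum_calB// -sinI_odd// -aE /half_cst -/a.
  by move: (sinI _ _) (Gamma _) (Gamma _) => S G1 G2; rewrite invfM; ring.
have am : a = nu / 2 + 2^-1 by rewrite /a; field.
(* If a were an integer k, then nu = 2k - 1 would be odd, the excluded case; k = 0 contradicts nu >
   0. *)
have nn : nonnat (nu / 2 + 2^-1).
  move=> k; apply: contra nodd => /eqP ak.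
  have nuE : nu = 2 * k%:R - 1 by rewrite -ak; field.
  case: k {ak} nuE => [|k] nuE; first by move: nu0; rewrite nuE mulr0; lra.
  have {}nuE : nu = (2 * k + 1)%:R by rewrite nuE natrD natrM -natr1; ring.
  by rewrite nuE natrK eqxx/= addn1 /= mul2n odd_double.
have := sinI_bessel_struve (nu / 2) (`|t| * c) m0 nn y0.
have := Gamma_reflection_half (nu / 2) nn m0.
rewrite -am /calB_generic yE => C E.
(* A zero cosine would turn the reflection formula into 0 = pi. *)
have cos0 : cos (pi * (nu / 2)) != 0.
  apply/eqP => c0; move: C; rewrite c0 mulr0 => /esym/eqP.
  by rewrite gt_eqF ?pi_gt0.
have -> : bs * Num.sqrt nu * `|t| = `|t| * c / 2 by rewrite /c /half_scale; field.
have sp : Num.sqrt pi != 0 :> R by rewrite gt_eqF// sqrtr_gt0 pi_gt0.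
have g0 : Gamma (nu / 2) != 0 by rewrite gt_eqF// Gamma_gt0.
rewrite -[pi * nu / 2]mulrA.
rewrite /half_cst -/a.
transitivity (2 * b * Num.sg t * (Gamma a * cos (pi * (nu / 2)) * sinI a (`|t| * c)) /
  (Num.sqrt pi * Gamma (nu / 2) * cos (pi * (nu / 2)))).
  rewrite E; move: sp g0 cos0; move: (Gamma _) (Num.sqrt pi) (besselI _ _) (struveL _ _) (_ `^ _) (cos _).
  by move=> G s I L p C' s0 G0 C0; field; rewrite G0 s0 C0.
move: sp g0 cos0; move: (Gamma a) (Gamma _) (Num.sqrt pi) (sinI _ _) (cos _).
by move=> Ga G s S C' s0 G0 C0; field; rewrite G0 s0 C0.
Qed.

End Half.

Lemma extend_at0_cts (f g : R -> R) : {for 0, continuous g} ->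
  (forall t, t != 0 -> f t = g t) ->
  cvg (f t @[t --> 0^']) /\ forall t, extend_at0 f t = g t.
Proof.
move=> cg fg; have L : f t @[t --> 0^'] --> g 0.
  have Lg : g t @[t --> 0^'] --> g 0 by apply: cvg_within_filter; exact: cg.
  apply: cvg_trans Lg; apply: near_eq_cvg.
  by near=> t; rewrite fg//; near: t; exact: nbhs_dnbhs_neq.
split; first by apply/cvg_ex; exists (g 0).
move=> t; rewrite /extend_at0; case: eqP => [->|/eqP/fg//].
exact/cvg_lim.
Unshelve. all: by end_near. Qed.

End StudentTransforms.

Section Asymmetric.
Context {R : realType}.
Local Notation mu := (@lebesgue_measure R).
Local Notation Rpos := (`]0%R, +oo[%classic : set R).
Implicit Types (b bs nu t x : R).

Lemma half_pdfN b bs nu x : half_pdf b bs nu (- x) = half_pdf b bs nu x.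
Proof. by rewrite /half_pdf mulNr sqrrN. Qed.

Lemma measurable_half_pdf b bs nu : measurable_fun setT (half_pdf b bs nu).
Proof. by rewrite /half_pdf; repeat meas_step. Qed.

Variables (alpha nu1 nu2 : R) (alpha0 : 0 < alpha) (alpha1 : alpha < 1).
Variables (nu1_gt0 : 0 < nu1) (nu2_gt0 : 0 < nu2).

Let alphas := alpha_star alpha nu1 nu2.

Lemma alpha_star_gt0 : 0 < alphas.
Proof.
have k1 := Kcst_gt0 nu1 nu1_gt0; have k2 := Kcst_gt0 nu2 nu2_gt0.
by rewrite /alphas /alpha_star divr_gt0 ?addr_gt0// mulr_gt0// subr_gt0.
Qed.

Lemma alpha_star_lt1 : alphas < 1.
Proof.
have k1 := Kcst_gt0 nu1 nu1_gt0; have k2 := Kcst_gt0 nu2 nu2_gt0.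
have h : 0 < (1 - alpha) * Kcst nu2 by rewrite mulr_gt0// subr_gt0.
by rewrite /alphas /alpha_star ltr_pdivrMr ?mul1r ?ltrDl// addr_gt0// mulr_gt0.
Qed.

Let f := ast_pdf alpha nu1 nu2.
Let f1 := half_pdf alpha alphas nu1.
Let f2 := half_pdf (1 - alpha) (1 - alphas) nu2.

Lemma ast_pdfE x : f x = if x <= 0 then f1 x else f2 x.
Proof. by []. Qed.

Lemma measurable_ast_pdf : measurable_fun setT f.
Proof.
apply: (measurable_fun_ifT (f := fun x => x <= 0) (g := f1) (h := f2)).
- exact: measurable_fun_ler.
- exact: measurable_half_pdf.
- exact: measurable_half_pdf.
Qed.

Let f1_ge0 x : 0 <= f1 x.
Proof. by apply: half_pdf_ge0 => //; exact: alpha_star_gt0. Qed.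

Let f2_ge0 x : 0 <= f2 x.
Proof. by apply: half_pdf_ge0 => //; rewrite subr_gt0//; exact: alpha_star_lt1. Qed.

Lemma ast_pdf_ge0 x : 0 <= f x.
Proof. by rewrite ast_pdfE; case: ifP. Qed.

Lemma ast_pdf_integral (w : R -> R) : measurable_fun setT w -> (forall x, 0 <= w x) ->
  (\int[mu]_x (w x * f x)%:E =
   \int[mu]_(x in Rpos) (w x * f2 x)%:E + \int[mu]_(x in Rpos) (w (- x) * f1 x)%:E)%E.
Proof.
move=> mw w0; have mf := measurable_ast_pdf.
have mwN : measurable_fun setT (fun x => w (- x)).
  by apply: (@measurableT_comp _ _ _ _ _ _ w _ (@GRing.opp R)).
rewrite (ge0_integralT_split (fun x => w x * f x)); last 2 first.
- exact: measurable_funM.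
- by move=> x; rewrite mulr_ge0 ?ast_pdf_ge0.
rewrite -ge0_integralD; first last.
- by apply/measurable_EFinP/measurable_funTS/measurable_funM => //; exact: measurable_half_pdf.
- by move=> x _; rewrite lee_fin mulr_ge0.
- by apply/measurable_EFinP/measurable_funTS/measurable_funM => //; exact: measurable_half_pdf.
- by move=> x _; rewrite lee_fin mulr_ge0.
- exact: measurable_Rpos.
apply: eq_integral => x; rewrite inE RposP => x0.
by rewrite !ast_pdfE leNgt x0/= oppr_le0 (ltW x0) /f1 half_pdfN -EFinD.
Qed.

Context d (T : measurableType d) (P : probability T R) (X : {RV P >-> R}).
Hypothesis Xpdf : has_pdf X f.

Let c1 := half_scale alphas nu1.
Let c2 := half_scale (1 - alphas) nu2.
Let A1 t := half_cst alpha nu1 * cosI ((nu1 + 1) / 2) (t * c1).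
Let A2 t := half_cst (1 - alpha) nu2 * cosI ((nu2 + 1) / 2) (t * c2).
Let B1 t := half_cst alpha nu1 * sinI ((nu1 + 1) / 2) (t * c1).
Let B2 t := half_cst (1 - alpha) nu2 * sinI ((nu2 + 1) / 2) (t * c2).

Lemma expectation_cos t : fine 'E_P[fun w => cos (t * X w)] = A1 t + A2 t.
Proof.
have s0 := alpha_star_gt0; have s1 : 0 < 1 - alphas by rewrite subr_gt0 alpha_star_lt1.
have a0' : 0 < 1 - alpha by rewrite subr_gt0.
have mc : measurable_fun setT (fun x => cos (t * x)) by repeat meas_step.
have h := half_pdf_cos _ _ _ a0' s1 nu2_gt0 t.
have h' := half_pdf_cos _ _ _ alpha0 s0 nu1_gt0 t.
rewrite (expectation_pdf _ _ _ P X f (fun x => cos (t * x)) (1 + (A1 t + A2 t)) Xpdf) //.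
- by rewrite addrC addKr.
- exact: measurable_ast_pdf.
- exact: ast_pdf_ge0.
- by move=> x; rewrite ler_norml cos_geN1 cos_le1.
- rewrite (ast_pdf_integral (fun x => 1 + cos (t * x))); last 2 first.
  + exact: measurable_funD.
  + by move=> x; have := cos_geN1 (t * x); lra.
  rewrite h; under eq_integral do rewrite mulrN cosN.
  rewrite h' -EFinD; congr (_%:E); rewrite -/(A1 t) -/(A2 t); move: (A1 t) (A2 t) => u v; ring.
Qed.

Lemma expectation_sin t : fine 'E_P[fun w => sin (t * X w)] = B2 t - B1 t.
Proof.
have s0 := alpha_star_gt0; have s1 : 0 < 1 - alphas by rewrite subr_gt0 alpha_star_lt1.
have a0' : 0 < 1 - alpha by rewrite subr_gt0.
have mc : measurable_fun setT (fun x => sin (t * x)) by repeat meas_step.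
have h := half_pdf_sin _ _ _ a0' s1 nu2_gt0 1 t (expr1n _ _).
have h' := half_pdf_sin _ _ _ alpha0 s0 nu1_gt0 (- 1) t (etrans (sqrrN 1) (expr1n _ _)).
rewrite (expectation_pdf _ _ _ P X f (fun x => sin (t * x)) (1 + (B2 t - B1 t)) Xpdf) //.
- by rewrite addrC addKr.
- exact: measurable_ast_pdf.
- exact: ast_pdf_ge0.
- by move=> x; rewrite ler_norml sin_geN1 sin_le1.
- rewrite (ast_pdf_integral (fun x => 1 + sin (t * x))); last 2 first.
  + exact: measurable_funD.
  + by move=> x; have := sin_geN1 (t * x); lra.
  under eq_integral do rewrite -[sin _]mul1r.
  rewrite h.
  under eq_integral do rewrite mulrN sinN -mulN1r.
  rewrite h' -EFinD; congr (_%:E); rewrite -/(B1 t) -/(B2 t); move: (B1 t) (B2 t) => u v; ring.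
Qed.

End Asymmetric.

(** * Existence and values of the limits at t = 0 *)

Section LimitsAtZero.
Context {R : realType}.
Variables (b bs nu : R) (bs0 : 0 < bs) (nu0 : 0 < nu).

Lemma calA_limit : cvg (calA_formula b bs nu t @[t --> 0^']) /\
  forall t, calA b bs nu t = half_cst b nu * cosI ((nu + 1) / 2) (t * half_scale bs nu).
Proof.
apply: extend_at0_cts => [|t t0]; last exact: calA_formulaE.
apply: (@continuousM _ _ (cst _)); first exact: cst_continuous.
apply: (@continuous_comp _ _ _ (fun t : R => t * half_scale bs nu) (cosI ((nu + 1) / 2))).
  by cts_auto.
by apply: cts_cosI; exact: half_index_gt.
Qed.

Lemma calB_limit : cvg (calB_formula b bs nu t @[t --> 0^']) /\
  forall t, calB b bs nu t = half_cst b nu * sinI ((nu + 1) / 2) (t * half_scale bs nu).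
Proof.
apply: extend_at0_cts => [|t t0]; last exact: calB_formulaE.
apply: (@continuousM _ _ (cst _)); first exact: cst_continuous.
apply: (@continuous_comp _ _ _ (fun t : R => t * half_scale bs nu) (sinI ((nu + 1) / 2))).
  by cts_auto.
by apply: cts_sinI; exact: half_index_gt.
Qed.

End LimitsAtZero.

Local Open Scope complex_scope.

Theorem theorem3p1 (R : realType) (d : measure_display) (T : measurableType d)
    (P : probability T R) (X : {RV P >-> R}) (alpha nu1 nu2 : R)
    (alpha_gt0 : 0 < alpha) (alpha_lt1 : alpha < 1)
    (nu1_gt0 : 0 < nu1) (nu2_gt0 : 0 < nu2)
    (Xpdf : has_pdf X (ast_pdf alpha nu1 nu2)) :
  let alphas := alpha_star alpha nu1 nu2 in
  [/\ cvg (calA_formula alpha alphas nu1 t @[t --> 0^']),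
      cvg (calA_formula (1 - alpha) (1 - alphas) nu2 t @[t --> 0^']),
      cvg (calB_formula alpha alphas nu1 t @[t --> 0^']) &
      cvg (calB_formula (1 - alpha) (1 - alphas) nu2 t @[t --> 0^'])] /\
  forall t : R,
    charfun X t =
      (calA alpha alphas nu1 t + calA (1 - alpha) (1 - alphas) nu2 t)
      +i* (calB (1 - alpha) (1 - alphas) nu2 t - calB alpha alphas nu1 t).
Proof.
move=> alphas.
have s0 : 0 < alphas by exact: alpha_star_gt0.
have s1 : 0 < 1 - alphas by rewrite subr_gt0; exact: alpha_star_lt1.
have [cA1 EA1] := calA_limit alpha alphas nu1 s0 nu1_gt0.
have [cA2 EA2] := calA_limit (1 - alpha) (1 - alphas) nu2 s1 nu2_gt0.
have [cB1 EB1] := calB_limit alpha alphas nu1 s0 nu1_gt0.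
have [cB2 EB2] := calB_limit (1 - alpha) (1 - alphas) nu2 s1 nu2_gt0.
split=> [//|t]; rewrite EA1 EA2 EB1 EB2 /charfun /cexpectation /=.
congr (_ +i* _).
- exact: expectation_cos.
- exact: expectation_sin.
Qed.
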